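(* Let $\alpha,\beta,\theta\in\mathbb{C}$ satisfy $0\le \operatorname{Re}\theta<1$, $-1<\operatorname{Re}\alpha<1$, $\alpha\neq 0$, $\operatorname{Re}\beta>-1$. Let $p,q$ be admissible indices and let $\Phi_p,\Phi_q$ be the piecewise hypergeometric functions on $[0,\infty)$ defined in the context. Then, with respect to the symmetric bilinear form $$\{f,g\}=\int_0^1 f(x)g(x)(1-x)^\alpha x^\beta\,dx+\frac{\sin((\alpha+\theta)\pi)}{\sin(\theta\pi)}\int_1^\infty f(x)g(x)(x-1)^\alpha x^\beta\,dx ,$$ one has $$\{\Phi_p,\Phi_q\}=0\qquad\text{for } p\neq q,$$ and $$\{\Phi_p,\Phi_p\}=\frac{\Gamma(2p+\alpha+\beta+2)^2\,\Gamma(1+p+\alpha)\,\Gamma(p+1)}{(2p+\alpha+\beta+1)\,\Gamma(p+\beta+1)\,\Gamma(p+\alpha+\beta+1)} .$$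
   Context: $F[a,b;c;x]={}_2F_1(a,b;c;x)$ is the Gauss hypergeometric function, and $1/\Gamma$ is taken to be $0$ at the poles of $\Gamma$. Admissible indices: $p\in\mathbb{C}$ with $p-\theta\in\mathbb{Z}$, $\operatorname{Re}(2p+\alpha+\beta+1)>0$ and $1+p+\alpha\notin\{0,-1,-2,\dots\}$. For an admissible $p$, the function $\Phi_p$ on $[0,\infty)$ is defined by $$\Phi_p(x)=\frac{\Gamma(2p+\alpha+\beta+2)}{\Gamma(\beta+1)}\,F\left[-p,\;p+\alpha+\beta+1;\;\beta+1;\;x\right]\qquad (0\le x<1),$$ $$\Phi_p(x)=\frac{\Gamma(1+p+\alpha)}{\Gamma(-p)}\,F\left[p+\alpha+1,\;p+\alpha+\beta+1;\;2p+\alpha+\beta+2;\;\tfrac1x\right]x^{-\alpha-\beta-p-1}\qquad (x>1).$$ Convention for $\theta=0$: the indices $p$ are restricted to nonnegative integers; then $\Phi_p$ vanishes on $(1,\infty)$ (because $1/\Gamma(-p)=0$) and the second term of the form $\{\cdot,\cdot\}$ is understood to be $0$. *)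

(* Defs.v *)
From Stdlib Require Export Reals Factorial.
From Coquelicot Require Export Coquelicot.

Open Scope R_scope.
Open Scope C_scope.

(* Limits and sums of complex sequences are taken componentwise; like Lim_seq
   and Series, they carry no information when the sequence diverges. *)
Definition CLim_seq (u : nat -> C) : C :=
  (real (Lim_seq (fun n => Re (u n))), real (Lim_seq (fun n => Im (u n)))).

Definition CSeries (u : nat -> C) : C :=
  (Series (fun n => Re (u n)), Series (fun n => Im (u n))).

Definition Cexp (z : C) : C :=
  RtoC (exp (Re z)) * (cos (Im z), sin (Im z)).

Definition Csin (z : C) : C := (Cexp (Ci * z) - Cexp (- (Ci * z))) / (2 * Ci).

(* x ^ z for a positive real x, with the real logarithm. *)
Definition Rcpow (x : R) (z : C) : C := Cexp (z * RtoC (ln x)).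

Fixpoint poch (a : C) (n : nat) : C :=
  match n with
  | O => 1
  | S m => poch a m * (a + RtoC (INR m))
  end.

(* The entire function 1/Gamma, by Gauss's product formula
     1/Gamma(z) = lim_n  z (z + 1) ... (z + n) / (n! n^z);
   it vanishes exactly at z = 0, -1, -2, ... *)
Definition rGamma (z : C) : C :=
  CLim_seq (fun n =>
    poch z (S n) / (RtoC (INR (fact n)) * Rcpow (INR n) z)).

(* Only meaningful off the poles 0, -1, -2, ...; a factor 1/Gamma(z) for which
   z may be a pole has to be written rGamma z. *)
Definition Gamma (z : C) : C := / rGamma z.

(* The Gauss series, for |x| < 1 and c not in {0, -1, -2, ...}. *)
Definition F (a b c x : C) : C :=
  CSeries (fun n =>
    poch a n * poch b n / (poch c n * RtoC (INR (fact n))) * Cpow x n).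

(* The last clause is the restriction on the indices made when theta = 0. *)
Definition admissible (theta alpha beta p : C) : Prop :=
  (exists k : Z, p - theta = RtoC (IZR k)) /\
  (0 < Re (2 * p + alpha + beta + 1))%R /\
  (forall n : nat, 1 + p + alpha <> - RtoC (INR n)) /\
  (theta = 0 -> exists n : nat, p = RtoC (INR n)).

(* Only the values at 0 <= x < 1 and at x > 1 matter; 0 at x = 1 is a filler. *)
Definition Phi (alpha beta p : C) (x : R) : C :=
  if Rlt_dec x 1 then
    Gamma (2 * p + alpha + beta + 2) / Gamma (beta + 1)
      * F (- p) (p + alpha + beta + 1) (beta + 1) (RtoC x)
  else if Rlt_dec 1 x then
    Gamma (1 + p + alpha) * rGamma (- p)
      * F (p + alpha + 1) (p + alpha + beta + 1) (2 * p + alpha + beta + 2)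
          (RtoC (1 / x))
      * Rcpow x (- alpha - beta - p - 1)
  else 0.

(* [is_form theta alpha beta f g v] : both integrals in the form {f, g}
   converge, as improper integrals at each of their endpoints, and {f, g} = v.
   The second term J is 0 by convention when theta = 0, where its coefficient
   has a vanishing denominator. *)
Definition is_form (theta alpha beta : C) (f g : R -> C) (v : C) : Prop :=
  exists I J : C,
    is_RInt_gen (V := C_R_NormedModule)
      (fun x => f x * g x * Rcpow (1 - x) alpha * Rcpow x beta)
      (at_right 0) (at_left 1) I /\
    (theta = 0 -> J = 0) /\
    (theta <> 0 -> exists K : C,
       is_RInt_gen (V := C_R_NormedModule)
         (fun x => f x * g x * Rcpow (x - 1) alpha * Rcpow x beta)
         (at_right 1) (Rbar_locally p_infty) K /\
       J = Csin ((alpha + theta) * PI) / Csin (theta * PI) * K) /\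
    v = I + J.

(* Main.v *)
(* On each of (0,1) and (1,oo), after x |-> 1/x on the latter, Phi_p is a Gauss
   series F = F[a,b;c;.] with a + b - c = alpha.  The bilinear concomitant (weighted
   Wronskian) of Phi_p and Phi_q is an antiderivative of a multiple
   (p - q)(p + q + alpha + beta + 1) of the integrand; it vanishes at 0 and oo, so
   everything is decided by its limits at 1.  These are expressed through
     lim (1-x)^(alpha+1) F'            (comparison of coefficients with a binomial series),
     lim ((1-x) F' - alpha F)          (= const * F[a,b;c+1;1], Gauss's summation),
   because alpha F is the difference of (1-x) F' and the second quantity; no connection
   formula is needed.  Gauss's product turns the limits into values of 1/Gamma, and the
   reflection formula, which follows from F[z,-z;1/2;sin^2 t] = cos(2zt) and Gauss's
   summation at t -> pi/2, makes the two contributions at 1 cancel for p <> q.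
   The norm is the limit of {Phi_p, Phi_(p+e)} as e -> 0+; the passage to the limit rests
   on coefficient bounds which are Lipschitz in the index. *)
Require Import Defs.
From Stdlib Require Import Lra Lia Psatz.

(** * Limits of complex functions along a filter *)

(** The concomitant identity has to be divided by (p - q)(p + q + alpha + beta + 1), which excludes
    p = q; hence the perturbation of the index. Replacing p by p + e keeps a + b - c = alpha, so
    that only series with the same singular exponent at 1 are compared and one integrable weight x^u
    (1 - x)^(-v) dominates all errors. At 1 the series F itself may blow up, converge or oscillate,
    depending on alpha, whereas (1 - x)^(alpha + 1) F' and (1 - x) F' - alpha F both converge for -1
    < Re alpha < 1; the price is a division by alpha, where alpha <> 0 enters. After reflection the
    boundary terms are multiples of sin((q + alpha) pi) - kappa sin(q pi), one for each index, and
    kappa = sin((alpha + theta) pi) / sin(theta pi) is the constant that annihilates this at every q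
    in theta + Z. At p + e the same expression has a first-order zero in e, as has the divisor, and
    their quotient gives the norm. For theta = 0, where kappa is undefined, 1/Gamma(-p - e) supplies
    the first-order zero. *)

Definition Clim {T : Type} (Fl : (T -> Prop) -> Prop) (f : T -> C) (l : C) : Prop :=
  forall eps : R, 0 < eps -> Fl (fun x => Cmod (f x - l) < eps).

Lemma im_le_Cmod (z : C) : Rabs (Im z) <= Cmod z.
Proof. apply Rle_trans with (2 := Rmax_Cmod z); apply Rmax_r. Qed.

Lemma Cmod_le_ReIm (z : C) : Cmod z <= Rabs (Re z) + Rabs (Im z).
Proof.
  destruct z as [x y]; simpl.
  replace (x, y) with (RtoC x + Ci * RtoC y)%C.
  - apply Rle_trans with (1 := Cmod_triangle _ _).
    rewrite Cmod_mult, Cmod_Ci, !Cmod_R; lra.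
  - unfold RtoC, Ci, Cplus, Cmult; simpl; f_equal; ring.
Qed.

Lemma Cmod_sym (x y : C) : Cmod (x - y) = Cmod (y - x).
Proof. rewrite <- Cmod_opp; f_equal; ring. Qed.

Lemma Cmod_minus_ge (x y : C) : Cmod x - Cmod y <= Cmod (x - y).
Proof.
  pose proof (Cmod_triangle (x - y) y) as H.
  replace (x - y + y) with x in H by ring; lra.
Qed.

Lemma Cmod_minus_le (x y : C) : Cmod (x - y) <= Cmod x + Cmod y.
Proof. unfold Cminus; rewrite <- (Cmod_opp y); apply Cmod_triangle. Qed.

Section Clim_theory.

Context {T : Type} {Fl : (T -> Prop) -> Prop} {FF : Filter Fl}.

Lemma Clim_ext_loc (f g : T -> C) (l : C) :
  Fl (fun x => f x = g x) -> Clim Fl f l -> Clim Fl g l.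
Proof.
  intros Hfg Hf eps He.
  generalize (filter_and _ _ Hfg (Hf eps He)); apply filter_imp.
  intros x [<- H]; exact H.
Qed.

Lemma Clim_ext (f g : T -> C) (l : C) :
  (forall x, f x = g x) -> Clim Fl f l -> Clim Fl g l.
Proof. intros H; apply Clim_ext_loc, filter_forall, H. Qed.

Lemma Clim_val (f : T -> C) (l m : C) : l = m -> Clim Fl f l -> Clim Fl f m.
Proof. now intros ->. Qed.

Lemma Clim_const (c : C) : Clim Fl (fun _ => c) c.
Proof.
  intros eps He; apply filter_forall; intros _.
  replace (c - c) with (RtoC 0) by ring; rewrite Cmod_0; exact He.
Qed.

Lemma Clim_plus (f g : T -> C) (l m : C) :
  Clim Fl f l -> Clim Fl g m -> Clim Fl (fun x => f x + g x) (l + m).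
Proof.
  intros Hf Hg eps He.
  assert (He2 : 0 < eps / 2) by lra.
  generalize (filter_and _ _ (Hf _ He2) (Hg _ He2)); apply filter_imp.
  intros x [H1 H2].
  replace (f x + g x - (l + m)) with ((f x - l) + (g x - m)) by ring.
  pose proof (Cmod_triangle (f x - l) (g x - m)); lra.
Qed.

Lemma Clim_dominated (f : T -> C) (g : T -> R) (l : C) :
  Fl (fun x => Cmod (f x - l) <= g x) -> filterlim g Fl (locally 0%R) ->
  Clim Fl f l.
Proof.
  intros Hf Hg eps He.
  assert (H : Fl (fun x => Rabs (g x) < eps)).
  { apply (Hg (fun y => Rabs y < eps)).
    exists (mkposreal eps He); intros y Hy.
    change (Rabs (y - 0) < eps) in Hy; now rewrite Rminus_0_r in Hy. }
  generalize (filter_and _ _ Hf H); apply filter_imp.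
  intros x [H1 H2]; apply Rle_lt_trans with (1 := H1).
  apply Rle_lt_trans with (2 := H2), Rle_abs.
Qed.

Lemma Clim_bounded_mult_0 (f g : T -> C) (M : R) :
  Fl (fun x => Cmod (f x) <= M) -> Clim Fl g 0 ->
  Clim Fl (fun x => f x * g x) 0.
Proof.
  intros Hf Hg eps He.
  assert (HM : 0 < Rabs M + 1) by (pose proof (Rabs_pos M); lra).
  assert (He2 : 0 < eps / (Rabs M + 1)) by (now apply Rdiv_lt_0_compat).
  generalize (filter_and _ _ Hf (Hg _ He2)); apply filter_imp.
  intros x [H1 H2].
  replace (g x - 0) with (g x) in H2 by ring.
  replace (f x * g x - 0) with (f x * g x) by ring.
  rewrite Cmod_mult.
  apply Rle_lt_trans with ((Rabs M + 1) * Cmod (g x))%R.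
  - apply Rmult_le_compat_r; [apply Cmod_ge_0 |].
    pose proof (Rle_abs M); lra.
  - apply Rlt_le_trans with ((Rabs M + 1) * (eps / (Rabs M + 1)))%R.
    + now apply Rmult_lt_compat_l.
    + right; field; lra.
Qed.

Lemma Clim_sub_0 (f : T -> C) (l : C) :
  Clim Fl f l -> Clim Fl (fun x => f x - l) 0.
Proof.
  intros H eps He; generalize (H eps He); apply filter_imp; intros x.
  replace (f x - l - 0) with (f x - l) by ring; auto.
Qed.

Lemma Clim_of_sub_0 (f : T -> C) (l : C) :
  Clim Fl (fun x => f x - l) 0 -> Clim Fl f l.
Proof.
  intros H eps He; generalize (H eps He); apply filter_imp; intros x.
  replace (f x - l - 0) with (f x - l) by ring; auto.
Qed.

Lemma Clim_bounded (f : T -> C) (l : C) :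
  Clim Fl f l -> Fl (fun x => Cmod (f x) <= Cmod l + 1).
Proof.
  intros H; generalize (H 1%R Rlt_0_1); apply filter_imp; intros x Hx.
  pose proof (Cmod_minus_ge (f x) l); lra.
Qed.

Lemma Clim_mult (f g : T -> C) (l m : C) :
  Clim Fl f l -> Clim Fl g m -> Clim Fl (fun x => f x * g x) (l * m).
Proof.
  intros Hf Hg; apply Clim_of_sub_0.
  apply Clim_ext with (fun x => f x * (g x - m) + m * (f x - l)).
  { intros x; ring. }
  replace (RtoC 0) with (0 + 0) by ring.
  apply Clim_plus.
  - apply Clim_bounded_mult_0 with (1 := Clim_bounded _ _ Hf), Clim_sub_0, Hg.
  - apply Clim_bounded_mult_0 with (Cmod m).
    + apply filter_forall; intros _; lra.
    + apply Clim_sub_0, Hf.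
Qed.

Lemma Clim_scal (c : C) (f : T -> C) (l : C) :
  Clim Fl f l -> Clim Fl (fun x => c * f x) (c * l).
Proof. apply Clim_mult, Clim_const. Qed.

Lemma Clim_opp (f : T -> C) (l : C) :
  Clim Fl f l -> Clim Fl (fun x => - f x) (- l).
Proof.
  intros H; replace (- l) with (- (1) * l) by ring.
  apply Clim_ext with (fun x => - (1) * f x); [intros x; ring |].
  now apply Clim_scal.
Qed.

Lemma Clim_minus (f g : T -> C) (l m : C) :
  Clim Fl f l -> Clim Fl g m -> Clim Fl (fun x => f x - g x) (l - m).
Proof. intros Hf Hg; apply Clim_plus; [exact Hf | now apply Clim_opp]. Qed.

Lemma Clim_away (f : T -> C) (l : C) :
  l <> 0 -> Clim Fl f l -> Fl (fun x => Cmod l / 2 <= Cmod (f x)).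
Proof.
  intros Hl H; apply Cmod_gt_0 in Hl.
  assert (He : 0 < Cmod l / 2) by lra.
  generalize (H _ He); apply filter_imp; intros x Hx.
  pose proof (Cmod_minus_ge l (f x)) as H1.
  rewrite Cmod_sym in H1; lra.
Qed.

Lemma Clim_neq (f : T -> C) (l : C) :
  l <> 0 -> Clim Fl f l -> Fl (fun x => f x <> 0).
Proof.
  intros Hl H; generalize (Clim_away _ _ Hl H); apply filter_imp; intros x Hx E.
  apply Cmod_gt_0 in Hl; rewrite E, Cmod_0 in Hx; lra.
Qed.

Lemma Clim_inv (f : T -> C) (l : C) :
  l <> 0 -> Clim Fl f l -> Clim Fl (fun x => / f x) (/ l).
Proof.
  intros Hl Hf; apply Clim_of_sub_0.
  pose proof (proj1 (Cmod_gt_0 l) Hl) as Hl'.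
  apply Clim_ext_loc with (fun x => (- / (f x * l)) * (f x - l)).
  { generalize (Clim_neq _ _ Hl Hf); apply filter_imp; intros x Hx.
    field; auto. }
  apply Clim_bounded_mult_0 with (/ (Cmod l / 2 * Cmod l))%R.
  - generalize (filter_and _ _ (Clim_neq _ _ Hl Hf) (Clim_away _ _ Hl Hf)).
    apply filter_imp; intros x [H1 H2].
    rewrite Cmod_opp, Cmod_inv, Cmod_mult.
    + apply Rinv_le_contravar; [apply Rmult_lt_0_compat; lra |].
      apply Rmult_le_compat_r; lra.
    + now apply Cmult_neq_0.
  - apply Clim_sub_0, Hf.
Qed.

Lemma Clim_div (f g : T -> C) (l m : C) :
  m <> 0 -> Clim Fl f l -> Clim Fl g m -> Clim Fl (fun x => f x / g x) (l / m).
Proof. intros Hm Hf Hg; apply Clim_mult; [exact Hf | now apply Clim_inv]. Qed.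

Lemma Clim_Re (f : T -> C) (l : C) :
  Clim Fl f l -> filterlim (fun x => Re (f x)) Fl (locally (Re l)).
Proof.
  intros H P [eps HP]; unfold filtermap.
  generalize (H eps (cond_pos eps)); apply filter_imp; intros x Hx.
  apply HP, Rle_lt_trans with (2 := Hx), (re_le_Cmod (f x - l)).
Qed.

Lemma Clim_Im (f : T -> C) (l : C) :
  Clim Fl f l -> filterlim (fun x => Im (f x)) Fl (locally (Im l)).
Proof.
  intros H P [eps HP]; unfold filtermap.
  generalize (H eps (cond_pos eps)); apply filter_imp; intros x Hx.
  apply HP, Rle_lt_trans with (2 := Hx), (im_le_Cmod (f x - l)).
Qed.

Lemma filterlim_R_eps (f : T -> R) (l eps : R) :
  0 < eps -> filterlim f Fl (locally l) ->
  Fl (fun x => Rabs (f x - l) < eps).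
Proof.
  intros He H; apply (H (fun y => Rabs (y - l) < eps)).
  exists (mkposreal eps He); intros y Hy; exact Hy.
Qed.

Lemma Clim_of_ReIm (f : T -> C) (l : C) :
  filterlim (fun x => Re (f x)) Fl (locally (Re l)) ->
  filterlim (fun x => Im (f x)) Fl (locally (Im l)) -> Clim Fl f l.
Proof.
  intros H1 H2 eps He.
  assert (He2 : 0 < eps / 2) by lra.
  generalize (filter_and _ _ (filterlim_R_eps _ _ _ He2 H1)
                (filterlim_R_eps _ _ _ He2 H2)).
  apply filter_imp; intros x [H3 H4].
  apply Rle_lt_trans with (1 := Cmod_le_ReIm _).
  change (Re (f x - l)) with (Re (f x) - Re l)%R.
  change (Im (f x - l)) with (Im (f x) - Im l)%R; lra.
Qed.

End Clim_theory.

Lemma Clim_unique {T : Type} {Fl : (T -> Prop) -> Prop} {FF : ProperFilter Fl}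
  (f : T -> C) (l m : C) : Clim Fl f l -> Clim Fl f m -> l = m.
Proof.
  intros Hl Hm.
  destruct (Ceq_dec l m) as [E | E]; [exact E | exfalso].
  assert (Hd : 0 < Cmod (l - m) / 2).
  { apply Rdiv_lt_0_compat; [| lra].
    apply Cmod_gt_0; intros E1; apply E.
    replace l with (l - m + m) by ring; rewrite E1; ring. }
  destruct (filter_ex _ (filter_and _ _ (Hl _ Hd) (Hm _ Hd))) as [x [H1 H2]].
  pose proof (Cmod_triangle (l - f x) (f x - m)) as H3.
  replace (l - f x + (f x - m)) with (l - m) in H3 by ring.
  rewrite (Cmod_sym l (f x)) in H3; lra.
Qed.

Lemma at_left_between (d a : R) : d < a -> at_left a (fun x => d < x < a).
Proof.
  intros Hd; assert (Hd' : 0 < a - d) by lra.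
  exists (mkposreal _ Hd'); intros x Hx Hxa; split; [| exact Hxa].
  change (Rabs (x - a) < a - d) in Hx; apply Rabs_lt_between in Hx; lra.
Qed.

Lemma at_right_between (a d : R) : a < d -> at_right a (fun x => a < x < d).
Proof.
  intros Hd; assert (Hd' : 0 < d - a) by lra.
  exists (mkposreal _ Hd'); intros x Hx Hxa; split; [exact Hxa |].
  change (Rabs (x - a) < d - a) in Hx; apply Rabs_lt_between in Hx; lra.
Qed.

Lemma Clim_RtoC (D : R -> Prop) (x : R) : Clim (within D (locally x)) RtoC (RtoC x).
Proof.
  intros eps He; exists (mkposreal eps He); intros t Ht _.
  rewrite <- RtoC_minus, Cmod_R; exact Ht.
Qed.

Lemma Clim_comp {T U : Type} (Fl : (T -> Prop) -> Prop) (Gl : (U -> Prop) -> Prop)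
  (f : T -> U) (g : U -> C) (l : C) :
  filterlim f Fl Gl -> Clim Gl g l -> Clim Fl (fun x => g (f x)) l.
Proof. intros Hf Hg eps He; apply (Hf _ (Hg eps He)). Qed.

Lemma CLim_seq_correct (u : nat -> C) (l : C) :
  Clim eventually u l -> CLim_seq u = l.
Proof.
  intros H; unfold CLim_seq.
  rewrite (is_lim_seq_unique (fun n => Re (u n)) (Re l)) by apply (Clim_Re _ _ H).
  rewrite (is_lim_seq_unique (fun n => Im (u n)) (Im l)) by apply (Clim_Im _ _ H).
  now destruct l.
Qed.

Lemma Clim_seq_incr (u : nat -> C) (l : C) :
  Clim eventually (fun n => u (S n)) l -> Clim eventually u l.
Proof.
  intros H eps He; destruct (H eps He) as [N HN].
  exists (S N); intros n Hn.
  destruct n as [| n]; [lia |]; apply HN; lia.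
Qed.

Lemma Clim_seq_S (u : nat -> C) (l : C) :
  Clim eventually u l -> Clim eventually (fun n => u (S n)) l.
Proof.
  intros H eps He; destruct (H eps He) as [N HN].
  exists N; intros n Hn; apply HN; lia.
Qed.

Lemma Clim_seq_subst_le (u : nat -> C) (l : C) (N : nat) (M : R) :
  (forall n, (N <= n)%nat -> Cmod (u n) <= M) -> Clim eventually u l ->
  Cmod l <= M.
Proof.
  intros Hu Hl; apply Rle_plus_epsilon; intros eps He.
  destruct (Hl eps He) as [N1 HN1].
  pose proof (HN1 (N + N1)%nat ltac:(lia)) as H1.
  pose proof (Hu (N + N1)%nat ltac:(lia)) as H2.
  pose proof (Cmod_minus_ge l (u (N + N1)%nat)) as H3.
  rewrite Cmod_sym in H3; lra.
Qed.

(** Real and imaginary parts have absolutely summable increments, and the partial sums of the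
    increments telescope back to the sequence. *)
Lemma Clim_seq_cauchy (u : nat -> C) (v : nat -> R) :
  (forall n, Cmod (u (S n) - u n) <= v n) -> ex_series v ->
  exists l, Clim eventually u l.
Proof.
  intros Huv Hv.
  (* [f] is to be [Re] and then [Im], which enter only through these two properties. *)
  assert (H : forall f : C -> R, (forall x y, f (x - y)%C = f x - f y)%R ->
            (forall x, Rabs (f x) <= Cmod x) ->
            exists l, is_lim_seq (fun n => f (u n)) (Finite l)).
  { intros f Hf1 Hf2.
    assert (Hs : ex_series (fun n => f (u (S n)) - f (u n))%R).
    { apply (ex_series_le (V := R_CompleteNormedModule)) with (2 := Hv); intros n.
      change (Rabs (f (u (S n)) - f (u n)) <= v n).
      rewrite <- Hf1; eapply Rle_trans; [apply Hf2 | apply Huv]. }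
    destruct Hs as [s Hs]; exists (s + f (u O))%R.
    apply is_lim_seq_incr_1.
    apply is_lim_seq_ext with
      (fun n => sum_n (fun k => f (u (S k)) - f (u k))%R n + f (u O))%R.
    - intros n; induction n as [| n IH].
      + rewrite sum_O; ring.
      + rewrite sum_Sn; unfold plus; simpl; lra.
    - apply is_lim_seq_plus with (Finite s) (Finite (f (u O)));
        [exact Hs | apply is_lim_seq_const | reflexivity]. }
  destruct (H Re) as [a Ha]; [intros; reflexivity | apply re_le_Cmod |].
  destruct (H Im) as [b Hb]; [intros; reflexivity | apply im_le_Cmod |].
  exists (a, b); apply Clim_of_ReIm; [exact Ha | exact Hb].
Qed.

(** * The complex exponential and derivatives of complex functions of a real variable *)

Lemma C_ext (a b : C) : Re a = Re b -> Im a = Im b -> a = b.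
Proof. destruct a, b; simpl; congruence. Qed.

Lemma C_eta (z : C) : (Re z, Im z) = z.
Proof. now destruct z. Qed.

Lemma Re_plus (a b : C) : Re (a + b) = (Re a + Re b)%R.
Proof. reflexivity. Qed.
Lemma Im_plus (a b : C) : Im (a + b) = (Im a + Im b)%R.
Proof. reflexivity. Qed.
Lemma Re_minus (a b : C) : Re (a - b) = (Re a - Re b)%R.
Proof. reflexivity. Qed.
Lemma Im_minus (a b : C) : Im (a - b) = (Im a - Im b)%R.
Proof. reflexivity. Qed.
Lemma Re_opp (a : C) : Re (- a) = (- Re a)%R.
Proof. reflexivity. Qed.
Lemma Im_opp (a : C) : Im (- a) = (- Im a)%R.
Proof. reflexivity. Qed.
Lemma Re_mult (a b : C) : Re (a * b) = (Re a * Re b - Im a * Im b)%R.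
Proof. reflexivity. Qed.
Lemma Im_mult (a b : C) : Im (a * b) = (Re a * Im b + Im a * Re b)%R.
Proof. reflexivity. Qed.
Lemma Re_RtoC (x : R) : Re (RtoC x) = x.
Proof. reflexivity. Qed.
Lemma Im_RtoC (x : R) : Im (RtoC x) = 0%R.
Proof. reflexivity. Qed.

Ltac ReIm := repeat (rewrite ?Re_plus, ?Im_plus, ?Re_minus, ?Im_minus, ?Re_opp,
  ?Im_opp, ?Re_mult, ?Im_mult, ?Re_RtoC, ?Im_RtoC).

Lemma Re_scal (x : R) (z : C) : Re (x * z) = (x * Re z)%R.
Proof. ReIm; ring. Qed.
Lemma Im_scal (x : R) (z : C) : Im (x * z) = (x * Im z)%R.
Proof. ReIm; ring. Qed.

Lemma RtoC_neq (x y : R) : x <> y -> RtoC x <> RtoC y.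
Proof. intros H E; apply H; injection E; auto. Qed.

Lemma Cexp_0 : Cexp 0 = 1.
Proof. unfold Cexp; simpl; rewrite exp_0, cos_0, sin_0; apply C_ext; simpl; ring. Qed.

Lemma Re_Cexp (z : C) : Re (Cexp z) = (exp (Re z) * cos (Im z))%R.
Proof. unfold Cexp; rewrite Re_scal; reflexivity. Qed.

Lemma Im_Cexp (z : C) : Im (Cexp z) = (exp (Re z) * sin (Im z))%R.
Proof. unfold Cexp; rewrite Im_scal; reflexivity. Qed.

Lemma Cexp_plus (a b : C) : Cexp (a + b) = Cexp a * Cexp b.
Proof.
  apply C_ext; rewrite ?Re_mult, ?Im_mult, ?Re_Cexp, ?Im_Cexp; ReIm;
    rewrite exp_plus, ?cos_plus, ?sin_plus; ring.
Qed.

Lemma Cmod_Cexp (z : C) : Cmod (Cexp z) = exp (Re z).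
Proof.
  unfold Cexp; rewrite Cmod_mult, Cmod_R, Rabs_pos_eq by (left; apply exp_pos).
  unfold Cmod; simpl fst; simpl snd.
  pose proof (sin2_cos2 (Im z)) as H; unfold Rsqr in H.
  replace (cos (Im z) ^ 2 + sin (Im z) ^ 2)%R with 1%R by (rewrite <- H; ring).
  rewrite sqrt_1; ring.
Qed.

Lemma Cexp_neq_0 (z : C) : Cexp z <> 0.
Proof. apply Cmod_gt_0; rewrite Cmod_Cexp; apply exp_pos. Qed.

Lemma Cexp_opp (z : C) : Cexp (- z) = / Cexp z.
Proof.
  assert (H : Cexp (- z) * Cexp z = 1).
  { rewrite <- Cexp_plus; replace (- z + z) with (RtoC 0) by ring; apply Cexp_0. }
  replace (Cexp (- z)) with (Cexp (- z) * Cexp z * / Cexp z)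
    by (field; apply Cexp_neq_0).
  rewrite H; ring.
Qed.

Lemma Cexp_RtoC (x : R) : Cexp x = exp x.
Proof. apply C_ext; rewrite ?Re_Cexp, ?Im_Cexp; ReIm; rewrite ?cos_0, ?sin_0; ring. Qed.

Lemma exp_minus_1_bound (x : R) : Rabs (exp x - 1) <= Rabs x * exp (Rabs x).
Proof.
  pose proof (exp_ineq1_le x) as H1.
  pose proof (exp_ineq1_le (- x)) as H2.
  pose proof (exp_pos x) as H3.
  assert (H4 : (exp x * exp (- x) = 1)%R) by (rewrite <- exp_plus, Rplus_opp_r; apply exp_0).
  assert (H5 : exp x * (1 + - x) <= 1) by (rewrite <- H4; apply Rmult_le_compat_l; lra).
  destruct (Rle_dec 0 x) as [Hx | Hx].
  - rewrite !(Rabs_pos_eq x) by lra; rewrite Rabs_pos_eq by lra; nra.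
  - rewrite !(Rabs_left x) by lra; rewrite Rabs_left1.
    + assert (1 <= exp (- x)) by lra; nra.
    + assert (exp x <= 1); [| lra].
      rewrite <- exp_0; apply Rlt_le, exp_increasing; lra.
Qed.

Lemma exp_minus_1_minus_bound (x : R) :
  Rabs (exp x - 1 - x) <= x ^ 2 * exp (Rabs x).
Proof.
  pose proof (exp_ineq1_le x) as H1.
  pose proof (exp_ineq1_le (- x)) as H2.
  pose proof (exp_pos x) as H3.
  assert (H4 : (exp x * exp (- x) = 1)%R) by (rewrite <- exp_plus, Rplus_opp_r; apply exp_0).
  assert (H5 : exp x * (1 + - x) <= 1) by (rewrite <- H4; apply Rmult_le_compat_l; lra).
  rewrite (Rabs_pos_eq (exp x - 1 - x)) by lra.
  destruct (Rle_dec 0 x) as [Hx | Hx].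
  - rewrite !(Rabs_pos_eq x) by lra; nra.
  - rewrite !(Rabs_left x) by lra.
    assert (1 <= exp (- x)) by lra.
    assert (exp x <= 1).
    { rewrite <- exp_0; apply Rlt_le, exp_increasing; lra. }
    assert (exp x <= 1 + x * exp x) by nra.
    assert (exp x - 1 - x <= x ^ 2) by nra.
    assert (0 <= x ^ 2) by nra. nra.
Qed.

Lemma Rabs_sin_le (y : R) : Rabs (sin y) <= Rabs y.
Proof.
  destruct (Rle_dec 0 y) as [Hy | Hy].
  - destruct (Req_dec y 0) as [-> | Hy0]; [rewrite sin_0; lra |].
    rewrite (Rabs_pos_eq y) by lra; apply Rabs_le; split.
    + destruct (Rle_dec y 1).
      * assert (0 < sin y); [apply sin_gt_0; pose proof PI2_1; lra | lra].
      * pose proof (SIN_bound y); lra.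
    + left; apply sin_lt_x; lra.
  - rewrite (Rabs_left y) by lra; rewrite <- Rabs_Ropp, <- sin_neg.
    apply Rabs_le; split.
    + destruct (Rle_dec (- y) 1).
      * assert (0 < sin (- y)); [apply sin_gt_0; pose proof PI2_1; lra | lra].
      * pose proof (SIN_bound (- y)); lra.
    + left; apply sin_lt_x; lra.
Qed.

Lemma cos_minus_1_bound (y : R) : Rabs (cos y - 1) <= y ^ 2.
Proof.
  pose proof (cos_2a_sin (y / 2)) as H.
  replace (2 * (y / 2))%R with y in H by field.
  pose proof (Rabs_sin_le (y / 2)) as H1.
  assert (H2 : sin (y / 2) ^ 2 <= (y / 2) ^ 2).
  { rewrite <- (pow2_abs (sin (y / 2))), <- (pow2_abs (y / 2)).
    apply pow_incr; split; [apply Rabs_pos | exact H1]. }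
  apply Rabs_le; split; nra.
Qed.

Lemma sin_minus_bound (y : R) : Rabs (sin y - y) <= y ^ 2.
Proof.
  destruct (MVT_abs (fun t => sin t - t)%R (fun t => cos t - 1)%R 0 y) as [c [H1 H2]].
  - intros c _; apply is_derive_Reals; auto_derive; [exact I | ring].
  - rewrite sin_0, !Rminus_0_r in H1; rewrite H1.
    assert (Hc : Rabs (cos c - 1) <= Rabs y).
    { assert (Hcy : Rabs c <= Rabs y).
      { revert H2; unfold Rmin, Rmax; destruct (Rle_dec 0 y); intros H2;
          unfold Rabs; repeat destruct Rcase_abs; lra. }
      apply Rle_trans with (2 := Hcy).
      destruct (MVT_abs cos (fun t => - sin t)%R 0 c) as [d [H3 H4]].
      - intros e _; apply is_derive_Reals; auto_derive; [exact I | ring].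
      - rewrite cos_0, Rminus_0_r in H3; rewrite H3.
        rewrite Rabs_Ropp.
        assert (Rabs (sin d) <= 1) by (apply Rabs_le, SIN_bound).
        pose proof (Rabs_pos c); nra. }
    rewrite <- pow2_abs; pose proof (Rabs_pos y); nra.
Qed.

(** The quadratic order is the point: it makes the factors of Gauss's product 1 + O(1/n^2). The 4
    collects 2 from each of the real and imaginary parts, and the exponential makes the estimate
    global. *)
Lemma Cexp_minus_1_minus_bound (w : C) :
  Cmod (Cexp w - 1 - w) <= 4 * Cmod w ^ 2 * exp (Cmod w).
Proof.
  apply Rle_trans with (1 := Cmod_le_ReIm _).
  pose proof (re_le_Cmod w) as Hx; pose proof (im_le_Cmod w) as Hy.
  ReIm; rewrite Re_Cexp, Im_Cexp.
  set (x := Re w) in *; set (y := Im w) in *.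
  assert (Hx2 : x ^ 2 <= Cmod w ^ 2).
  { rewrite <- (pow2_abs x); apply pow_incr; split; [apply Rabs_pos | exact Hx]. }
  assert (Hy2 : y ^ 2 <= Cmod w ^ 2).
  { rewrite <- (pow2_abs y); apply pow_incr; split; [apply Rabs_pos | exact Hy]. }
  assert (HE : exp (Rabs x) <= exp (Cmod w)).
  { destruct Hx as [Hx | Hx]; [left; now apply exp_increasing | now rewrite Hx; right]. }
  assert (Hxx : exp x <= exp (Cmod w)).
  { apply Rle_trans with (2 := HE); pose proof (Rle_abs x) as [H | H];
      [left; now apply exp_increasing | rewrite <- H; right; auto]. }
  assert (H1E : 1 <= exp (Cmod w)).
  { pose proof (exp_ineq1_le (Cmod w)); pose proof (Cmod_ge_0 w); lra. }
  pose proof (Cmod_ge_0 w) as Hw.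
  assert (A1 : Rabs (exp x * cos y - 1 - x) <= 2 * Cmod w ^ 2 * exp (Cmod w)).
  { replace (exp x * cos y - 1 - x)%R with ((exp x - 1 - x) + exp x * (cos y - 1))%R by ring.
    apply Rle_trans with (1 := Rabs_triang _ _).
    rewrite Rabs_mult, (Rabs_pos_eq (exp x)) by (left; apply exp_pos).
    pose proof (exp_minus_1_minus_bound x); pose proof (cos_minus_1_bound y).
    pose proof (exp_pos x); pose proof (exp_pos (Rabs x)).
    pose proof (Rabs_pos (cos y - 1)).
    assert (x ^ 2 * exp (Rabs x) <= Cmod w ^ 2 * exp (Cmod w)).
    { apply Rmult_le_compat; try lra; apply pow2_ge_0. }
    assert (exp x * Rabs (cos y - 1) <= exp (Cmod w) * Cmod w ^ 2).
    { apply Rmult_le_compat; lra. }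
    lra. }
  assert (A2 : Rabs (exp x * sin y - 0 - y) <= 2 * Cmod w ^ 2 * exp (Cmod w)).
  { replace (exp x * sin y - 0 - y)%R with ((exp x - 1) * sin y + (sin y - y))%R by ring.
    apply Rle_trans with (1 := Rabs_triang _ _); rewrite Rabs_mult.
    pose proof (exp_minus_1_bound x); pose proof (sin_minus_bound y).
    pose proof (Rabs_sin_le y); pose proof (Rabs_pos (sin y)).
    pose proof (Rabs_pos (exp x - 1)); pose proof (exp_pos (Rabs x)).
    pose proof (Rabs_pos x).
    assert (Rabs (exp x - 1) <= Cmod w * exp (Cmod w)).
    { apply Rle_trans with (1 := H); apply Rmult_le_compat; lra. }
    assert (Rabs (exp x - 1) * Rabs (sin y) <= Cmod w * exp (Cmod w) * Cmod w).
    { apply Rmult_le_compat; lra. }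
    assert (0 <= Cmod w ^ 2) by apply pow2_ge_0. nra. }
  change (Im 1) with 0%R; change (Re 1) with 1%R.
  lra.
Qed.

Lemma Cmod_Rcpow (x : R) (z : C) : Cmod (Rcpow x z) = exp (Re z * ln x).
Proof. unfold Rcpow; rewrite Cmod_Cexp; f_equal; ReIm; ring. Qed.

Lemma Cmod_Rcpow_Rpower (x : R) (z : C) : Cmod (Rcpow x z) = Rpower x (Re z).
Proof. apply Cmod_Rcpow. Qed.

Lemma Rcpow_neq_0 (x : R) (z : C) : Rcpow x z <> 0.
Proof. apply Cexp_neq_0. Qed.

Lemma Rcpow_plus (x : R) (a b : C) : Rcpow x (a + b) = Rcpow x a * Rcpow x b.
Proof. unfold Rcpow; rewrite <- Cexp_plus; f_equal; ring. Qed.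

Lemma Rcpow_opp (x : R) (a : C) : Rcpow x (- a) = / Rcpow x a.
Proof. unfold Rcpow; rewrite <- Cexp_opp; f_equal; ring. Qed.

Lemma Rcpow_minus (x : R) (a b : C) : Rcpow x (a - b) = Rcpow x a / Rcpow x b.
Proof. unfold Cminus; now rewrite Rcpow_plus, Rcpow_opp. Qed.

Lemma Rcpow_RtoC (x y : R) : Rcpow x y = Rpower x y.
Proof. unfold Rcpow; rewrite <- RtoC_mult; apply Cexp_RtoC. Qed.

Lemma Rcpow_1 (x : R) : 0 < x -> Rcpow x 1 = x.
Proof. intros Hx; rewrite Rcpow_RtoC, Rpower_1; auto. Qed.

Lemma Rcpow_mult (x y : R) (z : C) :
  0 < x -> 0 < y -> Rcpow (x * y) z = Rcpow x z * Rcpow y z.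
Proof.
  intros Hx Hy; unfold Rcpow; rewrite ln_mult, RtoC_plus, <- Cexp_plus by auto.
  f_equal; ring.
Qed.

Lemma Rcpow_inv (x : R) (z : C) : 0 < x -> Rcpow (/ x) z = Rcpow x (- z).
Proof. intros Hx; unfold Rcpow; rewrite ln_Rinv, RtoC_opp by auto; f_equal; ring. Qed.

Lemma Rcpow_one (z : C) : Rcpow 1 z = 1.
Proof. unfold Rcpow; rewrite ln_1, Cmult_0_r; apply Cexp_0. Qed.

(** Componentwise and in a real variable, so that the real theorems on constancy, composition and
    integration carry over directly. *)
Definition Cder (f : R -> C) (x : R) (l : C) : Prop :=
  is_derive (fun t => Re (f t)) x (Re l) /\ is_derive (fun t => Im (f t)) x (Im l).

Lemma is_derive_val (f : R -> R) (x l m : R) : l = m -> is_derive f x l -> is_derive f x m.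
Proof. now intros ->. Qed.

Lemma Cder_val (f : R -> C) (x : R) (l m : C) : l = m -> Cder f x l -> Cder f x m.
Proof. now intros ->. Qed.

Lemma Cder_ext_loc (f g : R -> C) (x : R) (l : C) :
  locally x (fun t => f t = g t) -> Cder f x l -> Cder g x l.
Proof.
  intros H [H1 H2]; split; eapply is_derive_ext_loc; eauto;
    (apply filter_imp with (2 := H); intros t ->; reflexivity).
Qed.

Lemma Cder_const (c : C) (x : R) : Cder (fun _ => c) x 0.
Proof. split; exact (is_derive_const _ _). Qed.

Lemma Cder_RtoC (f : R -> R) (x l : R) : is_derive f x l -> Cder (fun t => RtoC (f t)) x l.
Proof. intros H; split; [exact H | exact (is_derive_const _ _)]. Qed.

Lemma Cder_plus (f g : R -> C) (x : R) (l m : C) :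
  Cder f x l -> Cder g x m -> Cder (fun t => f t + g t) x (l + m).
Proof.
  intros [F1 F2] [G1 G2]; split.
  - exact (is_derive_plus _ _ _ _ _ F1 G1).
  - exact (is_derive_plus _ _ _ _ _ F2 G2).
Qed.

Lemma Cder_opp (f : R -> C) (x : R) (l : C) :
  Cder f x l -> Cder (fun t => - f t) x (- l).
Proof.
  intros [F1 F2]; split; [exact (is_derive_opp _ _ _ F1) | exact (is_derive_opp _ _ _ F2)].
Qed.

Lemma Cder_minus (f g : R -> C) (x : R) (l m : C) :
  Cder f x l -> Cder g x m -> Cder (fun t => f t - g t) x (l - m).
Proof. intros Hf Hg; apply Cder_plus; [exact Hf | now apply Cder_opp]. Qed.

Lemma Rder_mult (f g : R -> R) (x l m : R) :
  is_derive f x l -> is_derive g x m ->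
  is_derive (fun t => f t * g t)%R x (l * g x + f x * m)%R.
Proof. intros Hf Hg; apply (is_derive_mult f g x l m Hf Hg), Rmult_comm. Qed.

Lemma Cder_mult (f g : R -> C) (x : R) (l m : C) :
  Cder f x l -> Cder g x m -> Cder (fun t => f t * g t) x (l * g x + f x * m).
Proof.
  intros [F1 F2] [G1 G2]; split.
  - eapply is_derive_val;
      [| exact (is_derive_minus _ _ _ _ _ (Rder_mult _ _ _ _ _ F1 G1) (Rder_mult _ _ _ _ _ F2 G2))].
    ReIm; unfold minus, plus, opp; simpl; ring.
  - eapply is_derive_val;
      [| exact (is_derive_plus _ _ _ _ _ (Rder_mult _ _ _ _ _ F1 G2) (Rder_mult _ _ _ _ _ F2 G1))].
    ReIm; unfold plus; simpl; ring.
Qed.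

Lemma Cder_scal (c : C) (f : R -> C) (x : R) (l : C) :
  Cder f x l -> Cder (fun t => c * f t) x (c * l).
Proof.
  intros H; eapply Cder_val; [| exact (Cder_mult _ _ _ _ _ (Cder_const c x) H)].
  simpl; ring.
Qed.

Lemma Cder_comp (f : R -> C) (g : R -> R) (x : R) (l : C) (d : R) :
  Cder f (g x) l -> is_derive g x d -> Cder (fun t => f (g t)) x (d * l).
Proof.
  intros [F1 F2] G; split.
  - rewrite Re_scal; exact (is_derive_comp _ _ _ _ _ F1 G).
  - rewrite Im_scal; exact (is_derive_comp _ _ _ _ _ F2 G).
Qed.

Lemma Cder_Cexp (z : C) (x : R) : Cder (fun t => Cexp (z * t)) x (z * Cexp (z * x)).
Proof.
  split.
  - apply is_derive_ext with (fun t => exp (Re z * t) * cos (Im z * t))%R.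
    { intros t; rewrite Re_Cexp; ReIm; f_equal; f_equal; ring. }
    auto_derive; [exact I |].
    rewrite Re_mult, Re_Cexp, Im_Cexp; ReIm.
    replace (Re z * x - Im z * 0)%R with (Re z * x)%R by ring.
    replace (Re z * 0 + Im z * x)%R with (Im z * x)%R by ring.
    ring.
  - apply is_derive_ext with (fun t => exp (Re z * t) * sin (Im z * t))%R.
    { intros t; rewrite Im_Cexp; ReIm; f_equal; f_equal; ring. }
    auto_derive; [exact I |].
    rewrite Im_mult, Re_Cexp, Im_Cexp; ReIm.
    replace (Re z * x - Im z * 0)%R with (Re z * x)%R by ring.
    replace (Re z * 0 + Im z * x)%R with (Im z * x)%R by ring.
    ring.
Qed.

Lemma Cder_Rcpow (z : C) (x : R) : 0 < x -> Cder (fun t => Rcpow t z) x (z * Rcpow x z / x).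
Proof.
  intros Hx; eapply Cder_val; [| eapply (Cder_comp (fun u => Cexp (z * u)) ln x)].
  2: apply Cder_Cexp.
  2: apply is_derive_Reals, derivable_pt_lim_ln, Hx.
  unfold Rcpow; simpl; rewrite RtoC_inv by lra; field; apply RtoC_neq; lra.
Qed.

Lemma Cder_Rcpow_1m (z : C) (x : R) :
  x < 1 -> Cder (fun t => Rcpow (1 - t) z) x (- (z * Rcpow (1 - x) z / (1 - x)%R)).
Proof.
  intros Hx.
  eapply Cder_val; [| eapply (Cder_comp (fun u => Rcpow u z) (fun t => 1 - t)%R x _ (- 1))].
  2: apply Cder_Rcpow; lra.
  2: auto_derive; [exact I | ring].
  replace (RtoC (-1)) with (- RtoC 1) by (apply C_ext; simpl; ring); ring.
Qed.

(** The device behind the binomial series and the trigonometric form of a Gauss series: an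
    expression with zero derivative is evaluated at 0. *)
Lemma Cder_0_eq (f : R -> C) (a b : R) :
  a <= b -> (forall x, a <= x <= b -> Cder f x 0) -> f a = f b.
Proof.
  intros [Hab | <-] H; [| reflexivity].
  apply C_ext.
  - apply (eq_is_derive (fun t => Re (f t)) a b); [| exact Hab].
    intros t Ht; apply (H t Ht).
  - apply (eq_is_derive (fun t => Im (f t)) a b); [| exact Hab].
    intros t Ht; apply (H t Ht).
Qed.

(** * Gauss's product for the reciprocal Gamma function *)

Lemma INR_S_pos (n : nat) : 0 < INR n + 1.
Proof. pose proof (pos_INR n); lra. Qed.

(** From n + 2 <= 2(n + 1). The telescoping majorant gives explicit bounds for the sums of 1/(n +
    1)^2 that enter the constants below. *)
Lemma inv_sqr_telescope (n : nat) :
  / (INR n + 1) ^ 2 <= 2 * (/ (INR n + 1) - / (INR (S n) + 1)).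
Proof.
  rewrite S_INR; pose proof (pos_INR n) as H.
  replace (2 * (/ (INR n + 1) - / (INR n + 1 + 1)))%R
    with (/ ((INR n + 1) * (INR n + 2) / 2))%R by (field; lra).
  apply Rinv_le_contravar; nra.
Qed.

(** A discrete Gronwall inequality. Adding d/A absorbs the inhomogeneity, and the product of the
    factors 1 + A/(n + 1)^2 is at most exp(2A). *)
Lemma recurrence_bound (u : nat -> R) (A d : R) :
  0 < A -> 0 <= d -> 0 <= u O ->
  (forall n, u (S n) <= (1 + A / (INR n + 1) ^ 2) * u n + d / (INR n + 1) ^ 2) ->
  forall n, u n <= (u O + d / A) * exp (2 * A).
Proof.
  intros HA Hd Hu0 Hu.
  assert (HdA : 0 <= d / A) by (apply Rmult_le_pos; [lra | left; now apply Rinv_0_lt_compat]).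
  (* The exponent carries the telescoped sum 2A(1 - 1/(n + 1)) instead of its bound 2A, so that the
     induction closes. *)
  assert (H : forall n, u n + d / A <= (u O + d / A) * exp (2 * A * (1 - / (INR n + 1)))).
  { intros n; induction n as [| n IH].
    - simpl; replace (2 * A * (1 - / (0 + 1)))%R with 0%R by field; rewrite exp_0; lra.
    - set (x := (A / (INR n + 1) ^ 2)%R).
      assert (Hx : 0 < x).
      { apply Rdiv_lt_0_compat; [lra | apply pow_lt, INR_S_pos]. }
      apply Rle_trans with ((1 + x) * (u n + d / A))%R.
      + pose proof (Hu n) as H1; fold x in H1.
        replace (d / (INR n + 1) ^ 2)%R with (x * (d / A))%R in H1.
        * lra.
        * unfold x; field; pose proof (INR_S_pos n); lra.
      + apply Rle_trans with (exp x * ((u O + d / A) * exp (2 * A * (1 - / (INR n + 1)))))%R.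
        * apply Rle_trans with ((1 + x) * ((u O + d / A) * exp (2 * A * (1 - / (INR n + 1)))))%R.
          { apply Rmult_le_compat_l; lra. }
          apply Rmult_le_compat_r.
          { apply Rmult_le_pos; [lra | left; apply exp_pos]. }
          apply exp_ineq1_le.
        * rewrite (Rmult_comm (exp x)), Rmult_assoc, <- exp_plus.
          apply Rmult_le_compat_l; [lra |].
          assert (E : 2 * A * (1 - / (INR n + 1)) + x <= 2 * A * (1 - / (INR (S n) + 1))).
          { pose proof (inv_sqr_telescope n) as H1.
            unfold x, Rdiv.
            apply Rmult_le_compat_l with (r := A) in H1; lra. }
          destruct E as [E | E]; [left; now apply exp_increasing | rewrite E; lra]. }
  intros n; apply Rle_trans with (u n + d / A)%R; [lra |].
  apply Rle_trans with (1 := H n), Rmult_le_compat_l; [lra |].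
  assert (Hn : 2 * A * (1 - / (INR n + 1)) < 2 * A).
  { pose proof (Rinv_0_lt_compat _ (INR_S_pos n)); nra. }
  left; now apply exp_increasing.
Qed.

Lemma ex_series_inv_sqr : ex_series (fun n => / (INR n + 1) ^ 2)%R.
Proof.
  assert (H : ex_series (fun n => 2 * (/ (INR n + 1) - / (INR (S n) + 1)))%R).
  { exists 2%R.
    change (is_lim_seq (sum_n (fun n => 2 * (/ (INR n + 1) - / (INR (S n) + 1)))%R) (Finite 2)).
    apply (is_lim_seq_ext (fun n => 2 * (1 - / (INR (S n) + 1)))%R).
    - intros n; induction n as [| n IH].
      + rewrite sum_O; simpl; field.
      + rewrite sum_Sn, <- IH; unfold plus; simpl; lra.
    - replace (Finite 2) with (Finite (2 * (1 - 0)))%R by (f_equal; ring).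
      apply is_lim_seq_mult'; [apply is_lim_seq_const |].
      apply is_lim_seq_minus'; [apply is_lim_seq_const |].
      apply is_lim_seq_ext with (fun n => / INR (S (S n)))%R.
      { intros n; now rewrite (S_INR (S n)). }
      apply (is_lim_seq_incr_1 (fun n => / INR (S n))%R), (is_lim_seq_incr_1 (fun n => / INR n)%R).
      replace (Finite 0) with (Rbar_inv p_infty) by reflexivity.
      apply is_lim_seq_inv; [apply is_lim_seq_INR | discriminate]. }
  apply (ex_series_le (V := R_CompleteNormedModule)) with (2 := H); intros n.
  change (Rabs (/ (INR n + 1) ^ 2) <= 2 * (/ (INR n + 1) - / (INR (S n) + 1))).
  rewrite Rabs_pos_eq; [apply inv_sqr_telescope |].
  left; apply Rinv_0_lt_compat, pow_lt, INR_S_pos.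
Qed.

(** * Sequences whose successive factors are 1 + O(1/n^2) *)

Section product_sequence.

Variables (v : nat -> C) (A : R).
Hypothesis HA : 0 < A.
Hypothesis Hv : forall n, Cmod (v (S n) - v n) <= A / (INR n + 1) ^ 2 * Cmod (v n).

Lemma product_sequence_bound (n : nat) : Cmod (v n) <= Cmod (v O) * exp (2 * A).
Proof.
  replace (Cmod (v O)) with (Cmod (v O) + 0 / A)%R by (field; lra).
  apply (recurrence_bound (fun n => Cmod (v n)) A 0); [lra | lra | apply Cmod_ge_0 |].
  intros k; pose proof (Hv k) as H.
  pose proof (Cmod_triangle (v (S k) - v k) (v k)) as H1.
  replace (v (S k) - v k + v k) with (v (S k)) in H1 by ring.
  unfold Rdiv at 2; rewrite Rmult_0_l; lra.
Qed.

Lemma product_sequence_tail (n m : nat) :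
  Cmod (v (n + m)%nat - v n) <=
   Cmod (v O) * exp (2 * A) * A * 2 * (/ (INR n + 1) - / (INR (n + m) + 1)).
Proof.
  set (K := (Cmod (v O) * exp (2 * A) * A)%R).
  induction m as [| m IH].
  - rewrite Nat.add_0_r; replace (v n - v n) with (RtoC 0) by ring.
    rewrite Cmod_0; lra.
  - rewrite Nat.add_succ_r.
    replace (v (S (n + m)) - v n) with ((v (S (n + m)) - v (n + m)%nat) + (v (n + m)%nat - v n))
      by ring.
    apply Rle_trans with (1 := Cmod_triangle _ _).
    assert (H : Cmod (v (S (n + m)) - v (n + m)%nat) <= K * / (INR (n + m) + 1) ^ 2).
    { apply Rle_trans with (1 := Hv _).
      unfold K, Rdiv.
      pose proof (product_sequence_bound (n + m)) as H1.
      assert (0 <= A * / (INR (n + m) + 1) ^ 2).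
      { apply Rmult_le_pos; [lra |]; left; apply Rinv_0_lt_compat, pow_lt, INR_S_pos. }
      apply Rmult_le_compat_l with (1 := H) in H1; lra. }
    assert (HK : 0 <= K).
    { unfold K; apply Rmult_le_pos; [| lra].
      apply Rmult_le_pos; [apply Cmod_ge_0 | left; apply exp_pos]. }
    pose proof (inv_sqr_telescope (n + m)) as H1.
    apply Rmult_le_compat_l with (1 := HK) in H1.
    lra.
Qed.

Lemma product_sequence_cv : exists l, Clim eventually v l.
Proof.
  apply (Clim_seq_cauchy v (fun n => Cmod (v O) * exp (2 * A) * A * / (INR n + 1) ^ 2)%R).
  - intros n; apply Rle_trans with (1 := Hv n).
    pose proof (product_sequence_bound n) as H1; unfold Rdiv.
    assert (0 <= A * / (INR n + 1) ^ 2).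
    { apply Rmult_le_pos; [lra |]; left; apply Rinv_0_lt_compat, pow_lt, INR_S_pos. }
    apply Rmult_le_compat_l with (1 := H) in H1; lra.
  - apply (ex_series_scal (V := R_NormedModule)), ex_series_inv_sqr.
Qed.

(** The tail of the telescoping majorant is summed. The bound depends on the sequence only through
    [A] and [v O], which makes the convergence of Gauss's product locally uniform in z. *)
Lemma product_sequence_rate (l : C) (n : nat) :
  Clim eventually v l ->
  Cmod (v n - l) <= Cmod (v O) * exp (2 * A) * A * 2 * / (INR n + 1).
Proof.
  intros Hl; rewrite Cmod_sym.
  apply (Clim_seq_subst_le (fun k => v k - v n) (l - v n) n).
  - intros k Hk; replace k with (n + (k - n))%nat by lia.
    apply Rle_trans with (1 := product_sequence_tail _ _).
    apply Rmult_le_compat_l.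
    + repeat apply Rmult_le_pos; try lra; [apply Cmod_ge_0 | left; apply exp_pos].
    + pose proof (Rinv_0_lt_compat _ (INR_S_pos (n + (k - n)))); lra.
  - apply Clim_minus; [exact Hl | apply Clim_const].
Qed.

End product_sequence.

(** The reciprocals [/ Cmod (v n)] satisfy a Gronwall recurrence as well, hence stay bounded, and
    the limit keeps a distance from 0. *)
Lemma product_sequence_neq_0 (v : nat -> C) (A : R) (l : C) :
  0 < A ->
  (forall n, Cmod (v (S n) - v n) <= A / (INR n + 1) ^ 2 * Cmod (v n)) ->
  (forall n, v n <> 0) -> Clim eventually v l -> l <> 0.
Proof.
  intros HA Hv Hv0 Hl.
  (* Beyond N > 2A the relative increment x is at most 1/2, where 1/(1 - x) <= 1 + 2x; this is why
     the constant of the new recurrence is 2A. *)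
  destruct (INR_unbounded (2 * A)) as [N HN].
  set (w := fun n => (/ Cmod (v (n + N)%nat))%R).
  assert (Hpos : forall n, 0 < Cmod (v n)) by (intros n; apply Cmod_gt_0, Hv0).
  assert (Hw : forall n, w n <= (w O + 0 / (2 * A)) * exp (2 * (2 * A))).
  { apply recurrence_bound; [lra | lra | |].
    { left; apply Rinv_0_lt_compat, Hpos. }
    intros n; unfold w; simpl plus.
    set (x := (A / (INR (n + N) + 1) ^ 2)%R).
    pose proof (Hpos (n + N)%nat) as H1; pose proof (Hpos (S (n + N))) as H2.
    pose proof (pos_INR n) as Hn; pose proof (pos_INR N) as HN'.
    assert (Hx0 : 0 < x).
    { apply Rdiv_lt_0_compat; [lra | apply pow_lt, INR_S_pos]. }
    assert (Hx : x <= 1 / 2).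
    { unfold x; rewrite plus_INR.
      apply Rmult_le_reg_r with ((INR n + INR N + 1) ^ 2)%R; [apply pow_lt; lra |].
      unfold Rdiv; rewrite Rmult_assoc, Rinv_l by (apply pow_nonzero; lra). nra. }
    assert (H3 : (1 - x) * Cmod (v (n + N)%nat) <= Cmod (v (S (n + N)))).
    { pose proof (Hv (n + N)%nat) as H3; fold x in H3.
      pose proof (Cmod_minus_ge (v (n + N)%nat) (v (S (n + N)))) as H4.
      rewrite Cmod_sym in H4; lra. }
    assert (Hxx : x <= A / (INR n + 1) ^ 2).
    { unfold x, Rdiv; apply Rmult_le_compat_l; [lra |].
      apply Rinv_le_contravar; [apply pow_lt; lra |].
      apply pow_incr; rewrite plus_INR; lra. }
    apply Rle_trans with ((1 + 2 * x) * / Cmod (v (n + N)%nat))%R.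
    - apply Rmult_le_reg_r with (Cmod (v (S (n + N)))); [exact H2 |].
      rewrite Rinv_l by lra.
      apply Rle_trans with ((1 + 2 * x) * / Cmod (v (n + N)%nat) * ((1 - x) * Cmod (v (n + N)%nat)))%R.
      + replace ((1 + 2 * x) * / Cmod (v (n + N)%nat) * ((1 - x) * Cmod (v (n + N)%nat)))%R
          with ((1 + 2 * x) * (1 - x))%R by (field; lra).
        nra.
      + apply Rmult_le_compat_l; [| exact H3].
        apply Rmult_le_pos; [lra | left; now apply Rinv_0_lt_compat].
    - replace (0 / (INR n + 1) ^ 2)%R with 0%R by (unfold Rdiv; ring).
      rewrite Rplus_0_r.
      apply Rmult_le_compat_r; [left; now apply Rinv_0_lt_compat |].
      unfold Rdiv in *; lra. }
  set (W := ((w O + 0 / (2 * A)) * exp (2 * (2 * A)))%R) in Hw.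
  assert (HW : 0 < W).
  { apply Rlt_le_trans with (2 := Hw O); apply Rinv_0_lt_compat, Hpos. }
  intros ->.
  destruct (Hl (/ W)%R (Rinv_0_lt_compat _ HW)) as [N1 HN1].
  pose proof (HN1 (N1 + N)%nat ltac:(lia)) as H1.
  replace (v (N1 + N)%nat - 0) with (v (N1 + N)%nat) in H1 by ring.
  pose proof (Hw N1) as H2; unfold w in H2.
  pose proof (Hpos (N1 + N)%nat) as H3.
  apply Rinv_le_contravar in H2; [| now apply Rinv_0_lt_compat].
  rewrite Rinv_inv in H2; lra.
Qed.

(** * Pochhammer symbols and the convergence of Gauss's quotients *)

Lemma RtoC_INR_S (n : nat) : RtoC (INR (S n)) = RtoC (INR n) + 1.
Proof. now rewrite S_INR, RtoC_plus. Qed.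

Lemma RtoC_INR_S_neq (n : nat) : RtoC (INR n) + 1 <> 0.
Proof. rewrite <- RtoC_plus; apply RtoC_neq; pose proof (INR_S_pos n); lra. Qed.

Lemma fact_neq (n : nat) : RtoC (INR (fact n)) <> 0.
Proof. apply RtoC_neq, INR_fact_neq_0. Qed.

Lemma fact_S_C (n : nat) : RtoC (INR (fact (S n))) = (RtoC (INR n) + 1) * RtoC (INR (fact n)).
Proof. rewrite fact_simpl, mult_INR, RtoC_mult, RtoC_INR_S; reflexivity. Qed.

Lemma poch_shift (a : C) (n : nat) : poch a (S n) = a * poch (a + 1) n.
Proof.
  induction n as [| n IH]; [simpl; ring |].
  replace (poch a (S (S n))) with (poch a (S n) * (a + RtoC (INR (S n)))) by reflexivity.
  rewrite IH, RtoC_INR_S; simpl; ring.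
Qed.

Lemma poch_neq_0 (a : C) (n : nat) :
  (forall k : nat, a <> - RtoC (INR k)) -> poch a n <> 0.
Proof.
  intros Ha; induction n as [| n IH]; simpl.
  - apply RtoC_neq; lra.
  - apply Cmult_neq_0; [exact IH |].
    intros E; apply (Ha n); replace a with (a + RtoC (INR n) - RtoC (INR n)) by ring.
    rewrite E; ring.
Qed.

Lemma Re_pos_not_pole (c : C) : 0 < Re c -> forall k : nat, c <> - RtoC (INR k).
Proof.
  intros H k E; rewrite E in H; ReIm; rewrite Re_opp, Re_RtoC in H.
  pose proof (pos_INR k); lra.
Qed.

Lemma Cinv_neq_0 (z : C) : z <> 0 -> / z <> 0.
Proof.
  intros Hz E; apply Hz; replace z with (z * z * / z) by (field; exact Hz).
  rewrite E; ring.
Qed.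

(** The sequence whose [CLim_seq] is [rGamma z]. Its value at n = 0 involves the conventional
    [ln 0], so the recurrences below start at index 1. *)
Definition gauss (z : C) (n : nat) : C :=
  poch z (S n) / (RtoC (INR (fact n)) * Rcpow (INR n) z).

(** With h = 1/(n + 2), consecutive quotients differ by the factor (1 + z h)(1 - h)^z, in which the
    terms of first order in h cancel. *)
Lemma gauss_factor (z : C) (n : nat) :
  gauss z (S (S n)) - gauss z (S n) =
  gauss z (S n) * ((1 + z * RtoC (/ (INR n + 2))) * Cexp (z * RtoC (ln (1 - / (INR n + 2)))) - 1).
Proof.
  pose proof (pos_INR n) as Hn.
  replace (1 - / (INR n + 2))%R with ((INR n + 1) * / (INR n + 2))%R by (field; lra).
  fold (Rcpow ((INR n + 1) * / (INR n + 2)) z).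
  rewrite Rcpow_mult, Rcpow_inv, Rcpow_opp by (try apply Rinv_0_lt_compat; lra).
  unfold gauss.
  replace (poch z (S (S (S n)))) with (poch z (S (S n)) * (z + RtoC (INR (S (S n))))) by reflexivity.
  rewrite (fact_S_C (S n)), !RtoC_INR_S.
  replace (INR (S (S n))) with (INR n + 2)%R by (rewrite !S_INR; ring).
  rewrite (S_INR n).
  rewrite RtoC_inv by lra.
  rewrite RtoC_plus.
  field; repeat split; first [apply Rcpow_neq_0 | apply fact_neq |
    rewrite <- ?RtoC_plus; apply RtoC_neq; lra].
Qed.

Lemma ln_1m_bound (h : R) :
  0 < h <= 1 / 2 -> Rabs (ln (1 - h) + h) <= 2 * h ^ 2.
Proof.
  intros Hh.
  assert (H1 : ln (1 - h) <= - h).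
  { rewrite <- (ln_exp (- h)); apply Rcomplements.ln_le; [lra |].
    pose proof (exp_ineq1_le (- h)); lra. }
  assert (H2 : - ln (1 - h) <= h / (1 - h)).
  { rewrite <- ln_Rinv by lra; rewrite <- (ln_exp (h / (1 - h))).
    apply Rcomplements.ln_le; [apply Rinv_0_lt_compat; lra |].
    replace (/ (1 - h))%R with (1 + h / (1 - h))%R by (field; lra).
    apply exp_ineq1_le. }
  assert (H3 : h / (1 - h) <= h + 2 * h ^ 2).
  { apply Rmult_le_reg_r with (1 - h)%R; [lra |].
    unfold Rdiv; rewrite Rmult_assoc, Rinv_l by lra; nra. }
  rewrite Rabs_left1; lra.
Qed.

(** The constant is uniform on the disc |z| <= r, as the continuity of 1/Gamma requires. *)
Lemma gauss_factor_bound (r : R) :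
  0 <= r -> exists A, (0 < A) /\ forall (z : C) (h : R), Cmod z <= r ->
  0 < h <= 1 / 2 ->
  Cmod ((1 + z * RtoC h) * Cexp (z * RtoC (ln (1 - h))) - 1) <= A * h ^ 2.
Proof.
  intros Hr.
  exists (2 * r + 2 * r * r + (1 + r) * (4 * (2 * r) ^ 2 * exp (2 * r)) + 1)%R; split.
  { pose proof (exp_pos (2 * r)); pose proof (pow2_ge_0 (2 * r)).
    assert (0 <= (2 * r) ^ 2 * exp (2 * r)) by (apply Rmult_le_pos; lra). nra. }
  intros z h Hz Hh.
  pose proof (ln_1m_bound h Hh) as Hl.
  set (l := ln (1 - h)) in *.
  assert (Hl2 : Rabs l <= 2 * h).
  { replace l with (l + h + - h)%R by ring.
    apply Rle_trans with (1 := Rabs_triang _ _).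
    rewrite Rabs_Ropp, (Rabs_pos_eq h) by lra; nra. }
  set (w := z * RtoC l).
  assert (Hw : Cmod w <= 2 * r * h).
  { unfold w; rewrite Cmod_mult, Cmod_R.
    replace (2 * r * h)%R with (r * (2 * h))%R by ring.
    apply Rmult_le_compat; try apply Cmod_ge_0; try apply Rabs_pos; auto. }
  (* The linear terms meet in l + h = O(h^2); what remains is a product of two small quantities and
     the quadratic remainder of the exponential. *)
  replace ((1 + z * RtoC h) * Cexp w - 1) with
    (z * (RtoC l + RtoC h) + z * RtoC h * w + (1 + z * RtoC h) * (Cexp w - 1 - w))
    by (unfold w; ring).
  apply Rle_trans with (1 := Cmod_triangle _ _).
  apply Rle_trans with (2 * r * h ^ 2 + 2 * r * r * h ^ 2 +
     (1 + r) * (4 * (2 * r) ^ 2 * exp (2 * r)) * h ^ 2)%R;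
    [| assert (0 <= h ^ 2) by apply pow2_ge_0; nra].
  pose proof (Cmod_ge_0 z) as Hz0; pose proof (Cmod_ge_0 w) as Hw0.
  apply Rplus_le_compat; [apply Rle_trans with (1 := Cmod_triangle _ _); apply Rplus_le_compat |].
  - rewrite Cmod_mult, <- RtoC_plus, Cmod_R.
    replace (2 * r * h ^ 2)%R with (r * (2 * h ^ 2))%R by ring.
    apply Rmult_le_compat; auto; apply Rabs_pos.
  - rewrite !Cmod_mult, Cmod_R, (Rabs_pos_eq h) by lra.
    replace (2 * r * r * h ^ 2)%R with (r * h * (2 * r * h))%R by ring.
    apply Rmult_le_compat; auto; [apply Rmult_le_pos; lra | apply Rmult_le_compat_r; lra].
  - rewrite Cmod_mult, Rmult_assoc.
    apply Rmult_le_compat; try apply Cmod_ge_0.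
    + apply Rle_trans with (1 := Cmod_triangle _ _).
      rewrite Cmod_1, Cmod_mult, Cmod_R, (Rabs_pos_eq h) by lra. nra.
    + apply Rle_trans with (1 := Cexp_minus_1_minus_bound w).
      assert (He : exp (Cmod w) <= exp (2 * r)).
      { assert (Hw2 : Cmod w <= 2 * r) by nra.
        destruct Hw2 as [E | E]; [left; now apply exp_increasing | rewrite E; lra]. }
      replace (4 * (2 * r) ^ 2 * exp (2 * r) * h ^ 2)%R
        with (4 * (2 * r * h) ^ 2 * exp (2 * r))%R by ring.
      apply Rmult_le_compat; [| left; apply exp_pos | | exact He].
      * pose proof (pow2_ge_0 (Cmod w)); lra.
      * apply Rmult_le_compat_l; [lra |]; apply pow_incr; auto.
Qed.

Lemma gauss_step (r : R) :
  0 <= r -> exists A, (0 < A) /\ forall z : C, Cmod z <= r -> forall n,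
  Cmod (gauss z (S (S n)) - gauss z (S n)) <= A / (INR n + 1) ^ 2 * Cmod (gauss z (S n)).
Proof.
  intros Hr; destruct (gauss_factor_bound r Hr) as [A [HA H]].
  exists A; split; [exact HA |]; intros z Hz n.
  pose proof (pos_INR n) as Hn.
  rewrite gauss_factor, Cmod_mult, Rmult_comm.
  apply Rmult_le_compat_r; [apply Cmod_ge_0 |].
  apply Rle_trans with (A * (/ (INR n + 2)) ^ 2)%R.
  - apply H; [exact Hz |]; split; [apply Rinv_0_lt_compat; lra |].
    apply Rmult_le_reg_r with (INR n + 2)%R; [lra |]; rewrite Rinv_l; lra.
  - unfold Rdiv; rewrite pow_inv; apply Rmult_le_compat_l; [lra |].
    apply Rinv_le_contravar; [apply pow_lt; lra |].
    apply pow_incr; lra.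
Qed.

(** Only here does [rGamma] acquire its meaning, since [CLim_seq] says nothing about a divergent
    sequence. *)
Lemma gauss_lim (z : C) : Clim eventually (gauss z) (rGamma z).
Proof.
  destruct (gauss_step (Cmod z) (Cmod_ge_0 z)) as [A [HA H]].
  destruct (product_sequence_cv (fun n => gauss z (S n)) A HA (H z (Rle_refl _))) as [l Hl].
  apply Clim_seq_incr in Hl.
  replace (rGamma z) with l; [exact Hl |].
  symmetry; apply CLim_seq_correct, Hl.
Qed.

Lemma gauss_neq_0 (z : C) (n : nat) :
  (forall k : nat, z <> - RtoC (INR k)) -> gauss z n <> 0.
Proof.
  intros Hz; unfold gauss, Cdiv; apply Cmult_neq_0; [now apply poch_neq_0 |].
  apply Cinv_neq_0, Cmult_neq_0; [apply fact_neq | apply Rcpow_neq_0].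
Qed.

(** No factor of the product vanishes off the poles, and a product with factors 1 + O(1/n^2) then
    has a nonzero limit. *)
Lemma rGamma_neq_0 (z : C) : (forall k : nat, z <> - RtoC (INR k)) -> rGamma z <> 0.
Proof.
  intros Hz; destruct (gauss_step (Cmod z) (Cmod_ge_0 z)) as [A [HA H]].
  apply (product_sequence_neq_0 (fun n => gauss z (S n)) A).
  - exact HA.
  - exact (H z (Rle_refl _)).
  - intros n; now apply gauss_neq_0.
  - apply Clim_seq_S, gauss_lim.
Qed.

Lemma Clim_INR_shift (z : C) : Clim eventually (fun n => z / (RtoC (INR n) + 1)) 0.
Proof.
  replace (RtoC 0) with (z * 0) by ring.
  apply Clim_mult; [apply Clim_const |].
  apply Clim_dominated with (fun n => / (INR n + 1))%R.
  - apply filter_forall; intros n.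
    replace (/ (RtoC (INR n) + 1) - 0) with (/ (RtoC (INR n + 1))) by (rewrite RtoC_plus; ring).
    pose proof (INR_S_pos n).
    rewrite Cmod_inv by (apply RtoC_neq; lra).
    rewrite Cmod_R, Rabs_pos_eq; lra.
  - change (is_lim_seq (fun n => / (INR n + 1))%R (Finite 0)).
    apply is_lim_seq_ext with (fun n => / INR (S n))%R.
    { intros n; now rewrite S_INR. }
    apply (is_lim_seq_incr_1 (fun n => / INR n)%R).
    replace (Finite 0) with (Rbar_inv p_infty) by reflexivity.
    apply is_lim_seq_inv; [apply is_lim_seq_INR | discriminate].
Qed.

(** At equal index, z times the quotient at z + 1 is the quotient at z times 1 + (z + 1)/(n + 1),
    which tends to 1. *)
Lemma rGamma_rec (z : C) : rGamma z = z * rGamma (z + 1).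
Proof.
  apply (Clim_unique (Fl := eventually) (fun n => z * gauss (z + 1) (S n))).
  2: now apply Clim_scal, Clim_seq_S, gauss_lim.
  apply Clim_ext with (fun n => gauss z (S n) * (1 + (z + 1) / (RtoC (INR n) + 1))).
  - intros n; unfold gauss.
    transitivity (poch z (S (S (S n))) /
        (RtoC (INR (fact (S n))) * Rcpow (INR (S n)) (z + 1))).
    + replace (poch z (S (S (S n)))) with (poch z (S (S n)) * (z + RtoC (INR (S (S n)))))
        by reflexivity.
      rewrite Rcpow_plus, Rcpow_1 by (apply lt_0_INR; lia).
      rewrite !RtoC_INR_S; field; repeat split;
        first [apply Rcpow_neq_0 | apply RtoC_INR_S_neq | apply fact_neq].
    + rewrite poch_shift; field; split; first [apply Rcpow_neq_0 | apply fact_neq].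
  - replace (rGamma z) with (rGamma z * (1 + 0)) by ring.
    apply Clim_mult; [now apply Clim_seq_S, gauss_lim |].
    apply Clim_plus; [apply Clim_const | apply Clim_INR_shift].
Qed.

Lemma poch_1 (n : nat) : poch 1 n = RtoC (INR (fact n)).
Proof.
  induction n as [| n IH]; [reflexivity |].
  rewrite fact_S_C, <- IH; simpl; ring.
Qed.

Lemma rGamma_1 : rGamma 1 = 1.
Proof.
  apply (Clim_unique (Fl := eventually) (fun n => gauss 1 (S n))).
  - apply Clim_seq_S, gauss_lim.
  - apply Clim_ext with (fun n => 1 + 1 / (RtoC (INR n) + 1)).
    + intros n; unfold gauss.
      rewrite poch_1, (fact_S_C (S n)), Rcpow_1, !RtoC_INR_S by (apply lt_0_INR; lia).
      field; split; first [apply fact_neq | apply RtoC_INR_S_neq].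
    + apply Clim_val with (1 + 0); [ring |].
      apply Clim_plus; [apply Clim_const | apply Clim_INR_shift].
Qed.

Lemma rGamma_neg_INR (n : nat) : rGamma (- RtoC (INR n)) = 0.
Proof.
  induction n as [| n IH].
  - rewrite rGamma_rec; simpl; ring.
  - rewrite rGamma_rec, RtoC_INR_S.
    replace (- (RtoC (INR n) + 1) + 1) with (- RtoC (INR n)) by ring.
    rewrite IH; ring.
Qed.

Lemma Clim_Cexp {T : Type} {Fl : (T -> Prop) -> Prop} {FF : Filter Fl} (f : T -> C) (l : C) :
  Clim Fl f l -> Clim Fl (fun x => Cexp (f x)) (Cexp l).
Proof.
  intros H eps He.
  set (K := (Cmod (Cexp l) * (1 + 4 * exp 1))%R).
  assert (HK : 0 < K).
  { apply Rmult_lt_0_compat; [rewrite Cmod_Cexp; apply exp_pos | pose proof (exp_pos 1); lra]. }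
  assert (Hd : 0 < Rmin 1 (eps / K)).
  { apply Rmin_glb_lt; [lra | now apply Rdiv_lt_0_compat]. }
  generalize (H _ Hd); apply filter_imp; intros x Hx.
  set (h := f x - l) in *.
  assert (H1 : Cmod h < 1) by (apply Rlt_le_trans with (1 := Hx), Rmin_l).
  assert (H2 : Cmod h < eps / K) by (apply Rlt_le_trans with (1 := Hx), Rmin_r).
  replace (Cexp (f x) - Cexp l) with (Cexp l * (h + (Cexp h - 1 - h))).
  2: { replace (f x) with (l + h) by (unfold h; ring); rewrite Cexp_plus; ring. }
  rewrite Cmod_mult.
  apply Rle_lt_trans with (Cmod (Cexp l) * ((1 + 4 * exp 1) * Cmod h))%R.
  - apply Rmult_le_compat_l; [apply Cmod_ge_0 |].
    apply Rle_trans with (1 := Cmod_triangle _ _).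
    pose proof (Cexp_minus_1_minus_bound h) as H3.
    pose proof (Cmod_ge_0 h) as H4.
    assert (H5 : exp (Cmod h) <= exp 1) by (left; now apply exp_increasing).
    assert (H6 : Cmod h ^ 2 * exp (Cmod h) <= Cmod h * exp 1).
    { apply Rmult_le_compat; [apply pow2_ge_0 | left; apply exp_pos | nra | exact H5]. }
    lra.
  - rewrite <- Rmult_assoc; fold K.
    apply Rlt_le_trans with (K * (eps / K))%R; [now apply Rmult_lt_compat_l |].
    right; field; lra.
Qed.

(** * Continuity of 1/Gamma *)

Section rGamma_continuity.

Context {T : Type} {Fl : (T -> Prop) -> Prop} {FF : Filter Fl}.

Lemma Clim_poch (f : T -> C) (l : C) (n : nat) :
  Clim Fl f l -> Clim Fl (fun x => poch (f x) n) (poch l n).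
Proof.
  intros H; induction n as [| n IH]; simpl; [apply Clim_const |].
  apply Clim_mult; [exact IH |]; apply Clim_plus; [exact H | apply Clim_const].
Qed.

Lemma Clim_Rcpow (x : R) (f : T -> C) (l : C) :
  Clim Fl f l -> Clim Fl (fun t => Rcpow x (f t)) (Rcpow x l).
Proof.
  intros H; apply Clim_Cexp, Clim_mult; [exact H | apply Clim_const].
Qed.

Lemma Clim_gauss (f : T -> C) (l : C) (n : nat) :
  Clim Fl f l -> Clim Fl (fun x => gauss (f x) n) (gauss l n).
Proof.
  intros H; unfold gauss; apply Clim_div.
  - apply Cmult_neq_0; [apply fact_neq | apply Rcpow_neq_0].
  - now apply Clim_poch.
  - now apply Clim_scal, Clim_Rcpow.
Qed.

(** An eps/3 argument: near l the distance from [gauss z (S N)] to [rGamma z] is uniformly O(1/N),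
    and a single quotient is continuous in z. *)
Lemma Clim_rGamma (f : T -> C) (l : C) :
  Clim Fl f l -> Clim Fl (fun x => rGamma (f x)) (rGamma l).
Proof.
  intros H eps He.
  set (r := (Cmod l + 1)%R).
  assert (Hr : 0 <= r) by (unfold r; pose proof (Cmod_ge_0 l); lra).
  destruct (gauss_step r Hr) as [A [HA Hstep]].
  (* The rate depends on the initial value [gauss z 1], which stays below |gauss l 1| + 1 for z near
     l. *)
  set (B := ((Cmod (gauss l 1) + 1) * exp (2 * A) * A * 2)%R).
  assert (HB : 0 < B).
  { unfold B; pose proof (Cmod_ge_0 (gauss l 1)); pose proof (exp_pos (2 * A)).
    repeat apply Rmult_lt_0_compat; lra. }
  assert (Hrate : forall z n, Cmod z <= r -> Cmod (gauss z 1) <= Cmod (gauss l 1) + 1 ->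
    Cmod (gauss z (S n) - rGamma z) <= B * / (INR n + 1)).
  { intros z n Hz Hz1.
    apply Rle_trans with (Cmod (gauss z 1) * exp (2 * A) * A * 2 * / (INR n + 1))%R.
    - apply (product_sequence_rate (fun n => gauss z (S n)) A HA (Hstep z Hz)).
      apply Clim_seq_S, gauss_lim.
    - apply Rmult_le_compat_r; [left; apply Rinv_0_lt_compat, INR_S_pos |].
      unfold B; repeat apply Rmult_le_compat_r; try lra; left; apply exp_pos. }
  destruct (INR_unbounded (3 * B / eps)) as [N HN].
  assert (HN2 : B * / (INR N + 1) < eps / 3).
  { pose proof (INR_S_pos N).
    apply Rmult_lt_reg_r with (INR N + 1)%R; [lra |].
    rewrite Rmult_assoc, Rinv_l, Rmult_1_r by lra.
    apply Rlt_le_trans with (eps / 3 * INR N)%R; [| nra].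
    apply Rmult_lt_reg_l with (3 / eps)%R; [apply Rdiv_lt_0_compat; lra |].
    replace (3 / eps * B)%R with (3 * B / eps)%R by (field; lra).
    replace (3 / eps * (eps / 3 * INR N))%R with (INR N) by (field; lra). exact HN. }
  assert (He3 : 0 < eps / 3) by lra.
  generalize (filter_and _ _ (Clim_bounded _ _ H) (filter_and _ _
    (Clim_bounded _ _ (Clim_gauss _ _ 1 H)) (Clim_gauss _ _ (S N) H _ He3))).
  apply filter_imp; intros x [H1 [H2 H3]].
  pose proof (Hrate (f x) N H1 H2) as H4.
  assert (H5 : Cmod (gauss l (S N) - rGamma l) <= B * / (INR N + 1)).
  { apply Hrate; unfold r; lra. }
  replace (rGamma (f x) - rGamma l) with
    (- (gauss (f x) (S N) - rGamma (f x)) + ((gauss (f x) (S N) - gauss l (S N))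
      + (gauss l (S N) - rGamma l))) by ring.
  apply Rle_lt_trans with (1 := Cmod_triangle _ _).
  pose proof (Cmod_triangle (gauss (f x) (S N) - gauss l (S N)) (gauss l (S N) - rGamma l)) as H6.
  rewrite Cmod_opp; lra.
Qed.

End rGamma_continuity.

(** The balance a + b = c + d makes the factorials and the powers of n in the four Gauss quotients
    cancel. *)
Lemma poch_ratio_lim (a b c d : C) :
  a + b = c + d -> (forall k : nat, c <> - RtoC (INR k)) -> (forall k : nat, d <> - RtoC (INR k)) ->
  Clim eventually (fun n => poch a n * poch b n / (poch c n * poch d n))
    (rGamma a * rGamma b / (rGamma c * rGamma d)).
Proof.
  intros E Hc Hd; apply Clim_seq_incr.
  apply Clim_ext with (fun n => gauss a n * gauss b n / (gauss c n * gauss d n)).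
  - intros n; unfold gauss.
    assert (E1 : Rcpow (INR n) a * Rcpow (INR n) b = Rcpow (INR n) c * Rcpow (INR n) d).
    { rewrite <- !Rcpow_plus; now f_equal. }
    pose proof (poch_neq_0 c (S n) Hc) as H1; pose proof (poch_neq_0 d (S n) Hd) as H2.
    pose proof (fact_neq n) as H3.
    pose proof (Rcpow_neq_0 (INR n) a) as Ha; pose proof (Rcpow_neq_0 (INR n) b) as Hb.
    pose proof (Rcpow_neq_0 (INR n) c) as Hc'; pose proof (Rcpow_neq_0 (INR n) d) as Hd'.
    transitivity (poch a (S n) * poch b (S n) / (poch c (S n) * poch d (S n)) *
      (Rcpow (INR n) c * Rcpow (INR n) d / (Rcpow (INR n) a * Rcpow (INR n) b))).
    + field; repeat split; auto.
    + rewrite E1; field; repeat split; auto.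
  - apply Clim_div.
    + apply Cmult_neq_0; now apply rGamma_neq_0.
    + apply Clim_mult; apply gauss_lim.
    + apply Clim_mult; apply gauss_lim.
Qed.

(** * Bounds for the coefficients of the Gauss series *)

Definition hcoef (a b c : C) (n : nat) : C :=
  poch a n * poch b n / (poch c n * RtoC (INR (fact n))).

Definition hratio (a b c : C) (n : nat) : C :=
  (a + RtoC (INR n)) * (b + RtoC (INR n)) / ((c + RtoC (INR n)) * (RtoC (INR n) + 1)).

Lemma shift_neq_0 (c : C) (n : nat) :
  (forall k : nat, c <> - RtoC (INR k)) -> c + RtoC (INR n) <> 0.
Proof.
  intros Hc E; apply (Hc n); replace c with (c + RtoC (INR n) - RtoC (INR n)) by ring.
  rewrite E; ring.
Qed.

Lemma hcoef_0 (a b c : C) : hcoef a b c 0 = 1.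
Proof. unfold hcoef; simpl; field; apply RtoC_neq; lra. Qed.

Lemma hcoef_S (a b c : C) (n : nat) :
  (forall k : nat, c <> - RtoC (INR k)) ->
  hcoef a b c (S n) = hratio a b c n * hcoef a b c n.
Proof.
  intros Hc; unfold hcoef, hratio; rewrite fact_S_C; simpl poch.
  field; repeat split; first [now apply shift_neq_0 | now apply poch_neq_0 |
    apply fact_neq | apply RtoC_INR_S_neq].
Qed.

(* The coefficients of [(1 - x) ^ (- s)]. *)
Fixpoint binco (s : R) (n : nat) : R :=
  match n with
  | O => 1
  | S m => binco s m * ((s + INR m) / (INR m + 1))
  end.

Lemma binco_pos (s : R) (n : nat) : 0 < s -> 0 < binco s n.
Proof.
  intros Hs; induction n as [| n IH]; simpl; [lra |].
  pose proof (pos_INR n).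
  apply Rmult_lt_0_compat; [exact IH | apply Rdiv_lt_0_compat; lra].
Qed.

Lemma binco_ratio_ge (s : R) (n : nat) :
  0 < s -> Rmin s 1 <= (s + INR n) / (INR n + 1).
Proof.
  intros Hs; pose proof (pos_INR n) as Hn.
  apply Rmult_le_reg_r with (INR n + 1)%R; [lra |].
  unfold Rdiv; rewrite Rmult_assoc, Rinv_l, Rmult_1_r by lra.
  pose proof (Rmin_l s 1); pose proof (Rmin_r s 1).
  assert (0 < Rmin s 1) by (apply Rmin_glb_lt; lra). nra.
Qed.

Lemma Cmod_shift_ge (c : C) (c0 : R) (n : nat) :
  0 < c0 -> c0 <= Re c -> Rmin c0 1 * (INR n + 1) <= Cmod (c + RtoC (INR n)).
Proof.
  intros Hc0 Hc; pose proof (pos_INR n) as Hn.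
  apply Rle_trans with (Re (c + RtoC (INR n)));
    [| apply Rle_trans with (2 := re_le_Cmod _), Rle_abs].
  rewrite Re_plus, Re_RtoC.
  pose proof (Rmin_l c0 1); pose proof (Rmin_r c0 1); nra.
Qed.

(** With al = a + b - c the ratio is (n + al + (a b - al c)/(c + n))/(n + 1). As Re al <= s, its
    modulus exceeds (s + n)/(n + 1), the ratio for (1 - x)^(-s), by a relative error O(1/n^2) at
    most. *)
Lemma hratio_bound (r c0 s : R) :
  0 <= r -> 0 < c0 -> 0 < s -> exists A, (0 < A) /\
  forall a b c : C, Cmod a <= r -> Cmod b <= r -> Cmod c <= r ->
  c0 <= Re c -> Re (a + b - c) <= s ->
  forall n, Cmod (hratio a b c n) <=
             (1 + A / (INR n + 1) ^ 2) * ((s + INR n) / (INR n + 1)).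
Proof.
  intros Hr Hc0 Hs.
  set (m := Rmin c0 1); set (m' := Rmin s 1).
  assert (Hm : 0 < m) by (apply Rmin_glb_lt; lra).
  assert (Hm' : 0 < m') by (apply Rmin_glb_lt; lra).
  (* [B] makes 2(s + n) B/(n + 1) absorb |al|^2 <= 9 r^2 when |n + al| is compared with s + n; [K]
     bounds the remaining quotient. Division by [m'] later turns these additive errors into a
     relative one. *)
  set (B := (9 * r ^ 2 / (2 * m'))%R).
  set (K := (4 * r ^ 2 / m)%R).
  assert (Hr2 : 0 <= r ^ 2) by apply pow2_ge_0.
  assert (HB : 0 <= B).
  { apply Rmult_le_pos; [lra | left; apply Rinv_0_lt_compat; lra]. }
  assert (HK : 0 <= K).
  { apply Rmult_le_pos; [lra | left; apply Rinv_0_lt_compat; lra]. }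
  exists ((B + K) / m' + 1)%R; split.
  { assert (0 <= (B + K) / m'); [| lra].
    apply Rmult_le_pos; [lra | left; apply Rinv_0_lt_compat; lra]. }
  intros a b c Ha Hb Hc Hc1 Hal n.
  pose proof (pos_INR n) as Hn.
  set (al := a + b - c).
  assert (Hcn : c + RtoC (INR n) <> 0) by (apply shift_neq_0, Re_pos_not_pole; lra).
  assert (E : hratio a b c n =
    ((RtoC (INR n) + al) + (a * b - al * c) / (c + RtoC (INR n))) / (RtoC (INR n) + 1)).
  { unfold hratio, al; field; split; first [apply RtoC_INR_S_neq | exact Hcn]. }
  rewrite E, Cmod_div by apply RtoC_INR_S_neq.
  rewrite <- (RtoC_plus (INR n)), Cmod_R, (Rabs_pos_eq (INR n + 1)) by lra.
  apply Rmult_le_reg_r with (INR n + 1)%R; [lra |].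
  unfold Rdiv at 1; rewrite Rmult_assoc, Rinv_l, Rmult_1_r by lra.
  assert (H1 : Cmod (RtoC (INR n) + al) <= (s + INR n) + B / (INR n + 1)).
  { assert (HBn : 0 <= B / (INR n + 1)).
    { apply Rmult_le_pos; [lra | left; apply Rinv_0_lt_compat; lra]. }
    apply Rsqr_incr_0_var; [unfold Rsqr | lra].
    assert (Hmod : (Cmod (RtoC (INR n) + al) ^ 2 = INR n ^ 2 + 2 * INR n * Re al + Cmod al ^ 2)%R).
    { rewrite !Cmod2_alt; ReIm; ring. }
    assert (Hal2 : Cmod al ^ 2 <= 9 * r ^ 2).
    { replace (9 * r ^ 2)%R with ((3 * r) ^ 2)%R by ring.
      apply pow_incr; split; [apply Cmod_ge_0 |].
      unfold al; pose proof (Cmod_triangle a b); pose proof (Cmod_minus_le (a + b) c); lra. }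
    assert (HB2 : 9 * r ^ 2 <= 2 * (s + INR n) * (B / (INR n + 1))).
    { replace (2 * (s + INR n) * (B / (INR n + 1)))%R with
        ((2 * B) * ((s + INR n) / (INR n + 1)))%R by (field; lra).
      apply Rle_trans with (2 * B * m')%R.
      - right; unfold B; field; lra.
      - apply Rmult_le_compat_l; [lra | now apply binco_ratio_ge]. }
    fold al in Hal.
    assert (INR n * Re al <= INR n * s) by (apply Rmult_le_compat_l; lra).
    pose proof (pow2_ge_0 s); pose proof (pow2_ge_0 (B / (INR n + 1))).
    nra. }
  assert (H2 : Cmod ((a * b - al * c) / (c + RtoC (INR n))) <= K / (INR n + 1)).
  { rewrite Cmod_div by exact Hcn.
    pose proof (Cmod_shift_ge c c0 n Hc0 Hc1) as H; fold m in H.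
    replace (K / (INR n + 1))%R with ((4 * r ^ 2) * / (m * (INR n + 1)))%R
      by (unfold K; field; lra).
    apply Rmult_le_compat; [apply Cmod_ge_0 | | |].
    - left; apply Rinv_0_lt_compat; nra.
    - pose proof (Cmod_minus_le (a * b) (al * c)) as H3.
      rewrite !Cmod_mult in H3.
      assert (Cmod al <= 3 * r).
      { unfold al; pose proof (Cmod_triangle a b); pose proof (Cmod_minus_le (a + b) c); lra. }
      assert (Cmod a * Cmod b <= r * r) by (apply Rmult_le_compat; auto; apply Cmod_ge_0).
      assert (Cmod al * Cmod c <= 3 * r * r) by (apply Rmult_le_compat; auto; apply Cmod_ge_0).
      lra.
    - apply Rinv_le_contravar; [nra | exact H]. }
  apply Rle_trans with (1 := Cmod_triangle _ _).
  apply Rle_trans with ((s + INR n) + (B + K) / (INR n + 1))%R.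
  { unfold Rdiv in *; lra. }
  replace ((1 + ((B + K) / m' + 1) / (INR n + 1) ^ 2) * ((s + INR n) / (INR n + 1)) * (INR n + 1))%R
    with ((s + INR n) + (((B + K) / m' + 1) * ((s + INR n) / (INR n + 1))) / (INR n + 1))%R
    by (field; lra).
  apply Rplus_le_compat_l.
  unfold Rdiv at 1 2; apply Rmult_le_compat_r; [left; apply Rinv_0_lt_compat; lra |].
  apply Rle_trans with (((B + K) / m' + 1) * m')%R.
  - replace (((B + K) / m' + 1) * m')%R with (B + K + m')%R by (field; lra); lra.
  - apply Rmult_le_compat_l; [| now apply binco_ratio_ge].
    assert (0 <= (B + K) / m'); [| lra].
    apply Rmult_le_pos; [lra | left; apply Rinv_0_lt_compat; lra].
Qed.

(** Division by [binco s n] reduces this to the recurrence with factors 1 + A/(n + 1)^2. *)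
Lemma binco_recurrence_bound (x : nat -> R) (s A d : R) :
  0 < s -> 0 < A -> 0 <= d -> 0 <= x O ->
  (forall n, x (S n) <= (1 + A / (INR n + 1) ^ 2) * ((s + INR n) / (INR n + 1)) * x n
                         + d / (INR n + 1) ^ 2 * binco s (S n)) ->
  forall n, x n <= (x O + d / A) * exp (2 * A) * binco s n.
Proof.
  intros Hs HA Hd Hx0 Hx n.
  assert (Hp : forall k, 0 < binco s k) by (intros; now apply binco_pos).
  assert (H : x n / binco s n <= (x O / binco s O + d / A) * exp (2 * A)).
  { apply (recurrence_bound (fun n => x n / binco s n)%R); auto.
    - simpl; lra.
    - intros k; pose proof (Hp k); pose proof (Hp (S k)) as HS; pose proof (pos_INR k).
      apply Rmult_le_reg_r with (binco s (S k)); [exact HS |].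
      unfold Rdiv at 1; rewrite Rmult_assoc, Rinv_l, Rmult_1_r by lra.
      apply Rle_trans with (1 := Hx k); right; simpl binco; field; lra. }
  apply Rmult_le_compat_r with (r := binco s n) in H; [| left; apply Hp].
  unfold Rdiv in H at 1; rewrite Rmult_assoc, Rinv_l, Rmult_1_r in H by (pose proof (Hp n); lra).
  simpl binco in H at 1; now rewrite Rdiv_1_r in H.
Qed.

Lemma hcoef_bound_unif (r c0 s : R) :
  0 <= r -> 0 < c0 -> 0 < s -> exists M, (0 < M) /\
  forall a b c : C, Cmod a <= r -> Cmod b <= r -> Cmod c <= r ->
  c0 <= Re c -> Re (a + b - c) <= s ->
  forall n, Cmod (hcoef a b c n) <= M * binco s n.
Proof.
  intros Hr Hc0 Hs; destruct (hratio_bound r c0 s Hr Hc0 Hs) as [A [HA H]].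
  exists (exp (2 * A)); split; [apply exp_pos |].
  intros a b c Ha Hb Hc Hc1 Hal n.
  assert (E : (Cmod (hcoef a b c 0) + 0 / A = 1)%R).
  { rewrite hcoef_0, Cmod_1; field; lra. }
  replace (exp (2 * A)) with ((Cmod (hcoef a b c 0) + 0 / A) * exp (2 * A))%R by (rewrite E; ring).
  apply (binco_recurrence_bound (fun n => Cmod (hcoef a b c n)));
    [lra | lra | lra | apply Cmod_ge_0 |].
  intros k; rewrite hcoef_S, Cmod_mult by (apply Re_pos_not_pole; lra).
  replace (0 / (INR k + 1) ^ 2)%R with 0%R by (unfold Rdiv; ring).
  rewrite Rmult_0_l, Rplus_0_r.
  apply Rmult_le_compat_r; [apply Cmod_ge_0 | now apply H].
Qed.

Lemma hcoef_bound (a b c : C) (s : R) :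
  0 < Re c -> 0 < s -> Re (a + b - c) <= s ->
  exists M, (0 < M) /\ forall n, Cmod (hcoef a b c n) <= M * binco s n.
Proof.
  intros Hc Hs Hal.
  set (r := (Cmod a + Cmod b + Cmod c)%R).
  pose proof (Cmod_ge_0 a); pose proof (Cmod_ge_0 b); pose proof (Cmod_ge_0 c).
  destruct (hcoef_bound_unif r (Re c) s) as [M [HM H2]]; try (unfold r; lra).
  exists M; split; [exact HM |]; apply H2; unfold r; try lra.
Qed.

(** Since both triples have the same a + b - c, the leading parts n + al of the ratios agree, and
    the difference is of order e/n^2 instead of e/n. The Gronwall bound relies on this gain. *)
Lemma hratio_diff_bound (r c0 e : R) (a b c a' b' c' : C) (n : nat) :
  0 < c0 -> Cmod a <= r -> Cmod b <= r -> Cmod c <= r ->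
  Cmod a' <= r -> Cmod b' <= r -> Cmod c' <= r ->
  c0 <= Re c -> c0 <= Re c' -> a + b - c = a' + b' - c' ->
  Cmod (a - a') <= e -> Cmod (b - b') <= e -> Cmod (c - c') <= e ->
  Cmod (hratio a b c n - hratio a' b' c' n) <=
   (6 * r + 3 * r ^ 2) / Rmin c0 1 ^ 2 * e / (INR n + 1) ^ 2.
Proof.
  intros Hc0 Ha Hb Hc Ha' Hb' Hc' Hc1 Hc1' E Hda Hdb Hdc.
  pose proof (pos_INR n) as Hn.
  set (m := Rmin c0 1); assert (Hm : 0 < m) by (apply Rmin_glb_lt; lra).
  assert (Hcn : c + RtoC (INR n) <> 0) by (apply shift_neq_0, Re_pos_not_pole; lra).
  assert (Hcn' : c' + RtoC (INR n) <> 0) by (apply shift_neq_0, Re_pos_not_pole; lra).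
  set (N := RtoC (INR n)) in *.
  (* The numerator is arranged so that every summand contains one of the differences of parameters;
     [E0] brings in the condition on a + b - c by eliminating b. *)
  assert (Eq : hratio a b c n - hratio a' b' c' n =
    (N * ((a * (b - b') + b' * (a - a')) + (((a - a') + (b - b')) * c' + (a' + b') * (- (c - c'))))
     + ((a * (b - b') + b' * (a - a')) * c' + a' * b' * (- (c - c'))))
    / ((c + N) * (c' + N) * (N + 1))).
  { assert (E0 : b = a' + b' - c' + c - a) by (rewrite <- E; ring).
    unfold hratio; fold N; rewrite E0; field.
    repeat split; auto; apply RtoC_INR_S_neq. }
  pose proof (Cmod_ge_0 a) as P1; pose proof (Cmod_ge_0 b) as P2; pose proof (Cmod_ge_0 c) as P3.
  pose proof (Cmod_ge_0 a') as P4; pose proof (Cmod_ge_0 b') as P5; pose proof (Cmod_ge_0 c') as P6.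
  pose proof (Cmod_ge_0 (a - a')) as P7; pose proof (Cmod_ge_0 (b - b')) as P8.
  pose proof (Cmod_ge_0 (c - c')) as P9.
  assert (Q1 : Cmod (a * (b - b') + b' * (a - a')) <= 2 * r * e).
  { apply Rle_trans with (1 := Cmod_triangle _ _); rewrite !Cmod_mult.
    assert (Cmod a * Cmod (b - b') <= r * e) by (apply Rmult_le_compat; auto).
    assert (Cmod b' * Cmod (a - a') <= r * e) by (apply Rmult_le_compat; auto). lra. }
  assert (Q2 : Cmod (((a - a') + (b - b')) * c' + (a' + b') * (- (c - c'))) <= 4 * r * e).
  { apply Rle_trans with (1 := Cmod_triangle _ _); rewrite !Cmod_mult, Cmod_opp.
    assert (Cmod (a - a' + (b - b')) * Cmod c' <= (e + e) * r).
    { apply Rmult_le_compat; auto; [apply Cmod_ge_0 |].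
      apply Rle_trans with (1 := Cmod_triangle _ _); lra. }
    assert (Cmod (a' + b') * Cmod (c - c') <= (r + r) * e).
    { apply Rmult_le_compat; auto; [apply Cmod_ge_0 |].
      apply Rle_trans with (1 := Cmod_triangle _ _); lra. }
    lra. }
  assert (Q3 : Cmod ((a * (b - b') + b' * (a - a')) * c' + a' * b' * (- (c - c'))) <= 3 * r ^ 2 * e).
  { apply Rle_trans with (1 := Cmod_triangle _ _); rewrite !Cmod_mult, Cmod_opp.
    assert (Cmod (a * (b - b') + b' * (a - a')) * Cmod c' <= 2 * r * e * r).
    { apply Rmult_le_compat; auto; apply Cmod_ge_0. }
    assert (Cmod a' * Cmod b' * Cmod (c - c') <= r * r * e).
    { apply Rmult_le_compat; auto; [now apply Rmult_le_pos | now apply Rmult_le_compat]. }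
    lra. }
  rewrite Eq, Cmod_div.
  2: { repeat apply Cmult_neq_0; auto; apply RtoC_INR_S_neq. }
  assert (HN : Cmod N = INR n) by (unfold N; rewrite Cmod_R; apply Rabs_pos_eq; lra).
  assert (HN1 : Cmod (N + 1) = (INR n + 1)%R).
  { unfold N; rewrite <- RtoC_plus, Cmod_R; apply Rabs_pos_eq; lra. }
  pose proof (Cmod_shift_ge c c0 n Hc0 Hc1) as D1; fold m N in D1.
  pose proof (Cmod_shift_ge c' c0 n Hc0 Hc1') as D2; fold m N in D2.
  replace ((6 * r + 3 * r ^ 2) / m ^ 2 * e / (INR n + 1) ^ 2)%R with
    ((6 * r + 3 * r ^ 2) * e * (INR n + 1) * / (m * (INR n + 1) * (m * (INR n + 1)) * (INR n + 1)))%R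
    by (field; lra).
  assert (HmN : 0 < m * (INR n + 1)) by nra.
  unfold Rdiv; apply Rmult_le_compat.
  - apply Cmod_ge_0.
  - rewrite !Cmod_mult, HN1; left; apply Rinv_0_lt_compat.
    repeat apply Rmult_lt_0_compat; lra.
  - apply Rle_trans with (1 := Cmod_triangle _ _); rewrite Cmod_mult, HN.
    pose proof (Cmod_triangle (a * (b - b') + b' * (a - a'))
      (((a - a') + (b - b')) * c' + (a' + b') * (- (c - c')))) as Q4.
    set (X := Cmod _) in Q4 at 1.
    assert (HX : INR n * X <= INR n * (6 * r * e)) by (apply Rmult_le_compat_l; lra).
    fold X.
    assert (0 <= r) by lra. assert (0 <= e) by lra.
    assert (0 <= r * e) by now apply Rmult_le_pos.
    assert (0 <= INR n * (3 * r ^ 2 * e)).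
    { apply Rmult_le_pos; [lra |]; apply Rmult_le_pos; [| lra].
      pose proof (pow2_ge_0 r); lra. }
    nra.
  - rewrite !Cmod_mult, HN1; apply Rinv_le_contravar.
    + repeat apply Rmult_lt_0_compat; lra.
    + apply Rmult_le_compat_r; [lra |]; apply Rmult_le_compat; lra.
Qed.

(** The difference of coefficients satisfies the recurrence of the first triple with a source term
    of size e/n^2 times [binco]; the bound is therefore linear in e without loss in the growth
    exponent. *)
Lemma hcoef_diff_bound_unif (r c0 s : R) :
  0 <= r -> 0 < c0 -> 0 < s -> exists M, (0 < M) /\
  forall (e : R) (a b c a' b' c' : C),
  Cmod a <= r -> Cmod b <= r -> Cmod c <= r ->
  Cmod a' <= r -> Cmod b' <= r -> Cmod c' <= r ->
  c0 <= Re c -> c0 <= Re c' -> a + b - c = a' + b' - c' -> Re (a + b - c) <= s ->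
  Cmod (a - a') <= e -> Cmod (b - b') <= e -> Cmod (c - c') <= e ->
  forall n, Cmod (hcoef a b c n - hcoef a' b' c' n) <= M * e * binco s n.
Proof.
  intros Hr Hc0 Hs.
  destruct (hratio_bound r c0 s Hr Hc0 Hs) as [A [HA HH]].
  destruct (hcoef_bound_unif r c0 s Hr Hc0 Hs) as [M [HM HB]].
  set (D := ((6 * r + 3 * r ^ 2) / Rmin c0 1 ^ 2)%R).
  assert (Hm : 0 < Rmin c0 1) by (apply Rmin_glb_lt; lra).
  assert (Hm' : 0 < Rmin s 1) by (apply Rmin_glb_lt; lra).
  assert (HD : 0 <= D).
  { apply Rmult_le_pos; [pose proof (pow2_ge_0 r); lra |].
    left; apply Rinv_0_lt_compat, pow_lt, Hm. }
  assert (HQ0 : 0 <= D * M / Rmin s 1).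
  { apply Rmult_le_pos; [apply Rmult_le_pos; lra | left; now apply Rinv_0_lt_compat]. }
  exists (D * M / Rmin s 1 / A * exp (2 * A) + 1)%R; split.
  { apply Rplus_le_lt_0_compat; [| lra].
    apply Rmult_le_pos; [| left; apply exp_pos].
    apply Rmult_le_pos; [exact HQ0 | left; now apply Rinv_0_lt_compat]. }
  intros e a b c a' b' c' Ha Hb Hc Ha' Hb' Hc' Hc1 Hc1' E Hal Hda Hdb Hdc n.
  assert (He : 0 <= e) by (pose proof (Cmod_ge_0 (a - a')); lra).
  assert (Hp : forall k, 0 < binco s k) by (intros; now apply binco_pos).
  set (Q := (D * M / Rmin s 1 * e)%R).
  assert (HQ : 0 <= Q) by (now apply Rmult_le_pos).
  assert (H0 : Cmod (hcoef a b c 0 - hcoef a' b' c' 0) = 0%R).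
  { rewrite !hcoef_0; replace (1 - 1) with (RtoC 0) by ring; apply Cmod_0. }
  assert (Hu : Cmod (hcoef a b c n - hcoef a' b' c' n) <=
    (Cmod (hcoef a b c 0 - hcoef a' b' c' 0) + Q / A) * exp (2 * A) * binco s n).
  { apply (binco_recurrence_bound (fun n => Cmod (hcoef a b c n - hcoef a' b' c' n)));
      [lra | lra | exact HQ | apply Cmod_ge_0 |].
    intros k; rewrite !hcoef_S by (apply Re_pos_not_pole; lra).
    replace (hratio a b c k * hcoef a b c k - hratio a' b' c' k * hcoef a' b' c' k) with
      (hratio a b c k * (hcoef a b c k - hcoef a' b' c' k) +
       (hratio a b c k - hratio a' b' c' k) * hcoef a' b' c' k) by ring.
    apply Rle_trans with (1 := Cmod_triangle _ _); rewrite !Cmod_mult.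
    apply Rplus_le_compat.
    - apply Rmult_le_compat_r; [apply Cmod_ge_0 | now apply HH].
    - pose proof (pos_INR k); pose proof (Hp k).
      apply Rle_trans with (D * e / (INR k + 1) ^ 2 * (M * binco s k))%R.
      + apply Rmult_le_compat; try apply Cmod_ge_0; [now apply hratio_diff_bound |].
        apply HB; auto; now rewrite <- E.
      (* The source has to be measured against [binco s (S k)], whose ratio to [binco s k] is at
         least min(s, 1). *)
      + simpl binco; set (t := ((s + INR k) / (INR k + 1))%R).
        replace (D * e / (INR k + 1) ^ 2 * (M * binco s k))%R with
          (Q / (INR k + 1) ^ 2 * binco s k * Rmin s 1)%R by (unfold Q; field; lra).
        rewrite <- Rmult_assoc; apply Rmult_le_compat_l; [| now apply binco_ratio_ge].
        apply Rmult_le_pos; [| lra]; apply Rmult_le_pos; [exact HQ |].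
        left; apply Rinv_0_lt_compat, pow_lt; lra. }
  rewrite H0, Rplus_0_l in Hu; apply Rle_trans with (1 := Hu).
  apply Rmult_le_compat_r; [left; apply Hp |].
  replace (Q / A * exp (2 * A))%R with (D * M / Rmin s 1 / A * exp (2 * A) * e)%R
    by (unfold Q; field; lra).
  apply Rmult_le_compat_r; lra.
Qed.

(** * Complex power series on the unit interval *)

Definition CPS (a : nat -> C) (x : R) : C :=
  (PSeries (fun n => Re (a n)) x, PSeries (fun n => Im (a n)) x).

(** Both real radii of convergence are at least 1, phrased with the strict inequality at |x| that
    termwise operations ask for. *)
Definition radius1 (a : nat -> C) : Prop :=
  forall x, Rabs x < 1 ->
  Rbar_lt (Rabs x) (CV_radius (fun n => Re (a n))) /\
  Rbar_lt (Rabs x) (CV_radius (fun n => Im (a n))).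

Lemma CPS_ext (a b : nat -> C) (x : R) : (forall n, a n = b n) -> CPS a x = CPS b x.
Proof.
  intros H; unfold CPS; f_equal; apply PSeries_ext; intros n; now rewrite H.
Qed.

Lemma radius1_ext (a b : nat -> C) : (forall n, a n = b n) -> radius1 a -> radius1 b.
Proof.
  intros H Ha x Hx; destruct (Ha x Hx) as [H1 H2]; split.
  - rewrite (CV_radius_ext _ (fun n => Re (a n))); [exact H1 |]; intros n; now rewrite H.
  - rewrite (CV_radius_ext _ (fun n => Im (a n))); [exact H2 |]; intros n; now rewrite H.
Qed.

Lemma CPS_0 (a : nat -> C) : CPS a 0 = a O.
Proof. unfold CPS; rewrite !PSeries_0; apply C_eta. Qed.

Lemma binco_S_ratio (s : R) (n : nat) :
  0 < s -> (binco s (S n) / binco s n = 1 + (s - 1) * / INR (S n))%R.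
Proof.
  intros Hs; simpl binco; rewrite S_INR.
  pose proof (binco_pos s n Hs); pose proof (INR_S_pos n); field; lra.
Qed.

Lemma is_lim_seq_inv_S : is_lim_seq (fun n => / INR (S n))%R 0%R.
Proof.
  apply (is_lim_seq_incr_1 (fun n => / INR n)%R).
  replace (Finite 0) with (Rbar_inv p_infty) by reflexivity.
  apply is_lim_seq_inv; [apply is_lim_seq_INR | discriminate].
Qed.

Lemma binco_radius (s : R) : 0 < s -> CV_radius (binco s) = 1%R.
Proof.
  intros Hs; replace (Finite 1) with (Finite (/ 1)) by (f_equal; field).
  apply CV_radius_finite_DAlembert; [| lra |].
  - intros n; pose proof (binco_pos s n Hs); lra.
  - apply is_lim_seq_ext with (fun n => Rabs (1 + (s - 1) * / INR (S n))).
    { intros n; now rewrite binco_S_ratio. }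
    replace (Finite 1) with (Rbar_abs (Finite (1 + (s - 1) * 0))).
    2: { simpl; f_equal; rewrite Rmult_0_r, Rplus_0_r; apply Rabs_R1. }
    apply is_lim_seq_abs, is_lim_seq_plus'; [apply is_lim_seq_const |].
    apply is_lim_seq_mult'; [apply is_lim_seq_const | apply is_lim_seq_inv_S].
Qed.

Lemma CV_radius_binco_bound (a : nat -> R) (s M x : R) :
  0 < s -> (forall n, Rabs (a n) <= M * binco s n) -> Rabs x < 1 ->
  Rbar_lt (Rabs x) (CV_radius a).
Proof.
  intros Hs Ha Hx.
  (* A radius strictly between |x| and 1, since boundedness at [y] yields only a weak inequality. *)
  set (y := ((Rabs x + 1) / 2)%R).
  pose proof (Rabs_pos x) as Hx0.
  assert (Hy : 0 <= y < 1) by (unfold y; lra).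
  apply Rbar_lt_le_trans with (Finite y); [simpl; unfold y; lra |].
  apply (proj1 (CV_radius_bounded a)).
  assert (H1 : ex_series (fun n => Rabs (binco s n * y ^ n))).
  { apply CV_disk_inside; rewrite binco_radius, Rabs_pos_eq by lra; simpl; lra. }
  apply ex_series_lim_0 in H1.
  assert (H2 : exists K, forall n, Rabs (binco s n * y ^ n) <= K).
  { destruct (filterlim_bounded (fun n => Rabs (binco s n * y ^ n)) (ex_intro _ 0%R H1)) as [K HK].
    exists K; intros n; apply Rle_trans with (2 := HK n).
    unfold norm; simpl; unfold abs; simpl; apply Rle_abs. }
  destruct H2 as [K HK]; exists (M * K)%R; intros n.
  rewrite Rabs_mult.
  assert (HM : 0 <= M).
  { pose proof (Ha O) as H; simpl in H; pose proof (Rabs_pos (a O)); lra. }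
  apply Rle_trans with (M * Rabs (binco s n * y ^ n))%R.
  - rewrite Rabs_mult, (Rabs_pos_eq (binco s n)) by (left; now apply binco_pos).
    rewrite <- Rmult_assoc; apply Rmult_le_compat_r; [apply Rabs_pos | apply Ha].
  - now apply Rmult_le_compat_l.
Qed.

Lemma radius1_binco (a : nat -> C) (s M : R) :
  0 < s -> (forall n, Cmod (a n) <= M * binco s n) -> radius1 a.
Proof.
  intros Hs Ha x Hx; split; apply CV_radius_binco_bound with s M; auto; intros n.
  - apply Rle_trans with (2 := Ha n), re_le_Cmod.
  - apply Rle_trans with (2 := Ha n), im_le_Cmod.
Qed.

Lemma CPS_plus (a b : nat -> C) (x : R) :
  radius1 a -> radius1 b -> Rabs x < 1 ->
  CPS (fun n => a n + b n) x = CPS a x + CPS b x.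
Proof.
  intros Ha Hb Hx; destruct (Ha x Hx) as [A1 A2]; destruct (Hb x Hx) as [B1 B2].
  unfold CPS, Cplus; simpl fst; simpl snd; f_equal.
  - rewrite <- PSeries_plus by (now apply CV_radius_inside); reflexivity.
  - rewrite <- PSeries_plus by (now apply CV_radius_inside); reflexivity.
Qed.

Lemma Rbar_lt_min (x a b : Rbar) : Rbar_lt x a -> Rbar_lt x b -> Rbar_lt x (Rbar_min a b).
Proof.
  destruct x, a, b; simpl; auto; try contradiction; intros; apply Rmin_glb_lt; auto.
Qed.

Lemma radius1_plus (a b : nat -> C) :
  radius1 a -> radius1 b -> radius1 (fun n => a n + b n).
Proof.
  intros Ha Hb x Hx; destruct (Ha x Hx) as [A1 A2]; destruct (Hb x Hx) as [B1 B2]; split.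
  - eapply Rbar_lt_le_trans; [| exact (CV_radius_plus _ _)].
    now apply Rbar_lt_min.
  - eapply Rbar_lt_le_trans; [| exact (CV_radius_plus _ _)].
    now apply Rbar_lt_min.
Qed.

Lemma CV_radius_scal_lt (c : R) (a : nat -> R) (x : R) :
  Rbar_lt (Rabs x) (CV_radius a) -> Rbar_lt (Rabs x) (CV_radius (fun n => c * a n)%R).
Proof.
  intros H; destruct (Req_dec c 0) as [-> | Hc].
  - rewrite (CV_radius_ext _ (fun _ => 0%R)) by (intros n; apply Rmult_0_l).
    rewrite CV_radius_const_0; exact I.
  - change (fun n => c * a n)%R with (PS_scal c a); now rewrite CV_radius_scal.
Qed.

Lemma radius1_scal (c : C) (a : nat -> C) : radius1 a -> radius1 (fun n => c * a n).
Proof.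
  intros Ha.
  assert (H1 : radius1 (fun n => (Re c * Re (a n), Re c * Im (a n))%R)).
  { intros x Hx; destruct (Ha x Hx); split; simpl; now apply CV_radius_scal_lt. }
  assert (H2 : radius1 (fun n => (- Im c * Im (a n), Im c * Re (a n))%R)).
  { intros x Hx; destruct (Ha x Hx); split; simpl; now apply CV_radius_scal_lt. }
  apply radius1_ext with (2 := radius1_plus _ _ H1 H2); intros n.
  apply C_ext; ReIm; simpl; ring.
Qed.

Lemma CPS_scal (c : C) (a : nat -> C) (x : R) :
  radius1 a -> Rabs x < 1 -> CPS (fun n => c * a n) x = c * CPS a x.
Proof.
  intros Ha Hx.
  assert (H1 : radius1 (fun n => (Re c * Re (a n), Re c * Im (a n))%R)).
  { intros y Hy; destruct (Ha y Hy); split; simpl; now apply CV_radius_scal_lt. }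
  assert (H2 : radius1 (fun n => (- Im c * Im (a n), Im c * Re (a n))%R)).
  { intros y Hy; destruct (Ha y Hy); split; simpl; now apply CV_radius_scal_lt. }
  rewrite <- (CPS_ext (fun n => (Re c * Re (a n), Re c * Im (a n))%R + (- Im c * Im (a n), Im c * Re (a n))%R)).
  2: { intros n; apply C_ext; ReIm; simpl; ring. }
  rewrite CPS_plus by auto.
  apply C_ext; ReIm; unfold CPS; simpl.
  - rewrite (PSeries_scal (Re c) (fun n => Re (a n))), (PSeries_scal (- Im c) (fun n => Im (a n))).
    ring.
  - rewrite (PSeries_scal (Re c) (fun n => Im (a n))), (PSeries_scal (Im c) (fun n => Re (a n))).
    ring.
Qed.

Lemma radius1_minus (a b : nat -> C) :
  radius1 a -> radius1 b -> radius1 (fun n => a n - b n).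
Proof.
  intros Ha Hb; apply radius1_ext with (fun n => a n + (- (1)) * b n).
  { intros n; ring. }
  apply radius1_plus; [exact Ha | now apply radius1_scal].
Qed.

Lemma CPS_minus (a b : nat -> C) (x : R) :
  radius1 a -> radius1 b -> Rabs x < 1 ->
  CPS (fun n => a n - b n) x = CPS a x - CPS b x.
Proof.
  intros Ha Hb Hx; rewrite (CPS_ext _ (fun n => a n + (- (1)) * b n)) by (intros n; ring).
  rewrite CPS_plus, CPS_scal by (auto; now apply radius1_scal); ring.
Qed.

(* Coefficients of the derivative [d/dx], of the Euler operator [x d/dx] and, below, of the
   multiplication by [x]. *)
Definition Dco (a : nat -> C) (n : nat) : C := RtoC (INR (S n)) * a (S n).
Definition Tco (a : nat -> C) (n : nat) : C := RtoC (INR n) * a n.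

Lemma radius1_Dco (a : nat -> C) : radius1 a -> radius1 (Dco a).
Proof.
  intros Ha x Hx; destruct (Ha x Hx) as [H1 H2].
  rewrite <- CV_radius_derive in H1, H2; split.
  - rewrite (CV_radius_ext _ (PS_derive (fun n => Re (a n)))); [exact H1 |].
    intros n; unfold Dco; now rewrite Re_scal.
  - rewrite (CV_radius_ext _ (PS_derive (fun n => Im (a n)))); [exact H2 |].
    intros n; unfold Dco; now rewrite Im_scal.
Qed.

Lemma Cder_CPS (a : nat -> C) (x : R) :
  radius1 a -> Rabs x < 1 -> Cder (CPS a) x (CPS (Dco a) x).
Proof.
  intros Ha Hx; destruct (Ha x Hx) as [H1 H2]; split.
  - apply is_derive_val with (2 := is_derive_PSeries _ _ H1), PSeries_ext.
    intros n; unfold Dco; now rewrite Re_scal.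
  - apply is_derive_val with (2 := is_derive_PSeries _ _ H2), PSeries_ext.
    intros n; unfold Dco; now rewrite Im_scal.
Qed.

Definition Sco (a : nat -> C) (n : nat) : C := match n with O => 0 | S m => a m end.

Lemma radius1_Sco (a : nat -> C) : radius1 a -> radius1 (Sco a).
Proof.
  intros Ha x Hx; destruct (Ha x Hx) as [H1 H2].
  rewrite <- CV_radius_incr_1 in H1, H2; split.
  - rewrite (CV_radius_ext _ (PS_incr_1 (fun n => Re (a n)))); [exact H1 |].
    intros [| n]; reflexivity.
  - rewrite (CV_radius_ext _ (PS_incr_1 (fun n => Im (a n)))); [exact H2 |].
    intros [| n]; reflexivity.
Qed.

Lemma CPS_Sco (a : nat -> C) (x : R) : CPS (Sco a) x = RtoC x * CPS a x.
Proof.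
  apply C_ext; rewrite ?Re_scal, ?Im_scal; unfold CPS; simpl; rewrite <- PSeries_incr_1;
    apply PSeries_ext; intros [| n]; reflexivity.
Qed.

Lemma Tco_Sco (a : nat -> C) (n : nat) : Sco (Dco a) n = Tco a n.
Proof. destruct n; unfold Tco, Dco; simpl; [ring | reflexivity]. Qed.

Lemma radius1_Tco (a : nat -> C) : radius1 a -> radius1 (Tco a).
Proof.
  intros Ha; apply radius1_ext with (1 := Tco_Sco a); now apply radius1_Sco, radius1_Dco.
Qed.

Lemma CPS_Tco (a : nat -> C) (x : R) : CPS (Tco a) x = RtoC x * CPS (Dco a) x.
Proof. rewrite <- CPS_Sco; apply CPS_ext; intros n; now rewrite Tco_Sco. Qed.

Lemma PSeries_le (u v : nat -> R) (x : R) :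
  (forall n, Rabs (u n) <= v n) -> 0 <= x -> Rbar_lt (Rabs x) (CV_radius v) ->
  Rabs (PSeries u x) <= PSeries v x.
Proof.
  intros Huv Hx Hv; unfold PSeries.
  pose proof (CV_disk_inside v x Hv) as H.
  assert (H1 : forall n, Rabs (u n * x ^ n) <= v n * x ^ n).
  { intros n; rewrite Rabs_mult, (Rabs_pos_eq (x ^ n)) by (now apply pow_le).
    apply Rmult_le_compat_r; [now apply pow_le | apply Huv]. }
  assert (Hv' : ex_series (fun n => v n * x ^ n)%R).
  { apply ex_series_Rabs, H. }
  apply Rle_trans with (Series (fun n => Rabs (u n * x ^ n))).
  - apply Series_Rabs.
    apply (ex_series_le (V := R_CompleteNormedModule)) with (2 := Hv'); intros n.
    change (Rabs (Rabs (u n * x ^ n)) <= v n * x ^ n); now rewrite Rabs_Rabsolu.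
  - apply Series_le; [intros n; split; [apply Rabs_pos | apply H1] | exact Hv'].
Qed.

Lemma CPS_bound (w : nat -> C) (v : nat -> R) (x : R) :
  (forall n, Cmod (w n) <= v n) -> 0 <= x -> Rbar_lt (Rabs x) (CV_radius v) ->
  Cmod (CPS w x) <= 2 * PSeries v x.
Proof.
  intros Hw Hx Hv; apply Rle_trans with (1 := Cmod_le_ReIm _); unfold CPS; simpl Re; simpl Im.
  assert (H1 : Rabs (PSeries (fun n => Re (w n)) x) <= PSeries v x).
  { apply PSeries_le; auto; intros n; apply Rle_trans with (2 := Hw n), re_le_Cmod. }
  assert (H2 : Rabs (PSeries (fun n => Im (w n)) x) <= PSeries v x).
  { apply PSeries_le; auto; intros n; apply Rle_trans with (2 := Hw n), im_le_Cmod. }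
  lra.
Qed.

(** * The Gauss series as a power series: contiguity and differential equation *)

Lemma F_CPS (a b c : C) (x : R) : F a b c (RtoC x) = CPS (hcoef a b c) x.
Proof.
  unfold F, CSeries, CPS, PSeries; f_equal; apply Series_ext; intros n;
    fold (hcoef a b c n); rewrite <- RtoC_pow; ReIm; ring.
Qed.

Lemma radius1_hcoef (a b c : C) : 0 < Re c -> radius1 (hcoef a b c).
Proof.
  intros Hc.
  set (s := (Rmax 1 (Re (a + b - c)))).
  assert (H1 : 1 <= s) by apply Rmax_l.
  assert (H2 : Re (a + b - c) <= s) by apply Rmax_r.
  destruct (hcoef_bound a b c s Hc ltac:(lra) H2) as [M [HM HB]].
  apply radius1_binco with (2 := HB); lra.
Qed.

Lemma Dco_hcoef (a b c : C) (n : nat) :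
  (forall k : nat, c <> - RtoC (INR k)) ->
  Dco (hcoef a b c) n = a * b / c * hcoef (a + 1) (b + 1) (c + 1) n.
Proof.
  intros Hc; unfold Dco, hcoef.
  rewrite !poch_shift, fact_S_C, RtoC_INR_S.
  assert (Hc1 : poch (c + 1) n <> 0).
  { intros E; apply (poch_neq_0 c (S n) Hc); rewrite poch_shift, E; ring. }
  assert (Hc0 : c <> 0).
  { intros E; apply (Hc O); rewrite E; simpl; ring. }
  field; repeat split; auto; first [apply fact_neq | apply RtoC_INR_S_neq].
Qed.

Lemma hcoef_c_S (a b c : C) (n : nat) :
  (forall k : nat, c <> - RtoC (INR k)) ->
  hcoef a b (c + 1) n = c / (c + RtoC (INR n)) * hcoef a b c n.
Proof.
  intros Hc; unfold hcoef.
  assert (E : c * poch (c + 1) n = poch c n * (c + RtoC (INR n))).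
  { rewrite <- poch_shift; reflexivity. }
  pose proof (shift_neq_0 c n Hc) as H1; pose proof (poch_neq_0 c n Hc) as H2.
  assert (H0 : c <> 0).
  { intros E1; apply (Hc O); rewrite E1; simpl; ring. }
  assert (H3 : poch (c + 1) n <> 0).
  { intros E1; apply (Cmult_neq_0 _ _ H2 H1); rewrite <- E, E1; ring. }
  transitivity (c * (poch a n * poch b n) / (c * poch (c + 1) n * RtoC (INR (fact n)))).
  - field; repeat split; auto; apply fact_neq.
  - rewrite E; field; repeat split; auto; apply fact_neq.
Qed.

(** On coefficients [Dco - Tco] is the operator (1 - x) d/dx. Raising c to c + 1 improves the
    behaviour at 1 by one power, which makes the combination (1 - x) F' - (a + b - c) F tractable
    there. *)
Lemma hcoef_contiguous (a b c : C) (n : nat) :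
  (forall k : nat, c <> - RtoC (INR k)) ->
  Dco (hcoef a b c) n - Tco (hcoef a b c) n - (a + b - c) * hcoef a b c n =
  (c - a) * (c - b) / c * hcoef a b (c + 1) n.
Proof.
  intros Hc; unfold Dco, Tco; rewrite hcoef_S, hcoef_c_S by exact Hc.
  unfold hratio; rewrite RtoC_INR_S.
  assert (H0 : c <> 0).
  { intros E1; apply (Hc O); rewrite E1; simpl; ring. }
  field; repeat split; auto; first [now apply shift_neq_0 | apply RtoC_INR_S_neq].
Qed.

Lemma hyper_contiguous (a b c : C) (x : R) :
  0 < Re c -> Rabs x < 1 ->
  RtoC (1 - x) * CPS (Dco (hcoef a b c)) x - (a + b - c) * CPS (hcoef a b c) x =
  (c - a) * (c - b) / c * CPS (hcoef a b (c + 1)) x.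
Proof.
  intros Hc Hx.
  assert (R0 : radius1 (hcoef a b c)) by now apply radius1_hcoef.
  assert (R1 : radius1 (hcoef a b (c + 1))).
  { apply radius1_hcoef; rewrite Re_plus; simpl; lra. }
  rewrite <- (CPS_scal ((c - a) * (c - b) / c)) by auto.
  rewrite <- (CPS_ext (fun n => Dco (hcoef a b c) n - Tco (hcoef a b c) n -
    (a + b - c) * hcoef a b c n) (fun n => (c - a) * (c - b) / c * hcoef a b (c + 1) n)).
  2: { intros n; now apply hcoef_contiguous, Re_pos_not_pole. }
  pose proof (radius1_Dco _ R0) as RD; pose proof (radius1_Tco _ R0) as RT.
  rewrite (CPS_minus _ _ x (radius1_minus _ _ RD RT) (radius1_scal (a + b - c) _ R0) Hx).
  rewrite (CPS_minus _ _ x RD RT Hx), (CPS_scal _ _ x R0 Hx), CPS_Tco, RtoC_minus.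
  ring.
Qed.

Lemma hyper_ode (a b c : C) (x : R) :
  0 < Re c -> Rabs x < 1 ->
  RtoC (x * (1 - x)) * CPS (Dco (Dco (hcoef a b c))) x
    + (c - (a + b + 1) * RtoC x) * CPS (Dco (hcoef a b c)) x
  = a * b * CPS (hcoef a b c) x.
Proof.
  intros Hc Hx.
  assert (R0 : radius1 (hcoef a b c)) by now apply radius1_hcoef.
  set (h := hcoef a b c) in *.
  pose proof (radius1_Dco _ R0) as R1; pose proof (radius1_Dco _ R1) as R2.
  pose proof (radius1_Tco _ R0) as T0; pose proof (radius1_Tco _ R1) as T1.
  pose proof (radius1_Tco _ T0) as T2.
  (* The recurrence (n + 1)(c + n) h(n+1) = (a + n)(b + n) h(n), with powers of n read as Euler
     operators. *)
  assert (E : CPS (fun n => (Tco (Dco h) n + c * Dco h n) -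
                     (Tco (Tco h) n + ((a + b) * Tco h n + a * b * h n))) x = 0).
  { rewrite (CPS_ext _ (fun _ => 0)).
    - unfold CPS; simpl; rewrite PSeries_const_0; reflexivity.
    - intros n; unfold Tco, Dco, h; rewrite hcoef_S by now apply Re_pos_not_pole.
      unfold hratio; rewrite RtoC_INR_S; field; split;
        first [now apply shift_neq_0, Re_pos_not_pole | apply RtoC_INR_S_neq]. }
  (* With E = x d/dx, this is x^2 d^2/dx^2 = E^2 - E. *)
  assert (EX : x * x * CPS (Dco (Dco h)) x = CPS (Tco (Tco h)) x - CPS (Tco h) x).
  { rewrite <- CPS_minus by auto.
    rewrite <- Cmult_assoc, <- CPS_Tco, <- CPS_Sco.
    apply CPS_ext; intros [| n]; unfold Tco, Dco .
    - simpl; ring.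
    - unfold Sco; rewrite !RtoC_INR_S; ring. }
  pose proof (radius1_scal c _ R1) as S1; pose proof (radius1_scal (a + b) _ T0) as S2.
  pose proof (radius1_scal (a * b) _ R0) as S3; pose proof (radius1_plus _ _ S2 S3) as S23.
  rewrite (CPS_minus _ _ x (radius1_plus _ _ T1 S1) (radius1_plus _ _ T2 S23) Hx) in E.
  rewrite (CPS_plus _ _ x T1 S1 Hx), (CPS_plus _ _ x T2 S23 Hx), (CPS_plus _ _ x S2 S3 Hx) in E.
  rewrite (CPS_scal _ _ x R1 Hx), (CPS_scal _ _ x T0 Hx), (CPS_scal _ _ x R0 Hx) in E.
  rewrite (CPS_Tco (Dco h)) in E.
  rewrite RtoC_mult, RtoC_minus.
  replace (x * (1 - x) * CPS (Dco (Dco h)) x) with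
    (x * CPS (Dco (Dco h)) x - x * x * CPS (Dco (Dco h)) x) by ring.
  rewrite EX.
  rewrite (CPS_Tco h) in E |- *.
  rewrite <- (Cplus_0_r (a * b * CPS h x)), <- E; ring.
Qed.

(** * Behaviour of power series at the endpoint 1 *)

Lemma one_minus_neq_0 (x : R) : x < 1 -> RtoC (1 - x) <> 0.
Proof. intros Hx; apply RtoC_neq; lra. Qed.

(** For b = c = 1 the right-hand side of the contiguous relation vanishes, so that (1 - x)^s
    F[s,1;1;x] has derivative 0. *)
Lemma binomial_series (s : C) (x : R) :
  0 <= x < 1 -> CPS (hcoef s 1 1) x = Rcpow (1 - x) (- s).
Proof.
  intros Hx.
  assert (R0 : radius1 (hcoef s 1 1)) by (apply radius1_hcoef; simpl; lra).
  assert (E : Rcpow (1 - 0) s * CPS (hcoef s 1 1) 0 = Rcpow (1 - x) s * CPS (hcoef s 1 1) x).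
  { apply (Cder_0_eq (fun t => Rcpow (1 - t) s * CPS (hcoef s 1 1) t)); [lra |].
    intros t Ht.
    assert (Ht1 : Rabs t < 1) by (rewrite Rabs_pos_eq; lra).
    eapply Cder_val; [| apply Cder_mult; [apply Cder_Rcpow_1m; lra | now apply Cder_CPS]].
    pose proof (hyper_contiguous s 1 1 t ltac:(simpl; lra) Ht1) as H.
    replace ((1 - s) * (1 - 1) / 1 * CPS (hcoef s 1 (1 + 1)) t) with (RtoC 0) in H
      by (unfold Cdiv; ring).
    replace (s + 1 - 1) with s in H by ring.
    pose proof (one_minus_neq_0 t ltac:(lra)) as H1.
    transitivity (Rcpow (1 - t) s / RtoC (1 - t) *
      (RtoC (1 - t) * CPS (Dco (hcoef s 1 1)) t - s * CPS (hcoef s 1 1) t)).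
    - field; exact H1.
    - rewrite H; ring. }
  rewrite Rminus_0_r, Rcpow_one, CPS_0, hcoef_0 in E.
  rewrite Rcpow_opp.
  transitivity (/ Rcpow (1 - x) s * (Rcpow (1 - x) s * CPS (hcoef s 1 1) x)).
  - field; apply Rcpow_neq_0.
  - rewrite <- E; field; apply Rcpow_neq_0.
Qed.

Lemma hcoef_binco (s : R) (n : nat) : hcoef (RtoC s) 1 1 n = RtoC (binco s n).
Proof.
  induction n as [| n IH]; [apply hcoef_0 |].
  rewrite hcoef_S by (apply Re_pos_not_pole; simpl; lra).
  rewrite IH; unfold hratio; simpl binco.
  pose proof (INR_S_pos n).
  rewrite RtoC_mult, RtoC_div, !RtoC_plus by lra.
  rewrite (Cplus_comm 1); field; apply RtoC_INR_S_neq.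
Qed.

Lemma binco_series (s x : R) :
  0 <= x < 1 -> PSeries (binco s) x = Rpower (1 - x) (- s).
Proof.
  intros Hx; pose proof (binomial_series (RtoC s) x Hx) as H.
  rewrite <- RtoC_opp, Rcpow_RtoC in H.
  transitivity (Re (CPS (hcoef (RtoC s) 1 1) x)); [| now rewrite H].
  apply PSeries_ext; intros n; now rewrite hcoef_binco.
Qed.

Lemma CPS_binco_bound (w : nat -> C) (s M x : R) :
  0 < s -> (forall n, Cmod (w n) <= M * binco s n) -> 0 <= x < 1 ->
  Cmod (CPS w x) <= 2 * M * Rpower (1 - x) (- s).
Proof.
  intros Hs Hw Hx.
  apply Rle_trans with (2 * PSeries (fun n => M * binco s n)%R x)%R.
  - apply CPS_bound; [exact Hw | lra |].
    apply CV_radius_scal_lt; rewrite binco_radius, Rabs_pos_eq by lra; simpl; lra.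
  - rewrite (PSeries_scal M (binco s)), binco_series by exact Hx; lra.
Qed.

Lemma Rpower_lim0 (t : R) :
  0 < t -> filterlim (fun x => Rpower x t) (at_right 0) (locally 0%R).
Proof.
  intros Ht P [eps HP]; unfold filtermap.
  generalize (at_right_between 0 (Rpower eps (/ t)) (exp_pos _)); apply filter_imp.
  intros x Hx; apply HP; change (Rabs (Rpower x t - 0) < eps).
  rewrite Rminus_0_r, Rabs_pos_eq by (left; apply exp_pos).
  replace (pos eps) with (Rpower (Rpower eps (/ t)) t).
  - apply Rlt_Rpower_l; lra.
  - rewrite Rpower_mult, Rinv_l, Rpower_1 by (try lra; apply cond_pos); reflexivity.
Qed.

Lemma Rpower_1m_lim0 (t : R) :
  0 < t -> filterlim (fun x => Rpower (1 - x) t) (at_left 1) (locally 0%R).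
Proof.
  intros Ht; apply (filterlim_comp R R R (fun x => 1 - x)%R (fun x => Rpower x t) _ (at_right 0)).
  2: now apply Rpower_lim0.
  intros P [eps HP]; exists eps; intros x Hx Hx1.
  apply HP; [| lra].
  change (Rabs (x - 1) < eps) in Hx; change (Rabs (1 - x - 0) < eps).
  now rewrite Rminus_0_r, Rabs_minus_sym.
Qed.

(** Covers the finitely many initial terms that an asymptotic estimate leaves out. *)
Lemma finite_bound (u v : nat -> R) (N : nat) :
  (forall n, 0 < v n) -> exists Q, (0 <= Q) /\ forall n, (n < N)%nat -> u n <= Q * v n.
Proof.
  intros Hv; induction N as [| N [Q [HQ IH]]].
  - exists 0%R; split; [lra | intros; lia].
  - exists (Q + Rabs (u N) / v N)%R.
    assert (H : 0 <= Rabs (u N) / v N).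
    { apply Rmult_le_pos; [apply Rabs_pos | left; apply Rinv_0_lt_compat, Hv]. }
    split; [lra |]; intros n Hn; pose proof (Hv n).
    destruct (Nat.eq_dec n N) as [-> | Hne].
    + rewrite Rmult_plus_distr_r.
      replace (Rabs (u N) / v N * v N)%R with (Rabs (u N)) by (field; lra).
      pose proof (Rle_abs (u N)); assert (0 <= Q * v N) by (apply Rmult_le_pos; lra). lra.
    + apply Rle_trans with (1 := IH n ltac:(lia)); apply Rmult_le_compat_r; lra.
Qed.

Lemma binco_mono (s t : R) (n : nat) : 0 < s -> s <= t -> binco s n <= binco t n.
Proof.
  intros Hs Hst; induction n as [| n IH]; simpl; [lra |].
  pose proof (pos_INR n); pose proof (binco_pos s n Hs).
  apply Rmult_le_compat; try lra.
  - apply Rlt_le, Rdiv_lt_0_compat; lra.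
  - apply Rmult_le_compat_r; [left; apply Rinv_0_lt_compat |]; lra.
Qed.

(** An Abelian comparison with (1 - x)^(-s), whose coefficients are [hcoef s 1 1]. The terms from
    some index N on contribute a small multiple of (1 - x)^(-Re s), the earlier ones something of
    lower order. *)
Lemma series_asymptotics (s : C) (u : nat -> C) (K : C) :
  0 < Re s ->
  Clim eventually (fun n => u n / hcoef s 1 1 n) K ->
  Clim (at_left 1) (fun x => Rcpow (1 - x) s * CPS u x) K.
Proof.
  intros Hs HK.
  set (sg := Re s) in *.
  destruct (hcoef_bound s 1 1 sg) as [M [HM HB]]; [simpl; lra | exact Hs | |].
  { unfold sg; ReIm; simpl; lra. }
  assert (He0 : forall n, hcoef s 1 1 n <> 0).
  { intros n; unfold hcoef.
    apply Cmult_neq_0.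
    - apply Cmult_neq_0; [now apply poch_neq_0, Re_pos_not_pole |].
      rewrite poch_1; apply fact_neq.
    - apply Cinv_neq_0, Cmult_neq_0; [rewrite poch_1 |]; apply fact_neq. }
  set (w := fun n => u n - K * hcoef s 1 1 n).
  (* Finitely many terms fit under a multiple of any positive sequence; [binco (sg / 2)] is taken
     because its sum (1 - x)^(-sg/2) is negligible against (1 - x)^(-sg). *)
  assert (Hw : forall eta, 0 < eta -> exists Q, (0 <= Q) /\
            forall n, Cmod (w n) <= eta * M * binco sg n + Q * binco (sg / 2) n).
  { intros eta Heta; destruct (HK eta Heta) as [N HN].
    destruct (finite_bound (fun n => Cmod (w n)) (binco (sg / 2)) N) as [Q [HQ Hfin]].
    { intros n; apply binco_pos; lra. }
    exists Q; split; [exact HQ |]; intros n.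
    pose proof (binco_pos sg n Hs); pose proof (binco_pos (sg / 2) n ltac:(lra)).
    assert (0 <= eta * M * binco sg n) by (repeat apply Rmult_le_pos; lra).
    assert (0 <= Q * binco (sg / 2) n) by (apply Rmult_le_pos; lra).
    destruct (Nat.lt_ge_cases n N) as [Hn | Hn].
    - specialize (Hfin n Hn); simpl in Hfin; lra.
    - specialize (HN n Hn); simpl in HN.
      replace (w n) with ((u n / hcoef s 1 1 n - K) * hcoef s 1 1 n).
      2: { unfold w; field; apply He0. }
      rewrite Cmod_mult.
      assert (Cmod (u n / hcoef s 1 1 n - K) * Cmod (hcoef s 1 1 n) <= eta * (M * binco sg n)).
      { apply Rmult_le_compat; try apply Cmod_ge_0; [lra | apply HB]. }
      lra. }
  assert (Rw : radius1 w).
  { destruct (Hw 1%R Rlt_0_1) as [Q [HQ H]].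
    apply radius1_binco with sg (1 * M + Q)%R; [exact Hs |]; intros n.
    apply Rle_trans with (1 := H n); rewrite Rmult_plus_distr_r.
    apply Rplus_le_compat_l, Rmult_le_compat_l; [exact HQ |].
    apply binco_mono; lra. }
  assert (Re0 : radius1 (hcoef s 1 1)) by (apply radius1_hcoef; simpl; lra).
  assert (Ru : radius1 u).
  { apply radius1_ext with (fun n => w n + K * hcoef s 1 1 n).
    - intros n; unfold w; ring.
    - apply radius1_plus; [exact Rw | now apply radius1_scal]. }
  intros eps Heps.
  (* With this choice the main error 2 eta M equals eps/4. *)
  set (eta := (eps / (8 * M))%R).
  assert (Heta : 0 < eta) by (apply Rdiv_lt_0_compat; lra).
  destruct (Hw eta Heta) as [Q [HQ HwQ]].
  assert (Hlim : at_left 1 (fun x => 4 * Q * Rpower (1 - x) (sg / 2) < eps / 2)).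
  { assert (He' : 0 < eps / 2 / (4 * Q + 1)) by (apply Rdiv_lt_0_compat; lra).
    generalize (filterlim_R_eps _ _ _ He' (Rpower_1m_lim0 (sg / 2) ltac:(lra))).
    apply filter_imp; intros x Hx.
    rewrite Rminus_0_r, Rabs_pos_eq in Hx by (left; apply exp_pos).
    assert (0 < Rpower (1 - x) (sg / 2)) by apply exp_pos.
    apply Rle_lt_trans with ((4 * Q + 1) * Rpower (1 - x) (sg / 2))%R; [nra |].
    apply Rmult_lt_compat_l with (r := (4 * Q + 1)%R) in Hx; [| lra].
    replace ((4 * Q + 1) * (eps / 2 / (4 * Q + 1)))%R with (eps / 2)%R in Hx by (field; lra).
    exact Hx. }
  generalize (filter_and _ _ Hlim (at_left_between 0 1 Rlt_0_1)).
  apply filter_imp; intros x [Hx1 Hx0].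
  assert (Hx : 0 <= x < 1) by lra.
  assert (Hx' : Rabs x < 1) by (rewrite Rabs_pos_eq; lra).
  replace (Rcpow (1 - x) s * CPS u x - K) with (Rcpow (1 - x) s * CPS w x).
  2: { unfold w; rewrite CPS_minus, CPS_scal, binomial_series, Rcpow_opp
         by (auto; now apply radius1_scal).
       field; apply Rcpow_neq_0. }
  rewrite Cmod_mult, Cmod_Rcpow_Rpower; fold sg.
  assert (HC : Cmod (CPS w x) <= 2 * (eta * M * Rpower (1 - x) (- sg)
                                  + Q * Rpower (1 - x) (- (sg / 2)))).
  { rewrite <- !binco_series by exact Hx.
    replace (eta * M * PSeries (binco sg) x)%R with
      (PSeries (PS_scal (eta * M)%R (binco sg)) x) by apply PSeries_scal.
    replace (Q * PSeries (binco (sg / 2)) x)%R with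
      (PSeries (PS_scal Q (binco (sg / 2)%R)) x) by apply PSeries_scal.
    assert (C1 : Rbar_lt (Rabs x) (CV_radius (PS_scal (eta * M)%R (binco sg)))).
    { apply (CV_radius_scal_lt (eta * M)%R (binco sg)).
      rewrite binco_radius by lra; exact Hx'. }
    assert (C2 : Rbar_lt (Rabs x) (CV_radius (PS_scal Q (binco (sg / 2)%R)))).
    { apply (CV_radius_scal_lt Q (binco (sg / 2))).
      rewrite binco_radius by lra; exact Hx'. }
    rewrite <- PSeries_plus by (now apply CV_radius_inside).
    apply CPS_bound; [exact HwQ | lra |].
    eapply Rbar_lt_le_trans; [| exact (CV_radius_plus _ _)]; now apply Rbar_lt_min. }
  apply Rle_lt_trans with (Rpower (1 - x) sg * (2 * (eta * M * Rpower (1 - x) (- sg)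
                                  + Q * Rpower (1 - x) (- (sg / 2)))))%R.
  { apply Rmult_le_compat_l; [left; apply exp_pos | exact HC]. }
  replace (Rpower (1 - x) sg * (2 * (eta * M * Rpower (1 - x) (- sg)
     + Q * Rpower (1 - x) (- (sg / 2)))))%R with
     (2 * eta * M * (Rpower (1 - x) sg * Rpower (1 - x) (- sg)) +
      2 * Q * (Rpower (1 - x) sg * Rpower (1 - x) (- (sg / 2))))%R by ring.
  rewrite <- !Rpower_plus.
  replace (sg + - sg)%R with 0%R by ring; rewrite Rpower_O by lra.
  replace (sg + - (sg / 2))%R with (sg / 2)%R by field.
  replace (2 * eta * M * 1)%R with (eps / 4)%R by (unfold eta; field; lra).
  assert (0 < Rpower (1 - x) (sg / 2)) by apply exp_pos.
  nra.
Qed.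

(** * Gauss's summation theorem *)

(** The derivative is preferred to F because its exponent s = a + b - c + 1 has positive real part.
    Its coefficients, divided by those of (1 - x)^(-s), form a balanced Pochhammer quotient: (a + 1)
    + (b + 1) = (c + 1) + s. *)
Lemma hyper_deriv_lim (a b c : C) :
  0 < Re c -> -1 < Re (a + b - c) ->
  Clim (at_left 1) (fun x => Rcpow (1 - x) (a + b - c + 1) * CPS (Dco (hcoef a b c)) x)
    (rGamma a * rGamma b / (rGamma c * rGamma (a + b - c + 1))).
Proof.
  intros Hc Hal.
  pose proof (Re_pos_not_pole c Hc) as Hcp.
  assert (Hc0 : c <> 0) by (intros E; apply (Hcp O); rewrite E; simpl; ring).
  assert (Hc1 : forall k : nat, c + 1 <> - RtoC (INR k)).
  { apply Re_pos_not_pole; rewrite Re_plus, Re_RtoC; lra. }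
  set (s := a + b - c + 1).
  assert (Hs : 0 < Re s) by (unfold s; rewrite Re_plus, Re_RtoC; lra).
  pose proof (Re_pos_not_pole s Hs) as Hsp.
  apply series_asymptotics; [exact Hs |].
  apply Clim_ext with (fun n => a * b / c *
    (poch (a + 1) n * poch (b + 1) n / (poch (c + 1) n * poch s n))).
  { intros n; rewrite Dco_hcoef by exact Hcp; unfold hcoef; rewrite poch_1.
    field; repeat split; try apply fact_neq; now first [exact Hc0 | apply poch_neq_0]. }
  (* The factor a b / c of the derivative is absorbed by 1/Gamma(z) = z/Gamma(z + 1). *)
  apply Clim_val with (a * b / c * (rGamma (a + 1) * rGamma (b + 1) / (rGamma (c + 1) * rGamma s))).
  { rewrite (rGamma_rec a), (rGamma_rec b), (rGamma_rec c).
    field; repeat split; try exact Hc0; now apply rGamma_neq_0. }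
  apply Clim_scal, poch_ratio_lim; auto.
  unfold s; ring.
Qed.

Fixpoint csum (u : nat -> C) (n : nat) : C :=
  match n with O => 0 | S m => csum u m + u m end.

Lemma csum_ext (u v : nat -> C) (n : nat) : (forall k, u k = v k) -> csum u n = csum v n.
Proof. intros H; induction n as [| n IH]; simpl; [reflexivity | now rewrite IH, H]. Qed.

Lemma csum_scal (c : C) (u : nat -> C) (n : nat) : csum (fun k => c * u k) n = c * csum u n.
Proof. induction n as [| n IH]; simpl; [ring | rewrite IH; ring]. Qed.

Lemma csum_minus (u v : nat -> C) (n : nat) :
  csum (fun k => u k - v k) n = csum u n - csum v n.
Proof. induction n as [| n IH]; simpl; [ring | rewrite IH; ring]. Qed.

Lemma csum_Dco_Tco (u : nat -> C) (n : nat) :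
  csum (fun k => Dco u k - Tco u k) n = RtoC (INR n) * u n.
Proof.
  induction n as [| n IH]; simpl csum; [simpl; ring |].
  rewrite IH; unfold Dco, Tco; ring.
Qed.

Lemma binco_1 (n : nat) : binco 1 n = 1%R.
Proof.
  induction n as [| n IH]; simpl; [reflexivity |].
  rewrite IH; pose proof (INR_S_pos n); field; lra.
Qed.

(* Abel's theorem: [CPS u] is [1 - x] times the series of the partial sums of [u]. *)
Lemma abel_limit (u : nat -> C) (S0 : C) :
  radius1 u -> Clim eventually (csum u) S0 -> Clim (at_left 1) (CPS u) S0.
Proof.
  intros Ru HS.
  set (v := fun n => csum u (S n)).
  assert (E1 : forall n, hcoef 1 1 1 n = 1) by (intros n; rewrite hcoef_binco, binco_1; reflexivity).
  assert (Rv : radius1 v).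
  { pose proof (Clim_bounded _ _ (Clim_seq_S _ _ HS)) as [N HN].
    destruct (finite_bound (fun n => Cmod (v n)) (fun _ => 1%R) N) as [Q [HQ HB]].
    { intros _; lra. }
    apply radius1_binco with 1%R (Q + (Cmod S0 + 1))%R; [lra |]; intros n; rewrite binco_1.
    pose proof (Cmod_ge_0 S0).
    destruct (Nat.lt_ge_cases n N) as [Hn | Hn].
    - specialize (HB n Hn); simpl in HB; lra.
    - specialize (HN n Hn); simpl in HN; unfold v; simpl; lra. }
  apply Clim_ext_loc with (fun x => Rcpow (1 - x) 1 * CPS v x).
  - generalize (at_left_between 0 1 Rlt_0_1); apply filter_imp; intros x Hx.
    assert (Hx' : Rabs x < 1) by (rewrite Rabs_pos_eq; lra).
    rewrite Rcpow_1, RtoC_minus by lra.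
    replace ((1 - x) * CPS v x) with (CPS v x - x * CPS v x) by ring.
    rewrite <- CPS_Sco, <- CPS_minus by (auto; now apply radius1_Sco).
    apply CPS_ext; intros [| n]; unfold v; simpl; ring.
  - apply series_asymptotics; [rewrite Re_RtoC; lra |].
    apply Clim_ext with v.
    + intros n; rewrite E1; field; apply RtoC_neq; lra.
    + now apply Clim_seq_S.
Qed.

Lemma Rpower_INR_lim0 (t : R) : 0 < t -> is_lim_seq (fun n => Rpower (INR n) (- t)) 0%R.
Proof.
  intros Ht; unfold Rpower.
  apply (filterlim_comp nat R R (fun n => - t * ln (INR n))%R exp eventually (Rbar_locally m_infty)).
  2: apply is_lim_exp_m.
  apply (is_lim_seq_ext (fun n => (- t) * ln (INR n))%R); [reflexivity |].
  replace m_infty with (Rbar_mult (Finite (- t)) p_infty).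
  2: { simpl; destruct (Rle_dec 0 (- t)); [exfalso; lra | reflexivity]. }
  apply is_lim_seq_scal_l.
  apply (filterlim_comp nat R R INR ln eventually (Rbar_locally p_infty)).
  - apply is_lim_seq_INR.
  - apply is_lim_ln_p.
Qed.

(** By Gauss's quotient at s, [binco s n] is of order n^(s - 1). *)
Lemma binco_lim0 (s : R) : 0 < s < 1 -> is_lim_seq (binco s) 0%R.
Proof.
  intros Hs; apply is_lim_seq_incr_1, is_lim_seq_incr_1.
  pose proof (Clim_bounded _ _ (Clim_seq_S _ _ (gauss_lim (RtoC s)))) as HB.
  set (B := (Cmod (rGamma (RtoC s)) + 1)%R) in HB.
  apply is_lim_seq_le_le_loc with (fun _ => 0%R) (fun n => B * Rpower (INR (S n)) (- (1 - s)))%R.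
  - destruct HB as [N HN]; exists N; intros n Hn; specialize (HN n Hn); simpl in HN.
    split; [left; apply binco_pos; lra |].
    pose proof (pos_INR n) as Hn0.
    assert (E : RtoC (binco s (S (S n))) =
      gauss (RtoC s) (S n) * (Rcpow (INR (S n)) (RtoC s) / RtoC (INR (S (S n))))).
    { rewrite <- hcoef_binco; unfold hcoef, gauss; rewrite poch_1, (fact_S_C (S n)).
      rewrite (RtoC_INR_S (S n)).
      field; repeat split; first [apply RtoC_INR_S_neq | apply fact_neq | apply Rcpow_neq_0]. }
    assert (E2 : binco s (S (S n)) = Cmod (RtoC (binco s (S (S n))))).
    { rewrite Cmod_R, Rabs_pos_eq; [reflexivity | left; apply binco_pos; lra]. }
    rewrite E2, E, Cmod_mult.
    apply Rmult_le_compat; [apply Cmod_ge_0 | apply Cmod_ge_0 | exact HN |].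
    assert (Hpos : 0 < INR (S n)) by (apply lt_0_INR; lia).
    rewrite Rcpow_RtoC, Cmod_div, !Cmod_R, !Rabs_pos_eq.
    + replace (- (1 - s))%R with (s + - (1))%R by ring.
      rewrite Rpower_plus, Rpower_Ropp, Rpower_1 by exact Hpos.
      apply Rmult_le_compat_l; [left; apply exp_pos |].
      apply Rinv_le_contravar; [exact Hpos |]; rewrite (S_INR (S n)); lra.
    + apply pos_INR.
    + left; apply exp_pos.
    + apply RtoC_neq; rewrite S_INR; lra.
  - apply is_lim_seq_const.
  - replace (Finite 0) with (Finite (B * 0))%R by (f_equal; ring).
    apply is_lim_seq_mult'; [apply is_lim_seq_const |].
    apply (is_lim_seq_incr_1 (fun n => Rpower (INR n) (- (1 - s)))%R).
    apply Rpower_INR_lim0; lra.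
Qed.

Section gauss_sum.

Variables a b c : C.
Hypothesis Hc : 0 < Re c.
Hypothesis Hcab : 0 < Re (c - a - b).

(** The coefficients of F' have growth parameter Re (a + b - c) + 1 = 1 - Re (c - a - b) < 1, so
    that n times the n-th coefficient of F tends to 0. *)
Lemma hcoef_decay : exists M d, (0 <= M) /\ (0 < d < 1) /\
  forall n, Cmod (Dco (hcoef a b c) n) <= M * binco (1 - d) n.
Proof.
  pose proof (Re_pos_not_pole c Hc) as Hcp.
  (* The cap 1/2 keeps 1 - d positive, as the comparison with [binco] requires. *)
  set (d := Rmin (1 / 2) (Re (c - a - b))).
  assert (Hd : 0 < d) by (apply Rmin_glb_lt; lra).
  assert (Hd1 : d <= 1 / 2) by apply Rmin_l.
  assert (Hd2 : d <= Re (c - a - b)) by apply Rmin_r.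
  destruct (hcoef_bound (a + 1) (b + 1) (c + 1) (1 - d)) as [M [HM HB]].
  - rewrite Re_plus, Re_RtoC; lra.
  - lra.
  - replace (a + 1 + (b + 1) - (c + 1)) with (RtoC 1 - (c - a - b)) by ring.
    rewrite Re_minus, Re_RtoC; lra.
  - exists (Cmod (a * b / c) * M)%R, d; split; [| split; [lra |]].
    + apply Rmult_le_pos; [apply Cmod_ge_0 | lra].
    + intros n; rewrite Dco_hcoef, Cmod_mult, Rmult_assoc by exact Hcp.
      apply Rmult_le_compat_l; [apply Cmod_ge_0 | apply HB].
Qed.

(* The majorant [binco (1 - d) n / (n + 1)] of [hcoef_decay] telescopes. *)
Lemma hcoef_abs_series : ex_series (fun n => Cmod (hcoef a b c (S n))).
Proof.
  destruct hcoef_decay as [M [d [HM [Hd HB]]]].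
  apply (ex_series_le (V := R_CompleteNormedModule)) with
    (fun n => M / d * (binco (1 - d) n - binco (1 - d) (S n)))%R.
  - intros n; change (Rabs (Cmod (hcoef a b c (S n))) <=
      M / d * (binco (1 - d) n - binco (1 - d) (S n))).
    rewrite Rabs_pos_eq by apply Cmod_ge_0.
    pose proof (INR_S_pos n) as Hn; pose proof (binco_pos (1 - d) n ltac:(lra)).
    simpl binco.
    replace (M / d * (binco (1 - d) n - binco (1 - d) n * ((1 - d + INR n) / (INR n + 1))))%R
      with (M * binco (1 - d) n / (INR n + 1))%R by (field; lra).
    apply Rmult_le_reg_l with (INR n + 1)%R; [exact Hn |].
    replace ((INR n + 1) * (M * binco (1 - d) n / (INR n + 1)))%R
      with (M * binco (1 - d) n)%R by (field; lra).
    apply Rle_trans with (2 := HB n); right.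
    unfold Dco; rewrite Cmod_mult, Cmod_R, Rabs_pos_eq by apply pos_INR.
    now rewrite S_INR.
  - exists (M / d * (1 - 0))%R.
    change (is_lim_seq (sum_n (fun n => M / d * (binco (1 - d) n - binco (1 - d) (S n)))%R)
      (Finite (M / d * (1 - 0)))%R).
    apply is_lim_seq_ext with (fun n => M / d * (1 - binco (1 - d) (S n)))%R.
    + intros n; induction n as [| n IH].
      * rewrite sum_O; simpl; ring.
      * rewrite sum_Sn, <- IH; unfold plus; simpl; ring.
    + apply is_lim_seq_mult'; [apply is_lim_seq_const |].
      apply is_lim_seq_minus'; [apply is_lim_seq_const |].
      apply (is_lim_seq_incr_1 (binco (1 - d))), binco_lim0; lra.
Qed.

Lemma hcoef_csum_cv : exists S0, Clim eventually (csum (hcoef a b c)) S0.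
Proof.
  apply Clim_seq_cauchy with (fun n => Cmod (hcoef a b c n)).
  - intros n; simpl; right; f_equal; ring.
  - apply (ex_series_incr_1 (V := R_NormedModule)), hcoef_abs_series.
Qed.

Lemma Tco_hcoef_lim0 : Clim eventually (fun n => RtoC (INR n) * hcoef a b c n) 0.
Proof.
  apply Clim_seq_incr.
  destruct hcoef_decay as [M [d [HM [Hd HB]]]].
  apply Clim_dominated with (fun n => M * binco (1 - d) n)%R.
  - apply filter_forall; intros n.
    replace (RtoC (INR (S n)) * hcoef a b c (S n) - 0) with (Dco (hcoef a b c) n)
      by (unfold Dco; ring).
    apply HB.
  - change (is_lim_seq (fun n => M * binco (1 - d) n)%R (Finite 0)).
    replace (Finite 0) with (Finite (M * 0))%R by (f_equal; ring).
    apply is_lim_seq_mult'; [apply is_lim_seq_const | apply binco_lim0; lra].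
Qed.

End gauss_sum.

(** The contiguous relation is summed over the coefficients: the part (1 - x) d/dx telescopes to n
    times the n-th coefficient, which tends to 0 since Re (c - a - b) > 0. *)
Lemma gauss_sum_step (a b c S0 S1 : C) :
  0 < Re c -> 0 < Re (c - a - b) ->
  Clim eventually (csum (hcoef a b c)) S0 ->
  Clim eventually (csum (hcoef a b (c + 1))) S1 ->
  S0 = (c - a) * (c - b) / (c * (c - a - b)) * S1.
Proof.
  intros Hc Hcab H0 H1.
  pose proof (Re_pos_not_pole c Hc) as Hcp.
  assert (Hc0 : c <> 0) by (intros E; apply (Hcp O); rewrite E; simpl; ring).
  assert (Hd0 : c - a - b <> 0).
  { intros E; rewrite E, Re_RtoC in Hcab; lra. }
  assert (E : 0 + (c - a - b) * S0 = (c - a) * (c - b) / c * S1).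
  { apply (Clim_unique (Fl := eventually)
      (fun n => (c - a) * (c - b) / c * csum (hcoef a b (c + 1)) n)).
    - apply Clim_ext with
        (fun n => RtoC (INR n) * hcoef a b c n + (c - a - b) * csum (hcoef a b c) n).
      + intros n; rewrite <- (csum_scal ((c - a) * (c - b) / c)).
        rewrite <- (csum_ext _ _ n (fun k => hcoef_contiguous a b c k Hcp)).
        rewrite csum_minus, csum_scal, csum_Dco_Tco; ring.
      + apply Clim_plus; [now apply Tco_hcoef_lim0 | now apply Clim_scal].
    - now apply Clim_scal. }
  transitivity ((0 + (c - a - b) * S0) / (c - a - b)); [field; exact Hd0 |].
  rewrite E; field; auto.
Qed.

Lemma Re_shift (c : C) (n : nat) : Re (c + RtoC (INR n)) = (Re c + INR n)%R.
Proof. now rewrite Re_plus, Re_RtoC. Qed.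

Lemma Cmod_shift_mono (c : C) (N k : nat) :
  0 < Re c -> Cmod (c + RtoC (INR k)) <= Cmod (c + RtoC (INR N) + RtoC (INR k)).
Proof.
  intros Hc; pose proof (pos_INR N); pose proof (pos_INR k).
  apply Rsqr_incr_0_var; [| apply Cmod_ge_0].
  unfold Rsqr.
  assert (E : forall z, (Cmod z * Cmod z = Re z ^ 2 + Im z ^ 2)%R).
  { intros z; rewrite <- Cmod2_alt; ring. }
  rewrite !E; ReIm; nra.
Qed.

(** The first factor of the Pochhammer symbol in the denominator gains |c|/|c + N|, and no later
    factor loses because |c + k| <= |c + N + k|. Only the constant term lacks the gain, hence the
    index [S n]. *)
Lemma hcoef_shift_bound (a b c : C) (N n : nat) :
  0 < Re c ->
  Cmod (hcoef a b (c + RtoC (INR N)) (S n)) <=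
   Cmod c / Cmod (c + RtoC (INR N)) * Cmod (hcoef a b c (S n)).
Proof.
  intros Hc; pose proof (pos_INR N) as HN.
  pose proof (Re_pos_not_pole c Hc) as Hcp.
  assert (HcN : forall k : nat, c + RtoC (INR N) <> - RtoC (INR k)).
  { apply Re_pos_not_pole; rewrite Re_shift; lra. }
  set (cN := c + RtoC (INR N)) in *.
  assert (Hpos : forall k, 0 < Cmod (c + RtoC (INR k))).
  { intros k; apply Cmod_gt_0; now apply shift_neq_0. }
  assert (HposN : forall k, 0 < Cmod (cN + RtoC (INR k))).
  { intros k; apply Cmod_gt_0; now apply shift_neq_0. }
  assert (Hc0 : 0 < Cmod c).
  { specialize (Hpos O); simpl in Hpos; now rewrite Cplus_0_r in Hpos. }
  assert (HcN0 : 0 < Cmod cN).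
  { specialize (HposN O); simpl in HposN; now rewrite Cplus_0_r in HposN. }
  induction n as [| n IH].
  - rewrite !hcoef_S, !hcoef_0 by assumption; unfold hratio; simpl INR.
    replace (RtoC 0 + 1) with (RtoC 1) by ring.
    rewrite !Cplus_0_r, !Cmult_1_r, !Cmod_div.
    + right; field; lra.
    + now apply Cmod_gt_0.
    + now apply Cmod_gt_0.
  - rewrite (hcoef_S a b cN), (hcoef_S a b c (S n)), !Cmod_mult by assumption.
    replace (Cmod c / Cmod cN * (Cmod (hratio a b c (S n)) * Cmod (hcoef a b c (S n))))%R with
      (Cmod (hratio a b c (S n)) * (Cmod c / Cmod cN * Cmod (hcoef a b c (S n))))%R by ring.
    apply Rmult_le_compat; try apply Cmod_ge_0; [| exact IH].
    unfold hratio; rewrite !Cmod_div.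
    + unfold Rdiv; apply Rmult_le_compat_l; [apply Cmod_ge_0 |].
      rewrite !Cmod_mult; apply Rinv_le_contravar.
      * apply Rmult_lt_0_compat; [apply Hpos | apply Cmod_gt_0, RtoC_INR_S_neq].
      * apply Rmult_le_compat_r; [apply Cmod_ge_0 | now apply Cmod_shift_mono].
    + apply Cmult_neq_0; [now apply shift_neq_0 | apply RtoC_INR_S_neq].
    + apply Cmult_neq_0; [now apply shift_neq_0 | apply RtoC_INR_S_neq].
Qed.

Lemma csum_hcoef_S_bound (a b c : C) (B : R) (n : nat) :
  (forall m, sum_n (fun k => Cmod (hcoef a b c (S k))) m <= B) ->
  Cmod (csum (hcoef a b c) (S (S n)) - 1) <= B.
Proof.
  intros HB; apply Rle_trans with (2 := HB n).
  induction n as [| n IH].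
  - rewrite sum_O; simpl csum; rewrite hcoef_0; right; f_equal; ring.
  - rewrite sum_Sn; change (csum (hcoef a b c) (S (S (S n)))) with
      (csum (hcoef a b c) (S (S n)) + hcoef a b c (S (S n))).
    replace (csum (hcoef a b c) (S (S n)) + hcoef a b c (S (S n)) - 1) with
      (csum (hcoef a b c) (S (S n)) - 1 + hcoef a b c (S (S n))) by ring.
    apply Rle_trans with (1 := Cmod_triangle _ _).
    unfold plus; simpl; apply Rplus_le_compat_r; exact IH.
Qed.

(** As N grows only the constant term 1 survives: the rest is at most |c|/|c + N| times a fixed
    convergent sum. *)
Lemma gauss_sum_shift_lim (a b c : C) (Sn : nat -> C) :
  0 < Re c -> 0 < Re (c - a - b) ->
  (forall N, Clim eventually (csum (hcoef a b (c + RtoC (INR N)))) (Sn N)) ->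
  Clim eventually Sn 1.
Proof.
  intros Hc Hcab HS.
  set (B := Series (fun n => Cmod (hcoef a b c (S n)))).
  pose proof (hcoef_abs_series a b c Hc Hcab) as Hser.
  assert (HB : forall m, sum_n (fun k => Cmod (hcoef a b c (S k))) m <= B).
  { intros m; apply is_lim_seq_incr_compare.
    - exact (Series_correct _ Hser).
    - intros n; rewrite sum_Sn; unfold plus; simpl.
      pose proof (Cmod_ge_0 (hcoef a b c (S (S n)))); lra. }
  assert (HB0 : 0 <= B).
  { apply Rle_trans with (2 := HB O); rewrite sum_O; apply Cmod_ge_0. }
  apply Clim_seq_incr.
  apply Clim_dominated with (fun N => Cmod c * B * / INR (S N))%R.
  - apply filter_forall; intros N.
    assert (HN : 0 < INR (S N)) by (apply lt_0_INR; lia).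
    assert (H1 : INR (S N) <= Cmod (c + RtoC (INR (S N)))).
    { apply Rle_trans with (Re (c + RtoC (INR (S N)))); [rewrite Re_shift; lra |].
      apply Rle_trans with (2 := re_le_Cmod _), Rle_abs. }
    apply Clim_seq_subst_le with (fun n => csum (hcoef a b (c + RtoC (INR (S N)))) n - 1) 2%nat.
    + intros [| [| n]] Hn; try lia.
      apply csum_hcoef_S_bound; intros m.
      apply Rle_trans with (sum_n (fun k => Cmod c / Cmod (c + RtoC (INR (S N))) * Cmod (hcoef a b c (S k)))%R m).
      * apply sum_n_m_le; intros k; now apply hcoef_shift_bound.
      * rewrite (sum_n_mult_l (K := R_Ring)); unfold mult; simpl mult.
        change (Cmod c / Cmod (c + RtoC (INR (S N))) * sum_n (fun k => Cmod (hcoef a b c (S k))) m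
          <= Cmod c * B * / INR (S N)).
        replace (Cmod c * B * / INR (S N))%R with (Cmod c / INR (S N) * B)%R by (unfold Rdiv; ring).
        apply Rmult_le_compat; [| | | apply HB].
        -- apply Rmult_le_pos; [apply Cmod_ge_0 | left; apply Rinv_0_lt_compat; lra].
        -- apply Rle_trans with (sum_n (fun _ => 0%R) m).
           ++ rewrite sum_n_const; lra.
           ++ apply sum_n_m_le; intros k; apply Cmod_ge_0.
        -- apply Rmult_le_compat_l; [apply Cmod_ge_0 |].
           apply Rinv_le_contravar; lra.
    + apply Clim_minus; [apply HS | apply Clim_const].
  - change (is_lim_seq (fun N => Cmod c * B * / INR (S N))%R (Finite 0)).
    replace (Finite 0) with (Finite (Cmod c * B * 0))%R by (f_equal; ring).
    apply is_lim_seq_mult'; [apply is_lim_seq_const | apply is_lim_seq_inv_S].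
Qed.

(** [gauss_sum_step] is iterated N times. The accumulated Pochhammer quotient is balanced and tends
    to the quotient of 1/Gamma values, while the sum at c + N tends to 1. *)
Lemma gauss_sum (a b c : C) :
  0 < Re c -> 0 < Re (c - a - b) ->
  Clim eventually (csum (hcoef a b c))
    (rGamma (c - a) * rGamma (c - b) / (rGamma c * rGamma (c - a - b))).
Proof.
  intros Hc Hcab.
  set (Sn := fun N : nat => CLim_seq (csum (hcoef a b (c + RtoC (INR N))))).
  assert (HSn : forall N, Clim eventually (csum (hcoef a b (c + RtoC (INR N)))) (Sn N)).
  { intros N; pose proof (pos_INR N).
    destruct (hcoef_csum_cv a b (c + RtoC (INR N))) as [S0 HS0].
    - rewrite Re_shift; lra.
    - replace (c + RtoC (INR N) - a - b) with (c - a - b + RtoC (INR N)) by ring.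
      rewrite Re_shift; lra.
    - unfold Sn; rewrite (CLim_seq_correct _ _ HS0); exact HS0. }
  pose proof (Re_pos_not_pole c Hc) as Hcp.
  pose proof (Re_pos_not_pole _ Hcab) as Hdp.
  assert (E : forall N, Sn O =
    poch (c - a) N * poch (c - b) N / (poch c N * poch (c - a - b) N) * Sn N).
  { intros N; induction N as [| N IH].
    - simpl; field; apply RtoC_neq; lra.
    - rewrite IH; simpl poch; pose proof (pos_INR N).
      rewrite (gauss_sum_step a b (c + RtoC (INR N)) (Sn N) (Sn (S N))).
      + field; repeat split; first [now apply poch_neq_0 | now apply shift_neq_0 |
          replace (c + RtoC (INR N) - a - b) with (c - a - b + RtoC (INR N)) by ring;
          now apply shift_neq_0].
      + rewrite Re_shift; lra.
      + replace (c + RtoC (INR N) - a - b) with (c - a - b + RtoC (INR N)) by ring.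
        rewrite Re_shift; lra.
      + apply HSn.
      + replace (c + RtoC (INR N) + 1) with (c + RtoC (INR (S N))) by (rewrite RtoC_INR_S; ring).
        apply HSn. }
  assert (HE : Sn O = rGamma (c - a) * rGamma (c - b) / (rGamma c * rGamma (c - a - b)) * 1).
  { apply (Clim_unique (Fl := eventually) (fun _ => Sn O)); [apply Clim_const |].
    apply Clim_ext with (1 := fun N => eq_sym (E N)).
    apply Clim_mult; [apply poch_ratio_lim; auto; ring |].
    now apply gauss_sum_shift_lim with (3 := HSn). }
  rewrite Cmult_1_r in HE; rewrite <- HE.
  apply Clim_ext with (2 := HSn O); intros n; simpl INR.
  now rewrite Cplus_0_r.
Qed.

Lemma hyper_lim_1 (a b c : C) :
  0 < Re c -> 0 < Re (c - a - b) ->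
  Clim (at_left 1) (CPS (hcoef a b c))
    (rGamma (c - a) * rGamma (c - b) / (rGamma c * rGamma (c - a - b))).
Proof.
  intros Hc Hcab; apply abel_limit; [now apply radius1_hcoef | now apply gauss_sum].
Qed.

(** The contiguous relation turns this into the value at 1 of F[a,b;c+1;.], where Gauss's theorem
    applies because Re (c + 1 - a - b) = 1 - Re (a + b - c) > 0. *)
Lemma hyper_contiguous_lim (a b c : C) :
  0 < Re c -> Re (a + b - c) < 1 ->
  Clim (at_left 1)
    (fun x => RtoC (1 - x) * CPS (Dco (hcoef a b c)) x - (a + b - c) * CPS (hcoef a b c) x)
    (rGamma (c - a) * rGamma (c - b) / (rGamma c * rGamma (1 - (a + b - c)))).
Proof.
  intros Hc Hal.
  apply Clim_ext_loc with (fun x => (c - a) * (c - b) / c * CPS (hcoef a b (c + 1)) x).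
  { generalize (at_left_between 0 1 Rlt_0_1); apply filter_imp; intros x Hx.
    symmetry; apply hyper_contiguous; [exact Hc |].
    rewrite Rabs_pos_eq; lra. }
  pose proof (Re_pos_not_pole c Hc) as Hcp.
  assert (Hc0 : c <> 0) by (intros E; apply (Hcp O); rewrite E; simpl; ring).
  assert (Hc1 : 0 < Re (c + 1)) by (rewrite Re_plus, Re_RtoC; lra).
  assert (Hd : 0 < Re (c + 1 - a - b)).
  { replace (c + 1 - a - b) with (1 - (a + b - c)) by ring.
    rewrite Re_minus, Re_RtoC; lra. }
  eapply Clim_val; [| apply Clim_scal, hyper_lim_1; assumption].
  replace (1 - (a + b - c)) with (c + 1 - a - b) by ring.
  rewrite (rGamma_rec (c - a)), (rGamma_rec (c - b)), (rGamma_rec c).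
  replace (c - a + 1) with (c + 1 - a) by ring.
  replace (c - b + 1) with (c + 1 - b) by ring.
  field; repeat split; auto; now apply rGamma_neq_0, Re_pos_not_pole.
Qed.

(** * The reflection formula *)

Section reflection.

Variable z : C.

Let h := hcoef z (- z) (RtoC (/ 2)).
(* [Y'' = - 4 z^2 Y] by the hypergeometric equation, with [Y' = P]. *)
Let Y (t : R) : C := CPS h (sin t ^ 2).
Let P (t : R) : C := RtoC (2 * sin t * cos t) * CPS (Dco h) (sin t ^ 2).

Lemma sin2_lt_1 (t : R) : 0 <= t < PI / 2 -> Rabs (sin t ^ 2) < 1.
Proof.
  intros Ht; rewrite Rabs_pos_eq by apply pow2_ge_0.
  pose proof (sin2_cos2 t) as H; unfold Rsqr in H.
  assert (Hc : 0 < cos t) by (apply cos_gt_0; lra). nra.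
Qed.

Lemma is_derive_sin2 (t : R) : is_derive (fun t => sin t ^ 2)%R t (2 * sin t * cos t)%R.
Proof. auto_derive; [exact I | ring]. Qed.

Lemma half_Re_pos : 0 < Re (RtoC (/ 2)).
Proof. rewrite Re_RtoC; lra. Qed.

Lemma Cder_Y (t : R) : 0 <= t < PI / 2 -> Cder Y t (P t).
Proof.
  intros Ht; unfold Y, P.
  apply (Cder_comp (CPS h)); [| apply is_derive_sin2].
  apply Cder_CPS; [apply radius1_hcoef, half_Re_pos | now apply sin2_lt_1].
Qed.

Lemma Cder_P (t : R) : 0 <= t < PI / 2 -> Cder P t (- (4 * z * z) * Y t).
Proof.
  intros Ht; unfold P.
  pose proof (sin2_lt_1 t Ht) as Hx.
  eapply Cder_val; [| apply Cder_mult].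
  2: { apply Cder_RtoC; instantiate (1 := (2 * (cos t * cos t - sin t * sin t))%R).
       auto_derive; [exact I | ring]. }
  2: { apply (Cder_comp (CPS (Dco h))); [| apply is_derive_sin2].
       apply Cder_CPS; [apply radius1_Dco, radius1_hcoef, half_Re_pos | exact Hx]. }
  pose proof (hyper_ode z (- z) (RtoC (/ 2)) (sin t ^ 2) half_Re_pos Hx) as E.
  fold h in E; fold (Y t) in E.
  replace (- (4 * z * z) * Y t) with (4 * (z * - z * Y t)) by ring.
  rewrite <- E.
  replace (z + - z + 1) with (RtoC 1) by ring.
  pose proof (sin2_cos2 t) as H; unfold Rsqr in H.
  replace (1 - sin t ^ 2)%R with (cos t * cos t)%R by (simpl; lra).
  assert (E2 : RtoC (/ 2) - 1 * RtoC (sin t ^ 2) = RtoC ((cos t * cos t - sin t * sin t) / 2)).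
  { rewrite Cmult_1_l, <- RtoC_minus; f_equal.
    replace (sin t ^ 2)%R with (sin t * sin t)%R by ring; lra. }
  rewrite E2.
  replace ((cos t * cos t - sin t * sin t) / 2)%R
    with (/ 2 * (cos t * cos t - sin t * sin t))%R by field.
  rewrite !RtoC_mult, RtoC_pow, RtoC_inv by lra; simpl Cpow.
  field; apply RtoC_neq; lra.
Qed.

(** Y'' = w^2 Y factors as (d/dt - w)(d/dt + w) Y = 0, so P + w Y solves the first-order equation u'
    = w u with u(0) = w. *)
Lemma sin2_wave_factor (w : C) (t : R) :
  w * w = - (4 * z * z) -> 0 <= t < PI / 2 -> P t + w * Y t = w * Cexp (w * t).
Proof.
  intros Hw Ht.
  assert (E : (P 0 + w * Y 0) * Cexp (- w * 0%R) = (P t + w * Y t) * Cexp (- w * t)).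
  { apply (Cder_0_eq (fun u => (P u + w * Y u) * Cexp (- w * u))); [lra |].
    intros u Hu; assert (Hu' : 0 <= u < PI / 2) by lra.
    eapply Cder_val; [| apply Cder_mult;
      [apply Cder_plus; [now apply Cder_P | apply Cder_scal; now apply Cder_Y] | apply Cder_Cexp]].
    rewrite <- Hw; ring. }
  assert (E0 : P 0 = 0).
  { unfold P; rewrite sin_0; replace (2 * 0 * cos 0)%R with 0%R by ring; ring. }
  assert (E1 : Y 0 = 1).
  { unfold Y; rewrite sin_0; replace (0 ^ 2)%R with 0%R by ring; rewrite CPS_0; apply hcoef_0. }
  rewrite E0, E1 in E; replace (- w * 0%R) with (RtoC 0) in E by ring; rewrite Cexp_0 in E.
  replace (- w * t) with (- (w * t)) in E by ring; rewrite Cexp_opp in E.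
  transitivity ((P t + w * Y t) * / Cexp (w * t) * Cexp (w * t)).
  - field; apply Cexp_neq_0.
  - rewrite <- E; ring.
Qed.

(** The first-order relations for w and -w are subtracted; recovering Y divides by w = 2 i z, whence
    z <> 0. *)
Lemma hyper_sin2 (t : R) :
  z <> 0 -> 0 <= t < PI / 2 ->
  Y t = (Cexp (2 * Ci * z * t) + Cexp (- (2 * Ci * z * t))) / 2.
Proof.
  intros Hz Ht.
  assert (Ci2 : Ci * Ci = - (1)) by (apply C_ext; simpl; ring).
  set (w := 2 * Ci * z).
  assert (Hw : w * w = - (4 * z * z)).
  { unfold w; replace (2 * Ci * z * (2 * Ci * z)) with (4 * z * z * (Ci * Ci)) by ring.
    rewrite Ci2; ring. }
  pose proof (sin2_wave_factor w t Hw Ht) as E1.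
  assert (Hw' : - w * - w = - (4 * z * z)) by (rewrite <- Hw; ring).
  pose proof (sin2_wave_factor (- w) t Hw' Ht) as E2.
  assert (H2 : RtoC 2 <> 0) by (apply RtoC_neq; lra).
  assert (Hw0 : w <> 0).
  { unfold w; repeat apply Cmult_neq_0; auto.
    intros E; injection E; lra. }
  replace (- (w * t)) with (- w * t) by ring.
  transitivity (((P t + w * Y t) - (P t + - w * Y t)) / (2 * w)).
  - field; auto.
  - rewrite E1, E2; field; auto.
Qed.

Lemma sin2_at_left : filterlim (fun t => sin t ^ 2)%R (at_left (PI / 2)) (at_left 1).
Proof.
  pose proof PI2_1 as Hpi.
  intros Q [eps HQ]; unfold filtermap.
  assert (Hc : filterlim (fun t => sin t ^ 2)%R (at_left (PI / 2)) (locally (sin (PI / 2) ^ 2)%R)).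
  { apply filterlim_filter_le_1 with (1 := filter_le_within _).
    apply (ex_derive_continuous (fun t => sin t ^ 2)%R); eexists; apply is_derive_sin2. }
  rewrite sin_PI2 in Hc; replace (1 ^ 2)%R with 1%R in Hc by ring.
  generalize (filter_and _ _ (filterlim_R_eps _ _ _ (cond_pos eps) Hc)
    (at_left_between 0 (PI / 2) ltac:(lra))); apply filter_imp; intros t [Ht1 Ht2].
  apply HQ; [exact Ht1 |].
  apply Rle_lt_trans with (1 := Rle_abs _), sin2_lt_1; lra.
Qed.

(** The limit t -> pi/2 is computed twice, from the closed form and from Gauss's theorem, where c -
    a - b = 1/2. *)
Lemma rGamma_half_cos :
  rGamma (RtoC (/ 2) - z) * rGamma (RtoC (/ 2) + z) =
  rGamma (RtoC (/ 2)) * rGamma (RtoC (/ 2)) *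
    ((Cexp (Ci * z * PI) + Cexp (- (Ci * z * PI))) / 2).
Proof.
  assert (H2 : RtoC 2 <> 0) by (apply RtoC_neq; lra).
  assert (HG : rGamma (RtoC (/ 2)) <> 0) by apply rGamma_neq_0, Re_pos_not_pole, half_Re_pos.
  (* [hyper_sin2] excludes z = 0, where both sides are 1/Gamma(1/2)^2. *)
  destruct (Ceq_dec z 0) as [E | Hz].
  { rewrite E, !Cmult_0_r, !Cmult_0_l, Cexp_opp, Cexp_0.
    unfold Cminus; rewrite Copp_0, !Cplus_0_r; field; apply RtoC_neq; lra. }
  assert (Hlim : rGamma (RtoC (/ 2) - z) * rGamma (RtoC (/ 2) - - z) /
      (rGamma (RtoC (/ 2)) * rGamma (RtoC (/ 2) - z - - z)) =
      (Cexp (2 * Ci * z * RtoC (PI / 2)) + Cexp (- (2 * Ci * z * RtoC (PI / 2)))) / 2).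
  { apply (Clim_unique (Fl := at_left (PI / 2)) Y).
    - apply (Clim_comp _ (at_left 1) (fun t => sin t ^ 2)%R (CPS h)); [apply sin2_at_left |].
      apply hyper_lim_1; [apply half_Re_pos |].
      replace (RtoC (/ 2) - z - - z) with (RtoC (/ 2)) by ring; apply half_Re_pos.
    - apply Clim_ext_loc with
        (fun t => (Cexp (2 * Ci * z * RtoC t) + Cexp (- (2 * Ci * z * RtoC t))) / 2).
      + generalize (at_left_between 0 (PI / 2) ltac:(pose proof PI2_1; lra)).
        apply filter_imp; intros t Ht; symmetry; apply hyper_sin2; [exact Hz | lra].
      + apply Clim_div; [exact H2 | | apply Clim_const].
        apply Clim_plus; apply Clim_Cexp; [| apply Clim_opp]; apply Clim_scal, Clim_RtoC. }
  replace (RtoC (/ 2) - z - - z) with (RtoC (/ 2)) in Hlim by ring.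
  replace (RtoC (/ 2) - - z) with (RtoC (/ 2) + z) in Hlim by ring.
  replace (2 * Ci * z * RtoC (PI / 2)) with (Ci * z * PI) in Hlim.
  2: { unfold Rdiv; rewrite RtoC_mult, RtoC_inv by lra; field; exact H2. }
  rewrite <- Hlim; field; auto.
Qed.

End reflection.

Lemma Cexp_Ci (x : R) : Cexp (Ci * RtoC x) = RtoC (cos x) + Ci * RtoC (sin x).
Proof.
  apply C_ext; rewrite ?Re_Cexp, ?Im_Cexp; ReIm; simpl Re; simpl Im;
    replace (0 * x - 1 * 0)%R with 0%R by ring; replace (0 * 0 + 1 * x)%R with x by ring;
    rewrite exp_0; ring.
Qed.

Lemma Cexp_Ci_PI2 : Cexp (Ci * RtoC (PI / 2)) = Ci.
Proof. rewrite Cexp_Ci, cos_PI2, sin_PI2; ring. Qed.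

Lemma Csin_RtoC (x : R) : Csin (RtoC x) = RtoC (sin x).
Proof.
  unfold Csin.
  replace (- (Ci * RtoC x)) with (Ci * RtoC (- x)) by (rewrite RtoC_opp; ring).
  rewrite !Cexp_Ci, cos_neg, sin_neg, RtoC_opp; field.
  intros H; injection H; lra.
Qed.

(** The substitution of z + 1/2 turns the cosine into a sine. The constant 1/Gamma(1/2)^2 is still
    unknown at this stage. *)
Lemma rGamma_reflection_K (z : C) :
  rGamma (1 + z) * rGamma (- z) =
  - (rGamma (RtoC (/ 2)) * rGamma (RtoC (/ 2))) * Csin (z * PI).
Proof.
  pose proof (rGamma_half_cos (z + RtoC (/ 2))) as H.
  replace (RtoC (/ 2) - (z + RtoC (/ 2))) with (- z) in H by ring.
  replace (RtoC (/ 2) + (z + RtoC (/ 2))) with (1 + z) in H.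
  2: { assert (E : RtoC (/ 2) + RtoC (/ 2) = 1) by (rewrite <- RtoC_plus; f_equal; lra).
       rewrite <- E; ring. }
  rewrite Cmult_comm, H.
  replace (Ci * (z + RtoC (/ 2)) * PI) with (Ci * (z * PI) + Ci * RtoC (PI / 2)).
  2: { unfold Rdiv; rewrite RtoC_mult; ring. }
  rewrite !Cexp_opp, Cexp_plus, Cexp_Ci_PI2.
  unfold Csin; rewrite Cexp_opp.
  assert (Hi : Ci <> 0) by (intros E; injection E; lra).
  assert (H2 : RtoC 2 <> 0) by (apply RtoC_neq; lra).
  assert (Ci2 : Ci * Ci = - (1)) by (apply C_ext; simpl; ring).
  pose proof (Cexp_neq_0 (Ci * (z * PI))) as HE.
  set (X := Cexp (Ci * (z * PI))) in *.
  set (G := rGamma (RtoC (/ 2)) * rGamma (RtoC (/ 2))).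
  transitivity (G * ((X * (Ci * Ci) + / X) / (2 * Ci))).
  - field; auto.
  - rewrite Ci2; field; auto.
Qed.

(** The preceding formula is compared near z = 0: for x = 1/(n + 1), the product of 1/Gamma(1 + x)
    and 1/Gamma(1 - x) tends to 1 and equals K sin(pi x)/x. *)
Lemma rGamma_half_sqr : rGamma (RtoC (/ 2)) * rGamma (RtoC (/ 2)) = / RtoC PI.
Proof.
  pose proof PI_RGT_0 as Hpi.
  set (K := rGamma (RtoC (/ 2)) * rGamma (RtoC (/ 2))).
  assert (E : 1 * 1 = K * RtoC PI).
  { set (x := fun n : nat => (/ (INR n + 1))%R).
    assert (Hx : forall n, 0 < x n) by (intros n; apply Rinv_0_lt_compat, INR_S_pos).
    assert (Hx0 : Clim eventually (fun n => RtoC (x n)) 0).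
    { apply Clim_ext with (2 := Clim_INR_shift 1); intros n.
      unfold x; rewrite RtoC_inv, RtoC_plus by (pose proof (INR_S_pos n); lra).
      unfold Cdiv; ring. }
    apply (Clim_unique (Fl := eventually)
      (fun n => rGamma (1 + RtoC (x n)) * rGamma (1 - RtoC (x n)))).
    - apply Clim_mult.
      + apply Clim_val with (rGamma 1); [apply rGamma_1 | apply Clim_rGamma].
        apply Clim_val with (1 + 0); [ring | apply Clim_plus; [apply Clim_const | exact Hx0]].
      + apply Clim_val with (rGamma 1); [apply rGamma_1 | apply Clim_rGamma].
        apply Clim_val with (1 - 0); [ring | apply Clim_minus; [apply Clim_const | exact Hx0]].
    - apply Clim_ext with (fun n => K * RtoC (sin (x n * PI) / x n)).
      + intros n; pose proof (rGamma_reflection_K (RtoC (x n))) as H; fold K in H.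
        rewrite <- RtoC_mult, Csin_RtoC, (rGamma_rec (- RtoC (x n))) in H.
        replace (- RtoC (x n) + 1) with (1 - RtoC (x n)) in H by ring.
        assert (Hn : RtoC (x n) <> 0) by (apply RtoC_neq; pose proof (Hx n); lra).
        rewrite RtoC_div by (pose proof (Hx n); lra).
        transitivity (- (- K * RtoC (sin (x n * PI))) / RtoC (x n)); [field; exact Hn |].
        rewrite <- H; field; exact Hn.
      + apply Clim_scal.
        apply Clim_dominated with (fun n => PI ^ 2 * x n)%R.
        * apply filter_forall; intros n; pose proof (Hx n) as H.
          rewrite <- RtoC_minus, Cmod_R.
          replace (sin (x n * PI) / x n - PI)%R with ((sin (x n * PI) - x n * PI) / x n)%R
            by (field; lra).
          unfold Rdiv; rewrite Rabs_mult, (Rabs_pos_eq (/ x n))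
            by (left; now apply Rinv_0_lt_compat).
          apply Rmult_le_reg_r with (x n); [exact H |].
          rewrite Rmult_assoc, Rinv_l, Rmult_1_r by lra.
          apply Rle_trans with (1 := sin_minus_bound _); right; ring.
        * change (is_lim_seq (fun n => PI ^ 2 * x n)%R (Finite 0)).
          replace (Finite 0) with (Finite (PI ^ 2 * 0))%R by (f_equal; ring).
          apply is_lim_seq_mult'; [apply is_lim_seq_const |].
          exact (Clim_Re _ _ Hx0). }
  assert (Hpi0 : RtoC PI <> 0) by (apply RtoC_neq; lra).
  transitivity (K * RtoC PI * / RtoC PI); [field; exact Hpi0 |].
  rewrite <- E; ring.
Qed.

Lemma rGamma_reflection (z : C) :
  rGamma (1 + z) * rGamma (- z) = - Csin (z * PI) / RtoC PI.
Proof. rewrite rGamma_reflection_K, rGamma_half_sqr; unfold Cdiv; ring. Qed.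

(** * The bilinear concomitant of two Gauss series *)

(** The eps form of [is_RInt_gen], with closeness measured by [Cmod]: estimates are carried out in
    this form and transferred by [CRInt_gen_is_RInt_gen] at the end. *)
Definition CRInt_gen (f : R -> C) (Fa Fb : (R -> Prop) -> Prop) (l : C) : Prop :=
  forall eps : R, 0 < eps ->
  filter_prod Fa Fb (fun ab => exists y : C,
    is_RInt (V := C_R_NormedModule) f (fst ab) (snd ab) y /\ (Cmod (y - l) < eps)).

Lemma CRInt_gen_is_RInt_gen (f : R -> C) (Fa Fb : (R -> Prop) -> Prop)
  {HFa : Filter Fa} {HFb : Filter Fb} (l : C) :
  CRInt_gen f Fa Fb l -> is_RInt_gen (V := C_R_NormedModule) f Fa Fb l.
Proof.
  intros H P [eps HP]; unfold filtermapi.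
  generalize (H eps (cond_pos eps)); apply filter_imp; intros ab [y [H1 H2]].
  exists y; split; [exact H1 |].
  apply HP, C_NormedModule_mixin_compat1; exact H2.
Qed.

Lemma is_RInt_C_iff (f : R -> C) (a b : R) (y : C) :
  is_RInt (V := C_R_NormedModule) f a b y <->
  is_RInt (fun x => Re (f x)) a b (Re y) /\ is_RInt (fun x => Im (f x)) a b (Im y).
Proof.
  split.
  - intros H; split.
    + exact (is_RInt_fct_extend_fst (U := R_NormedModule) (V := R_NormedModule) f a b y H).
    + exact (is_RInt_fct_extend_snd (U := R_NormedModule) (V := R_NormedModule) f a b y H).
  - intros [H1 H2]; rewrite <- (C_eta y).
    exact (is_RInt_fct_extend_pair (U := R_NormedModule) (V := R_NormedModule) f a b _ _ H1 H2).
Qed.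

Lemma is_RInt_C_scal (c : C) (f : R -> C) (a b : R) (y : C) :
  is_RInt (V := C_R_NormedModule) f a b y ->
  is_RInt (V := C_R_NormedModule) (fun x => c * f x) a b (c * y).
Proof.
  intros H; apply is_RInt_C_iff in H; destruct H as [H1 H2]; apply is_RInt_C_iff; split.
  - exact (is_RInt_minus _ _ _ _ _ _ (is_RInt_scal _ _ _ (Re c) _ H1)
             (is_RInt_scal _ _ _ (Im c) _ H2)).
  - exact (is_RInt_plus _ _ _ _ _ _ (is_RInt_scal _ _ _ (Re c) _ H2)
             (is_RInt_scal _ _ _ (Im c) _ H1)).
Qed.

Section CRInt_gen_theory.

Context (Fa Fb : (R -> Prop) -> Prop) {HFa : Filter Fa} {HFb : Filter Fb}.

Lemma CRInt_gen_scal (c : C) (f : R -> C) (l : C) :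
  CRInt_gen f Fa Fb l -> CRInt_gen (fun x => c * f x) Fa Fb (c * l).
Proof.
  intros H eps He.
  assert (Hc : 0 < Cmod c + 1) by (pose proof (Cmod_ge_0 c); lra).
  assert (He' : 0 < eps / (Cmod c + 1)) by (now apply Rdiv_lt_0_compat).
  generalize (H _ He'); apply filter_imp; intros ab [y [H1 H2]].
  exists (c * y); split; [now apply is_RInt_C_scal |].
  replace (c * y - c * l) with (c * (y - l)) by ring; rewrite Cmod_mult.
  apply Rle_lt_trans with ((Cmod c + 1) * Cmod (y - l))%R.
  - apply Rmult_le_compat_r; [apply Cmod_ge_0 | lra].
  - apply Rlt_le_trans with ((Cmod c + 1) * (eps / (Cmod c + 1)))%R.
    + now apply Rmult_lt_compat_l.
    + right; field; lra.
Qed.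

Lemma CRInt_gen_val (f : R -> C) (l m : C) :
  l = m -> CRInt_gen f Fa Fb l -> CRInt_gen f Fa Fb m.
Proof. now intros ->. Qed.

End CRInt_gen_theory.

Lemma filter_prod_01 :
  filter_prod (at_right 0) (at_left 1)
    (fun ab : R * R => (0 < fst ab) /\ (fst ab <= snd ab) /\ (snd ab < 1)).
Proof.
  exists (fun x => 0 < x < 1 / 2) (fun x => 1 / 2 < x < 1).
  - apply at_right_between; lra.
  - apply at_left_between; lra.
  - intros x y Hx Hy; simpl; lra.
Qed.

Lemma CRInt_gen_ext_01 (f g : R -> C) (l : C) :
  (forall x, 0 < x < 1 -> f x = g x) ->
  CRInt_gen f (at_right 0) (at_left 1) l -> CRInt_gen g (at_right 0) (at_left 1) l.
Proof.
  intros Hfg Hf eps He.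
  generalize (filter_and _ _ filter_prod_01 (Hf eps He)); apply filter_imp.
  intros [a b] [[H1 [H2 H3]] [y [Hy1 Hy2]]]; simpl in *.
  exists y; split; [| exact Hy2].
  apply (is_RInt_ext (V := C_R_NormedModule)) with (2 := Hy1); intros x Hx.
  rewrite Rmin_left, Rmax_right in Hx by exact H2; apply Hfg; lra.
Qed.

(** The fundamental theorem of calculus in each component; differentiability of [df] supplies the
    continuity of the integrand. *)
Lemma is_RInt_Cder (f df : R -> C) (a b : R) :
  a <= b -> (forall x, a <= x <= b -> Cder f x (df x)) ->
  (forall x, a <= x <= b -> exists l, Cder df x l) ->
  is_RInt (V := C_R_NormedModule) df a b (f b - f a).
Proof.
  intros Hab Hf Hdf.
  assert (E : forall x, Rmin a b <= x <= Rmax a b -> a <= x <= b).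
  { intros x; rewrite Rmin_left, Rmax_right; auto. }
  apply is_RInt_C_iff; split.
  - apply (is_RInt_derive (V := R_CompleteNormedModule) (fun t => Re (f t)) (fun t => Re (df t))).
    + intros x Hx; apply (Hf x (E x Hx)).
    + intros x Hx; destruct (Hdf x (E x Hx)) as [l [Hl _]].
      apply (ex_derive_continuous (fun t => Re (df t))); now exists (Re l).
  - apply (is_RInt_derive (V := R_CompleteNormedModule) (fun t => Im (f t)) (fun t => Im (df t))).
    + intros x Hx; apply (Hf x (E x Hx)).
    + intros x Hx; destruct (Hdf x (E x Hx)) as [l [_ Hl]].
      apply (ex_derive_continuous (fun t => Im (df t))); now exists (Im l).
Qed.

Lemma CRInt_gen_antiderivative (G g : R -> C) (A B : C) :
  (forall x, 0 < x < 1 -> Cder G x (g x)) ->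
  (forall x, 0 < x < 1 -> exists l, Cder g x l) ->
  Clim (at_right 0) G A -> Clim (at_left 1) G B ->
  CRInt_gen g (at_right 0) (at_left 1) (B - A).
Proof.
  intros HG Hg HA HB eps He.
  assert (He2 : 0 < eps / 2) by lra.
  assert (HP : filter_prod (at_right 0) (at_left 1) (fun ab : R * R =>
    (Cmod (G (fst ab) - A) < eps / 2) /\ (Cmod (G (snd ab) - B) < eps / 2))).
  { exists (fun a => Cmod (G a - A) < eps / 2) (fun b => Cmod (G b - B) < eps / 2).
    - now apply HA.
    - now apply HB.
    - intros x y H1 H2; now split. }
  generalize (filter_and _ _ filter_prod_01 HP); apply filter_imp.
  intros [a b] [[H1 [H2 H3]] [H4 H5]]; simpl in *.
  exists (G b - G a); split.
  - apply is_RInt_Cder; [exact H2 | |]; intros x Hx; [apply HG | apply Hg]; lra.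
  - replace (G b - G a - (B - A)) with ((G b - B) - (G a - A)) by ring.
    pose proof (Cmod_minus_le (G b - B) (G a - A)); lra.
Qed.

Lemma Cder_Clim (f : R -> C) (x : R) (l : C) : Cder f x l -> Clim (locally x) f (f x).
Proof.
  intros [H1 H2]; apply Clim_of_ReIm.
  - exact (ex_derive_continuous (fun t => Re (f t)) x (ex_intro _ _ H1)).
  - exact (ex_derive_continuous (fun t => Im (f t)) x (ex_intro _ _ H2)).
Qed.

Lemma Clim_within (D : R -> Prop) (f : R -> C) (x : R) (l : C) :
  Clim (locally x) f l -> Clim (within D (locally x)) f l.
Proof. intros H eps He; apply filter_le_within, (H eps He). Qed.

Lemma Cder_Clim_right (f : R -> C) (x : R) (l : C) : Cder f x l -> Clim (at_right x) f (f x).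
Proof. intros H; apply Clim_within, (Cder_Clim _ _ _ H). Qed.

Lemma Cder_Clim_left (f : R -> C) (x : R) (l : C) : Cder f x l -> Clim (at_left x) f (f x).
Proof. intros H; apply Clim_within, (Cder_Clim _ _ _ H). Qed.

Lemma Rcpow_lim0 (z : C) : 0 < Re z -> Clim (at_right 0) (fun x => Rcpow x z) 0.
Proof.
  intros Hz; apply Clim_dominated with (fun x => Rpower x (Re z)); [| now apply Rpower_lim0].
  apply filter_forall; intros x.
  replace (Rcpow x z - 0) with (Rcpow x z) by ring; rewrite Cmod_Rcpow_Rpower; lra.
Qed.

Lemma Rcpow_1m_lim0 (z : C) : 0 < Re z -> Clim (at_left 1) (fun x => Rcpow (1 - x) z) 0.
Proof.
  intros Hz; apply Clim_dominated with (fun x => Rpower (1 - x) (Re z)); [| now apply Rpower_1m_lim0].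
  apply filter_forall; intros x.
  replace (Rcpow (1 - x) z - 0) with (Rcpow (1 - x) z) by ring; rewrite Cmod_Rcpow_Rpower; lra.
Qed.

Section wronskian.

(* The lower parameters are [mu + dl] and [mu - dl]; [dl / x] in [wr] accounts for the factors
   [x ^ dl] and [x ^ (- dl)] by which the two series differ from solutions of one equation. *)
Variables a1 b1 a2 b2 mu dl al : C.
Hypothesis E1 : a1 + b1 - (mu + dl) = al.
Hypothesis E2 : a2 + b2 - (mu - dl) = al.
Hypothesis Hc1 : 0 < Re (mu + dl).
Hypothesis Hc2 : 0 < Re (mu - dl).
Hypothesis Hal : -1 < Re al < 1.
Hypothesis Hal0 : al <> 0.
(** Two situations: equal lower parameters on (0,1), and the series in 1/x, where the term dl x^(mu
    - 1) of the concomitant has to vanish at 0. *)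
Hypothesis Hdl : dl = 0 \/ (0 < Re (mu - 1)).

Let h1 := hcoef a1 b1 (mu + dl).
Let h2 := hcoef a2 b2 (mu - dl).

Let wr (x : R) : C :=
  CPS (Dco h1) x * CPS h2 x - CPS h1 x * CPS (Dco h2) x + dl / RtoC x * (CPS h1 x * CPS h2 x).

(** x^c (1 - x)^(a + b - c + 1) is the factor that makes the hypergeometric operator self-adjoint;
    [mu], the mean of the two lower parameters, takes the place of c. *)
Let G (x : R) : C := Rcpow x mu * Rcpow (1 - x) (al + 1) * wr x.

(** What remains after both equations are inserted. For dl = 0 it is the constant a1 b1 - a2 b2; for
    the series in 1/x, with dl = p - q, it reduces to dl (mu - 1)/x. *)
Let kappa (x : R) : C :=
  dl * (mu - 1) * (/ RtoC x - 1) - dl * (al + 1) + a1 * b1 - a2 * b2.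

Let g (x : R) : C :=
  kappa x * (Rcpow x (mu - 1) * Rcpow (1 - x) al * (CPS h1 x * CPS h2 x)).

Lemma Cder_inv_RtoC (x : R) : x <> 0%R -> Cder (fun t => / RtoC t) x (- / (RtoC x * RtoC x)).
Proof.
  intros Hx.
  assert (H : Cder (fun t => RtoC (/ t)) x (RtoC (- / (x * x)))).
  { apply Cder_RtoC; auto_derive; [exact Hx | field; exact Hx]. }
  rewrite RtoC_opp, RtoC_inv, RtoC_mult in H by (now apply Rmult_integral_contrapositive).
  apply Cder_ext_loc with (2 := H).
  assert (Hpos : 0 < Rabs x) by now apply Rabs_pos_lt.
  exists (mkposreal _ Hpos); intros t Ht; apply RtoC_inv.
  intros E; rewrite E in Ht; change (Rabs (0 - x) < Rabs x) in Ht.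
  rewrite Rminus_0_l, Rabs_Ropp in Ht; lra.
Qed.

Lemma wronskian_radius1 : radius1 h1.
Proof. now apply radius1_hcoef. Qed.

Lemma wronskian_radius2 : radius1 h2.
Proof. now apply radius1_hcoef. Qed.

Lemma Cder_wronskian (x : R) : 0 < x < 1 -> Cder G x (g x).
Proof.
  intros Hx.
  pose proof wronskian_radius1 as R1; pose proof wronskian_radius2 as R2.
  pose proof (radius1_Dco _ R1) as D1; pose proof (radius1_Dco _ R2) as D2.
  assert (Hx' : Rabs x < 1) by (rewrite Rabs_pos_eq; lra).
  assert (Hx0 : x <> 0%R) by lra.
  eapply Cder_val; [| apply Cder_mult; [apply Cder_mult; [apply Cder_Rcpow; lra |
     apply Cder_Rcpow_1m; lra] |]].
  2: { apply Cder_plus; [apply Cder_minus; apply Cder_mult; apply Cder_CPS; auto |].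
       apply Cder_mult; [| apply Cder_mult; apply Cder_CPS; auto].
       apply Cder_scal, Cder_inv_RtoC, Hx0. }
  pose proof (hyper_ode a1 b1 (mu + dl) x Hc1 Hx') as O1; fold h1 in O1.
  pose proof (hyper_ode a2 b2 (mu - dl) x Hc2 Hx') as O2; fold h2 in O2.
  (* Eliminating [b1] and [b2] through the common [al], and the second derivatives through the two
     equations, leaves a rational identity. *)
  assert (B1 : b1 = al + (mu + dl) - a1) by (rewrite <- E1; ring).
  assert (B2 : b2 = al + (mu - dl) - a2) by (rewrite <- E2; ring).
  unfold g, kappa, wr.
  rewrite Rcpow_minus, Rcpow_1, Rcpow_plus, Rcpow_1 by lra.
  rewrite RtoC_mult in O1, O2; rewrite RtoC_minus in O1, O2 |- *.
  assert (Hxc : RtoC x <> 0) by (now apply RtoC_neq).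
  assert (H1x : 1 - RtoC x <> 0) by (rewrite <- RtoC_minus; apply RtoC_neq; lra).
  set (X := RtoC x) in *.
  set (f1 := CPS h1 x) in *; set (f1' := CPS (Dco h1) x) in *.
  set (f1'' := CPS (Dco (Dco h1)) x) in *.
  set (f2 := CPS h2 x) in *; set (f2' := CPS (Dco h2) x) in *.
  set (f2'' := CPS (Dco (Dco h2)) x) in *.
  assert (O1' : f1'' = (a1 * b1 * f1 - (mu + dl - (a1 + b1 + 1) * X) * f1') / (X * (1 - X))).
  { rewrite <- O1; field; auto. }
  assert (O2' : f2'' = (a2 * b2 * f2 - (mu - dl - (a2 + b2 + 1) * X) * f2') / (X * (1 - X))).
  { rewrite <- O2; field; auto. }
  rewrite O1', O2', B1, B2.
  field; auto.
Qed.

Lemma ex_Cder_wronskian_integrand (x : R) : 0 < x < 1 -> exists l, Cder g x l.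
Proof.
  intros Hx; eexists.
  assert (Hx' : Rabs x < 1) by (rewrite Rabs_pos_eq; lra).
  apply Cder_mult.
  - unfold kappa; apply Cder_minus; [| apply Cder_const].
    apply Cder_plus; [| apply Cder_const].
    apply Cder_minus; [| apply Cder_const].
    apply Cder_scal, Cder_minus; [apply Cder_inv_RtoC; lra | apply Cder_const].
  - apply Cder_mult; [apply Cder_mult; [apply Cder_Rcpow; lra | apply Cder_Rcpow_1m; lra] |].
    apply Cder_mult; apply Cder_CPS; auto; [apply wronskian_radius1 | apply wronskian_radius2].
Qed.

Lemma wronskian_lim_0 : Clim (at_right 0) G 0.
Proof.
  pose proof wronskian_radius1 as R1; pose proof wronskian_radius2 as R2.
  pose proof (radius1_Dco _ R1) as D1; pose proof (radius1_Dco _ R2) as D2.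
  assert (H0 : Rabs 0 < 1) by (rewrite Rabs_R0; lra).
  assert (Hmu : 0 < Re mu).
  { rewrite Re_plus in Hc1; rewrite Re_minus in Hc2; lra. }
  assert (L : forall u, radius1 u -> Clim (at_right 0) (CPS u) (CPS u 0)).
  { intros u Hu; exact (Cder_Clim_right _ _ _ (Cder_CPS u 0 Hu H0)). }
  assert (LU : Clim (at_right 0) (fun x => Rcpow (1 - x) (al + 1)) (Rcpow (1 - 0) (al + 1))).
  { apply (Cder_Clim_right (fun x => Rcpow (1 - x) (al + 1)) 0 _ (Cder_Rcpow_1m (al + 1) 0 Rlt_0_1)). }
  assert (LX : Clim (at_right 0) (fun x => dl * Rcpow x (mu - 1)) 0).
  { destruct Hdl as [-> | H].
    - apply Clim_ext with (fun _ => 0); [intros; ring | apply Clim_const].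
    - replace (RtoC 0) with (dl * 0) by ring; now apply Clim_scal, Rcpow_lim0. }
  (* x^mu / x is merged into x^(mu - 1), which isolates the possibly singular term. *)
  apply Clim_ext_loc with (fun x => Rcpow (1 - x) (al + 1) *
    (Rcpow x mu * (CPS (Dco h1) x * CPS h2 x - CPS h1 x * CPS (Dco h2) x)
     + dl * Rcpow x (mu - 1) * (CPS h1 x * CPS h2 x))).
  - generalize (at_right_between 0 1 Rlt_0_1); apply filter_imp; intros x Hx.
    unfold G, wr; rewrite Rcpow_minus, Rcpow_1 by lra.
    field; apply RtoC_neq; lra.
  - replace (RtoC 0) with (Rcpow (1 - 0) (al + 1) *
      (0 * (CPS (Dco h1) 0 * CPS h2 0 - CPS h1 0 * CPS (Dco h2) 0) + 0 * (CPS h1 0 * CPS h2 0)))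
      by ring.
    apply Clim_mult; [exact LU |].
    apply Clim_plus; apply Clim_mult; auto.
    + now apply Rcpow_lim0.
    + apply Clim_minus; apply Clim_mult; auto.
    + apply Clim_mult; auto.
Qed.

(** [Yl] and [Vl] are the limits at 1 of (1 - x)^(al + 1) F' and of (1 - x) F' - al F. *)
Let Yl (a b c : C) : C := rGamma a * rGamma b / (rGamma c * rGamma (al + 1)).
Let Vl (a b c : C) : C := rGamma (c - a) * rGamma (c - b) / (rGamma c * rGamma (1 - al)).

(* Both [F] are eliminated in favour of [Y] and [V] by [al F = (1 - x) F' - V]. *)
Lemma wronskian_lim_1 :
  Clim (at_left 1) G
    ((Yl a2 b2 (mu - dl) * Vl a1 b1 (mu + dl) - Yl a1 b1 (mu + dl) * Vl a2 b2 (mu - dl)) / al).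
Proof.
  set (Y1 := fun x => Rcpow (1 - x) (al + 1) * CPS (Dco h1) x).
  set (Y2 := fun x => Rcpow (1 - x) (al + 1) * CPS (Dco h2) x).
  set (V1 := fun x => RtoC (1 - x) * CPS (Dco h1) x - al * CPS h1 x).
  set (V2 := fun x => RtoC (1 - x) * CPS (Dco h2) x - al * CPS h2 x).
  assert (LY1 : Clim (at_left 1) Y1 (Yl a1 b1 (mu + dl))).
  { unfold Y1, Yl, h1; rewrite <- E1; apply hyper_deriv_lim; [exact Hc1 | rewrite E1; lra]. }
  assert (LY2 : Clim (at_left 1) Y2 (Yl a2 b2 (mu - dl))).
  { unfold Y2, Yl, h2; rewrite <- E2; apply hyper_deriv_lim; [exact Hc2 | rewrite E2; lra]. }
  assert (LV1 : Clim (at_left 1) V1 (Vl a1 b1 (mu + dl))).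
  { unfold V1, Vl, h1; rewrite <- E1; apply hyper_contiguous_lim; [exact Hc1 | rewrite E1; lra]. }
  assert (LV2 : Clim (at_left 1) V2 (Vl a2 b2 (mu - dl))).
  { unfold V2, Vl, h2; rewrite <- E2; apply hyper_contiguous_lim; [exact Hc2 | rewrite E2; lra]. }
  assert (Lx : Clim (at_left 1) (fun x => RtoC (1 - x)) 0).
  { apply Clim_ext with (fun x => 1 - RtoC x); [intros x; now rewrite RtoC_minus |].
    replace (RtoC 0) with (RtoC 1 - 1) by ring.
    apply Clim_minus; [apply Clim_const | apply Clim_RtoC]. }
  assert (LX : Clim (at_left 1) (fun x => Rcpow x mu) 1).
  { rewrite <- (Rcpow_one mu).
    exact (Cder_Clim_left (fun x => Rcpow x mu) 1 _ (Cder_Rcpow mu 1 Rlt_0_1)). }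
  assert (LX' : Clim (at_left 1) (fun x => Rcpow x mu * (dl / RtoC x)) (1 * (dl / 1))).
  { apply Clim_mult; [exact LX |]; apply Clim_div; [apply RtoC_neq; lra | apply Clim_const |].
    apply Clim_RtoC. }
  assert (LU : Clim (at_left 1) (fun x => Rcpow (1 - x) (al + 1)) 0).
  { apply Rcpow_1m_lim0; rewrite Re_plus, Re_RtoC; lra. }
  assert (LU' : Clim (at_left 1) (fun x => Rcpow (1 - x) (1 - al)) 0).
  { apply Rcpow_1m_lim0; rewrite Re_minus, Re_RtoC; lra. }
  (* In F1' F2 - F1 F2' the products of two derivatives cancel. In the dl term every summand keeps a
     factor (1 - x)^(1 - al), 1 - x or (1 - x)^(1 + al), and all of these vanish at 1 because |Re
     al| < 1. *)
  apply Clim_ext_loc with (fun x =>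
    Rcpow x mu * ((Y2 x * V1 x - Y1 x * V2 x) / al) +
    Rcpow x mu * (dl / RtoC x) *
      ((Rcpow (1 - x) (1 - al) * (Y1 x * Y2 x) - RtoC (1 - x) * (Y1 x * V2 x)
        - RtoC (1 - x) * (Y2 x * V1 x) + Rcpow (1 - x) (al + 1) * (V1 x * V2 x)) / (al * al))).
  - generalize (at_left_between 0 1 Rlt_0_1); apply filter_imp; intros x Hx.
    unfold G, wr, Y1, Y2, V1, V2.
    assert (H1x : RtoC (1 - x) <> 0) by (apply RtoC_neq; lra).
    assert (Hx0 : RtoC x <> 0) by (apply RtoC_neq; lra).
    rewrite Rcpow_plus, Rcpow_minus, !Rcpow_1 by lra.
    pose proof (Rcpow_neq_0 (1 - x) al).
    field; auto.
  - set (Yl1 := Yl a1 b1 (mu + dl)) in *; set (Yl2 := Yl a2 b2 (mu - dl)) in *.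
    set (Vl1 := Vl a1 b1 (mu + dl)) in *; set (Vl2 := Vl a2 b2 (mu - dl)) in *.
    apply Clim_val with (1 * ((Yl2 * Vl1 - Yl1 * Vl2) / al) + 1 * (dl / 1) *
      ((0 * (Yl1 * Yl2) - 0 * (Yl1 * Vl2) - 0 * (Yl2 * Vl1) + 0 * (Vl1 * Vl2)) / (al * al))).
    { field; exact Hal0. }
    apply Clim_plus; apply Clim_mult; auto.
    + apply Clim_div; [exact Hal0 | | apply Clim_const].
      apply Clim_minus; apply Clim_mult; auto.
    + apply Clim_div; [now apply Cmult_neq_0 | | apply Clim_const].
      apply Clim_plus; [apply Clim_minus; [apply Clim_minus |] |];
        repeat (apply Clim_mult; auto).
Qed.

Lemma wronskian_integral :
  CRInt_gen g (at_right 0) (at_left 1)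
    ((Yl a2 b2 (mu - dl) * Vl a1 b1 (mu + dl) - Yl a1 b1 (mu + dl) * Vl a2 b2 (mu - dl)) / al).
Proof.
  eapply CRInt_gen_val; [| apply (CRInt_gen_antiderivative G g)].
  3: exact ex_Cder_wronskian_integrand.
  2: exact Cder_wronskian.
  2: exact wronskian_lim_0.
  2: exact wronskian_lim_1.
  ring.
Qed.

End wronskian.

(** * Limits of improper integrals *)

Lemma Rpower_le_exponent (x s t : R) :
  0 < x < 1 -> s <= t -> Rpower x t <= Rpower x s.
Proof.
  intros Hx Hst; unfold Rpower.
  assert (Hl : ln x < 0) by (rewrite <- ln_1; apply ln_increasing; lra).
  assert (H : t * ln x <= s * ln x) by nra.
  destruct H as [H | H]; [left; now apply exp_increasing | rewrite H; lra].
Qed.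

Lemma Rpower_ge_1 (x s : R) : 0 < x < 1 -> s <= 0 -> 1 <= Rpower x s.
Proof.
  intros Hx Hs; rewrite <- (Rpower_O x) by lra; now apply Rpower_le_exponent.
Qed.

Lemma Rpower_le_2 (x s : R) : 1 / 2 <= x < 1 -> -1 <= s -> Rpower x s <= 2.
Proof.
  intros Hx Hs; apply Rle_trans with (Rpower x (- (1))).
  - apply Rpower_le_exponent; lra.
  - rewrite Rpower_Ropp, Rpower_1 by lra.
    apply Rmult_le_reg_r with x; [lra |]; rewrite Rinv_l; lra.
Qed.

Definition beta_weight (u v x : R) : R := (Rpower x u * Rpower (1 - x) (- v))%R.

(** On each half of the interval one factor is at most 2. The sum, unlike the product, has an
    elementary antiderivative. *)
Lemma beta_weight_le (u v x : R) :
  -1 < u <= 0 -> 0 <= v < 1 -> 0 < x < 1 ->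
  beta_weight u v x <= 2 * (Rpower x u + Rpower (1 - x) (- v)).
Proof.
  intros Hu Hv Hx; unfold beta_weight.
  assert (H1 : 0 < Rpower x u) by apply exp_pos.
  assert (H2 : 0 < Rpower (1 - x) (- v)) by apply exp_pos.
  destruct (Rle_dec x (1 / 2)) as [H | H].
  - assert (Rpower (1 - x) (- v) <= 2) by (apply Rpower_le_2; lra). nra.
  - assert (Rpower x u <= 2) by (apply Rpower_le_2; lra). nra.
Qed.

(** The bound does not depend on the endpoints a and b; this uniformity is what survives in the
    improper integral. *)
Lemma is_RInt_beta_majorant (u v a b : R) :
  -1 < u <= 0 -> 0 <= v < 1 -> 0 < a -> a <= b -> b < 1 ->
  exists I, is_RInt (fun x => 2 * (Rpower x u + Rpower (1 - x) (- v)))%R a b I /\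
            (I <= 2 * (/ (u + 1) + / (1 - v))).
Proof.
  intros Hu Hv Ha Hab Hb.
  set (H := fun x => (2 * (Rpower x (u + 1) / (u + 1) - Rpower (1 - x) (1 - v) / (1 - v)))%R).
  exists (H b - H a)%R; split.
  - apply (is_RInt_derive (V := R_CompleteNormedModule) H); intros x Hx;
      rewrite Rmin_left, Rmax_right in Hx by exact Hab.
    + unfold H, Rpower; auto_derive; [lra |].
      assert (E1 : (exp ((u + 1) * ln x) = x * exp (u * ln x))%R).
      { rewrite Rmult_plus_distr_r, exp_plus, Rmult_1_l, exp_ln by lra; ring. }
      assert (E2 : (exp ((1 - v) * ln (1 - x)) = (1 - x) * exp (- v * ln (1 - x)))%R).
      { replace ((1 - v) * ln (1 - x))%R with (ln (1 - x) + - v * ln (1 - x))%R by ring.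
        rewrite exp_plus, exp_ln by lra; ring. }
      replace (1 + - x)%R with (1 - x)%R by ring.
      replace (1 + - v)%R with (1 - v)%R by ring.
      rewrite E1, E2; field; lra.
    + apply (ex_derive_continuous (fun x => 2 * (Rpower x u + Rpower (1 - x) (- v)))%R).
      unfold Rpower; auto_derive; lra.
  - assert (P : forall x s, 0 < x < 1 -> 0 < s -> 0 <= Rpower x s <= 1).
    { intros x s Hx Hs; split; [left; apply exp_pos |].
      rewrite <- (Rpower_O x) by lra; apply Rpower_le_exponent; lra. }
    pose proof (P b (u + 1)%R ltac:(lra) ltac:(lra)) as P1.
    pose proof (P a (u + 1)%R ltac:(lra) ltac:(lra)) as P2.
    pose proof (P (1 - b)%R (1 - v)%R ltac:(lra) ltac:(lra)) as P3.
    pose proof (P (1 - a)%R (1 - v)%R ltac:(lra) ltac:(lra)) as P4.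
    assert (I1 : 0 < / (u + 1)) by (apply Rinv_0_lt_compat; lra).
    assert (I2 : 0 < / (1 - v)) by (apply Rinv_0_lt_compat; lra).
    unfold H, Rdiv; nra.
Qed.

Lemma ex_RInt_Cder (f : R -> C) (a b : R) :
  a <= b -> (forall x, a <= x <= b -> exists l, Cder f x l) ->
  exists y : C, is_RInt (V := C_R_NormedModule) f a b y.
Proof.
  intros Hab Hf.
  assert (H1 : ex_RInt (fun x => Re (f x)) a b).
  { apply (ex_RInt_continuous (V := R_CompleteNormedModule)); intros x Hx.
    rewrite Rmin_left, Rmax_right in Hx by exact Hab.
    destruct (Hf x Hx) as [l [Hl _]].
    apply (ex_derive_continuous (fun t => Re (f t))); now exists (Re l). }
  assert (H2 : ex_RInt (fun x => Im (f x)) a b).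
  { apply (ex_RInt_continuous (V := R_CompleteNormedModule)); intros x Hx.
    rewrite Rmin_left, Rmax_right in Hx by exact Hab.
    destruct (Hf x Hx) as [l [_ Hl]].
    apply (ex_derive_continuous (fun t => Im (f t))); now exists (Im l). }
  destruct H1 as [y1 H1]; destruct H2 as [y2 H2]; exists (y1, y2).
  now apply is_RInt_C_iff.
Qed.

Lemma RInt_beta_weight_diff (f g : R -> C) (k u v a b : R) (yf yg : C) :
  -1 < u <= 0 -> 0 <= v < 1 -> 0 < a -> a <= b -> b < 1 -> 0 <= k ->
  (forall x, 0 < x < 1 -> Cmod (f x - g x) <= k * beta_weight u v x) ->
  is_RInt (V := C_R_NormedModule) f a b yf -> is_RInt (V := C_R_NormedModule) g a b yg ->
  Cmod (yf - yg) <= k * (2 * (/ (u + 1) + / (1 - v))).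
Proof.
  intros Hu Hv Ha Hab Hb Hk Hfg Hf Hg.
  destruct (is_RInt_beta_majorant u v a b Hu Hv Ha Hab Hb) as [J [HJ1 HJ2]].
  assert (H : Cmod (yf - yg) <= k * J).
  { pose proof (is_RInt_minus _ _ _ _ _ _ Hf Hg) as Hm.
    pose proof (is_RInt_scal _ _ _ k _ HJ1) as Hs.
    assert (N : forall z : C, norm (V := C_R_NormedModule) z = Cmod z).
    { intros [x y]; change (sqrt (Rabs x ^ 2 + Rabs y ^ 2) = sqrt (x ^ 2 + y ^ 2))%R.
      now rewrite !pow2_abs. }
    rewrite <- N; change (norm (minus yf yg : C_R_NormedModule) <= k * J).
    refine (norm_RInt_le _ _ a b _ _ Hab _ Hm Hs).
    intros x Hx; rewrite N.
    change (Cmod (f x - g x) <= k * (2 * (Rpower x u + Rpower (1 - x) (- v)))).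
    apply Rle_trans with (1 := Hfg x ltac:(lra)), Rmult_le_compat_l; [exact Hk |].
    apply beta_weight_le; lra. }
  apply Rle_trans with (1 := H); now apply Rmult_le_compat_l.
Qed.

(** * Integrals depending on a parameter e -> 0+ under a Lipschitz bound *)

Section limit_of_integrals.

Variables (f : R -> C) (fe : R -> R -> C) (Le : R -> C) (K u v : R).
Hypothesis HK : 0 < K.
Hypothesis Hu : -1 < u <= 0.
Hypothesis Hv : 0 <= v < 1.
Hypothesis Hf : forall x, 0 < x < 1 -> exists l, Cder f x l.
Hypothesis Hfe : forall e, 0 < e < 1 -> CRInt_gen (fe e) (at_right 0) (at_left 1) (Le e).
Hypothesis Hbd : forall e x, 0 < e < 1 -> 0 < x < 1 ->
  Cmod (fe e x - f x) <= e * K * beta_weight u v x.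

Let B := (K * (2 * (/ (u + 1) + / (1 - v))))%R.

Lemma limit_const_pos : 0 < B.
Proof.
  assert (I1 : 0 < / (u + 1)) by (apply Rinv_0_lt_compat; lra).
  assert (I2 : 0 < / (1 - v)) by (apply Rinv_0_lt_compat; lra).
  unfold B; apply Rmult_lt_0_compat; lra.
Qed.

(** A pair of endpoints at which the integral of [fe e] is close to its limit also serves for f,
    because the error e * B of the comparison is independent of the endpoints. *)
Lemma CRInt_gen_close (e eps : R) :
  0 < e < 1 -> 0 < eps ->
  filter_prod (at_right 0) (at_left 1) (fun ab => exists y : C,
    is_RInt (V := C_R_NormedModule) f (fst ab) (snd ab) y /\ (Cmod (y - Le e) < e * B + eps)).
Proof.
  intros He Heps.
  generalize (filter_and _ _ filter_prod_01 (Hfe e He eps Heps)); apply filter_imp.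
  intros [a b] [[H1 [H2 H3]] [ye [Hye1 Hye2]]]; simpl in *.
  destruct (ex_RInt_Cder f a b H2) as [y Hy]; [intros x Hx; apply Hf; lra |].
  exists y; split; [exact Hy |].
  assert (Hd : Cmod (ye - y) <= e * B).
  { unfold B; rewrite <- Rmult_assoc.
    apply (RInt_beta_weight_diff (fe e) f (e * K) u v a b); auto.
    - apply Rmult_le_pos; lra. }
  replace (y - Le e) with ((ye - Le e) - (ye - y)) by ring.
  pose proof (Cmod_minus_le (ye - Le e) (ye - y)); lra.
Qed.

(** Both values are compared with the integral of f over one common interval. *)
Lemma Le_cauchy (e e' : R) :
  0 < e < 1 -> 0 < e' < 1 -> Cmod (Le e - Le e') <= e * B + e' * B.
Proof.
  intros He He'; apply Rle_plus_epsilon; intros eps Heps.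
  assert (Heps2 : 0 < eps / 2) by lra.
  destruct (filter_ex _ (filter_and _ _ (CRInt_gen_close e _ He Heps2)
    (CRInt_gen_close e' _ He' Heps2))) as [[a b] [[y [Hy1 Hy2]] [y' [Hy1' Hy2']]]].
  simpl in *.
  assert (E : y = y').
  { apply is_RInt_C_iff in Hy1, Hy1'; apply C_ext.
    - now rewrite <- (is_RInt_unique _ _ _ _ (proj1 Hy1)), (is_RInt_unique _ _ _ _ (proj1 Hy1')).
    - now rewrite <- (is_RInt_unique _ _ _ _ (proj2 Hy1)), (is_RInt_unique _ _ _ _ (proj2 Hy1')). }
  subst y'.
  replace (Le e - Le e') with ((y - Le e') - (y - Le e)) by ring.
  pose proof (Cmod_minus_le (y - Le e') (y - Le e)); lra.
Qed.

(* The values [Le e] form a Cauchy family, so that the convergence of the limit integral need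
   not be assumed. *)
Lemma CRInt_gen_limit :
  exists L, Clim (at_right 0) Le L /\ CRInt_gen f (at_right 0) (at_left 1) L.
Proof.
  pose proof limit_const_pos as HB.
  (* Halving the parameter makes the increments of [Le (e n)] geometric. *)
  set (e := fun n : nat => ((/ 2) ^ (S n))%R).
  assert (He : forall n, 0 < e n < 1).
  { intros n; unfold e; split; [apply pow_lt; lra |].
    apply pow_lt_1_compat; [lra | lia]. }
  destruct (Clim_seq_cauchy (fun n => Le (e n)) (fun n => 2 * B * (/ 2) ^ n)%R) as [L HL].
  - intros n; apply Rle_trans with (1 := Le_cauchy _ _ (He _) (He _)).
    unfold e; simpl; pose proof (pow_lt (/ 2) n ltac:(lra)).
    assert (0 < B * (/ 2) ^ n) by (now apply Rmult_lt_0_compat). lra.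
  - apply (ex_series_scal (V := R_NormedModule)).
    exists (/ (1 - / 2))%R; apply is_series_geom; rewrite Rabs_pos_eq; lra.
  (* The Cauchy estimate with its second parameter sent to 0. *)
  - assert (Hrate : forall d, 0 < d < 1 -> Cmod (Le d - L) <= d * B).
    { intros d Hd; apply Rle_plus_epsilon; intros eps Heps.
      assert (Heps2 : 0 < eps / 2) by lra.
      destruct (HL _ Heps2) as [N1 HN1].
      assert (Hd' : 0 < eps / 2 / B) by (now apply Rdiv_lt_0_compat).
      destruct (pow_lt_1_zero (/ 2) ltac:(rewrite Rabs_pos_eq; lra) _ Hd') as [N2 HN2].
      specialize (HN1 (N1 + N2)%nat ltac:(lia)); specialize (HN2 (S (N1 + N2)) ltac:(lia)).
      fold (e (N1 + N2)%nat) in HN2.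
      pose proof (He (N1 + N2)%nat) as HeN.
      rewrite Rabs_pos_eq in HN2 by lra.
      pose proof (Le_cauchy d (e (N1 + N2)%nat) Hd HeN) as H1.
      assert (H2 : e (N1 + N2)%nat * B < eps / 2).
      { apply Rmult_lt_compat_r with (r := B) in HN2; [| exact HB].
        replace (eps / 2 / B * B)%R with (eps / 2)%R in HN2 by (field; lra); exact HN2. }
      replace (Le d - L) with ((Le d - Le (e (N1 + N2)%nat)) + (Le (e (N1 + N2)%nat) - L)) by ring.
      pose proof (Cmod_triangle (Le d - Le (e (N1 + N2)%nat)) (Le (e (N1 + N2)%nat) - L)); lra. }
    exists L; split.
    + intros eps Heps.
      assert (Hm : 0 < Rmin 1 (eps / B)).
      { apply Rmin_glb_lt; [lra | now apply Rdiv_lt_0_compat]. }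
      generalize (at_right_between _ _ Hm); apply filter_imp; intros d Hd.
      pose proof (Rmin_l 1 (eps / B)); pose proof (Rmin_r 1 (eps / B)).
      apply Rle_lt_trans with (d * B)%R; [apply Hrate; lra |].
      apply Rlt_le_trans with (eps / B * B)%R; [apply Rmult_lt_compat_r; lra |].
      right; field; lra.
    + intros eps Heps.
      set (d := Rmin (1 / 2) (eps / (4 * B))).
      assert (Hd : 0 < d).
      { apply Rmin_glb_lt; [lra | apply Rdiv_lt_0_compat; lra]. }
      assert (Hd1 : d <= 1 / 2) by apply Rmin_l.
      assert (Hd2 : d * B <= eps / 4).
      { apply Rle_trans with (eps / (4 * B) * B)%R; [apply Rmult_le_compat_r; [lra | apply Rmin_r] |].
        right; field; lra. }
      generalize (CRInt_gen_close d (eps / 4) ltac:(lra) ltac:(lra)); apply filter_imp.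
      intros [a b] [y [Hy1 Hy2]]; exists y; split; [exact Hy1 |].
      pose proof (Hrate d ltac:(lra)) as H1.
      replace (y - L) with ((y - Le d) + (Le d - L)) by ring.
      pose proof (Cmod_triangle (y - Le d) (Le d - L)); lra.
Qed.

End limit_of_integrals.

(** * The substitution of 1/x *)

Lemma is_RInt_inv_subst (f : R -> R) (a b y : R) :
  1 < a -> a <= b -> (forall x, 0 < x < 1 -> ex_derive f x) ->
  is_RInt f (/ b) (/ a) y -> is_RInt (fun x => f (/ x) / (x * x))%R a b y.
Proof.
  intros Ha Hab Hf Hy.
  assert (Hinv : forall x, a <= x <= b -> 0 < / x < 1).
  { intros x Hx; split; [apply Rinv_0_lt_compat; lra |].
    rewrite <- Rinv_1; apply Rinv_lt_contravar; lra. }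
  pose proof (is_RInt_comp (V := R_CompleteNormedModule) f (fun x => / x)%R
    (fun x => - / (x * x))%R a b) as H.
  rewrite Rmin_left, Rmax_right in H by exact Hab.
  assert (H1 : is_RInt (V := R_NormedModule) (fun x => scal (- / (x * x))%R (f (/ x)%R)) a b
                 (RInt (V := R_CompleteNormedModule) f (/ a) (/ b))).
  { apply H.
    - intros x Hx; apply (ex_derive_continuous f), Hf, Hinv, Hx.
    - intros x Hx; split; [auto_derive; [lra | field; lra] |].
      apply (ex_derive_continuous (fun x => - / (x * x))%R); auto_derive.
      apply Rmult_integral_contrapositive; split; lra. }
  (* Inversion reverses the orientation: the negative derivative and the exchanged endpoints
     compensate each other. *)
  apply is_RInt_swap in Hy.
  rewrite (is_RInt_unique (V := R_CompleteNormedModule) _ _ _ _ Hy) in H1.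
  apply is_RInt_opp in H1.
  replace y with (opp (opp y : R_NormedModule)) by apply opp_opp.
  apply is_RInt_ext with (2 := H1); intros x Hx.
  unfold opp, scal; simpl; unfold mult; simpl; unfold Rdiv; ring.
Qed.

Lemma is_RInt_C_inv_subst (f : R -> C) (a b : R) (y : C) :
  1 < a -> a <= b -> (forall x, 0 < x < 1 -> exists l, Cder f x l) ->
  is_RInt (V := C_R_NormedModule) f (/ b) (/ a) y ->
  is_RInt (V := C_R_NormedModule) (fun x => f (/ x)%R / RtoC (x * x)) a b y.
Proof.
  intros Ha Hab Hf Hy; apply is_RInt_C_iff in Hy; destruct Hy as [H1 H2].
  apply is_RInt_inv_subst in H1; auto.
  2: { intros x Hx; destruct (Hf x Hx) as [l [Hl _]]; now exists (Re l). }
  apply is_RInt_inv_subst in H2; auto.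
  2: { intros x Hx; destruct (Hf x Hx) as [l [_ Hl]]; now exists (Im l). }
  assert (E : forall x, Rmin a b < x < Rmax a b ->
    f (/ x)%R / RtoC (x * x) = RtoC (/ (x * x)) * f (/ x)%R).
  { intros x Hx; rewrite Rmin_left, Rmax_right in Hx by exact Hab.
    rewrite RtoC_inv by (apply Rmult_integral_contrapositive; split; lra).
    unfold Cdiv; ring. }
  apply is_RInt_C_iff; split.
  - apply is_RInt_ext with (2 := H1); intros x Hx.
    rewrite E, Re_scal by exact Hx; apply Rmult_comm.
  - apply is_RInt_ext with (2 := H2); intros x Hx.
    rewrite E, Im_scal by exact Hx; apply Rmult_comm.
Qed.

Lemma filterlim_Rinv_infty : filterlim (fun x => / x)%R (Rbar_locally p_infty) (at_right 0).
Proof.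
  intros P [eps HP]; unfold filtermap.
  exists (Rmax 1 (/ eps))%R; intros x Hx.
  pose proof (Rmax_l 1 (/ eps)); pose proof (Rmax_r 1 (/ eps)).
  assert (He : 0 < / eps) by apply Rinv_0_lt_compat, cond_pos.
  assert (Hx0 : 0 < / x) by (apply Rinv_0_lt_compat; lra).
  apply HP; [| exact Hx0].
  change (Rabs (/ x - 0) < eps); rewrite Rminus_0_r, Rabs_pos_eq by lra.
  rewrite <- (Rinv_inv eps); apply Rinv_lt_contravar; [| lra].
  apply Rmult_lt_0_compat; lra.
Qed.

Lemma filterlim_Rinv_at_right_1 : filterlim (fun x => / x)%R (at_right 1) (at_left 1).
Proof.
  intros P [eps HP]; unfold filtermap.
  exists eps; intros x Hx Hx1.
  assert (H1 : / x < 1) by (rewrite <- Rinv_1; apply Rinv_lt_contravar; lra).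
  apply HP; [| exact H1].
  change (Rabs (x - 1) < eps) in Hx; change (Rabs (/ x - 1) < eps).
  rewrite Rabs_left by lra; rewrite Rabs_pos_eq in Hx by lra.
  apply Rle_lt_trans with (2 := Hx).
  apply Rmult_le_reg_r with x; [lra |].
  replace (- (/ x - 1) * x)%R with (x - 1)%R by (field; lra). nra.
Qed.

Lemma CRInt_gen_inv_subst (f : R -> C) (l : C) :
  (forall x, 0 < x < 1 -> exists l, Cder f x l) ->
  CRInt_gen f (at_right 0) (at_left 1) l ->
  CRInt_gen (fun x => f (/ x)%R / RtoC (x * x)) (at_right 1) (Rbar_locally p_infty) l.
Proof.
  intros Hf H eps He.
  destruct (filter_and _ _ filter_prod_01 (H eps He)) as [Q1 Q2 HQ1 HQ2 HQ].
  apply filterlim_Rinv_infty in HQ1; apply filterlim_Rinv_at_right_1 in HQ2.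
  unfold filtermap in HQ1, HQ2.
  assert (HP1 : Rbar_locally p_infty (fun x => 1 < x)) by (exists 1%R; auto).
  assert (HP2 : at_right 1 (fun x => 1 < x)).
  { exists (mkposreal 1 Rlt_0_1); auto. }
  (* [Q1], which concerns 0, governs the end at infinity, and [Q2] the end at 1. *)
  exists (fun x => Q2 (/ x)%R /\ (1 < x)) (fun x => Q1 (/ x)%R /\ (1 < x)).
  - now apply filter_and.
  - now apply filter_and.
  - intros a b [Ha1 Ha2] [Hb1 Hb2]; simpl.
    destruct (HQ _ _ Hb1 Ha1) as [[H1 [H2 H3]] [y [Hy1 Hy2]]]; simpl in *.
    exists y; split; [| exact Hy2].
    apply is_RInt_C_inv_subst; auto.
    rewrite <- (Rinv_inv a), <- (Rinv_inv b); apply Rinv_le_contravar; [exact H1 | exact H2].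
Qed.

Lemma CRInt_gen_ext_1_infty (f g : R -> C) (l : C) :
  (forall x, 1 < x -> f x = g x) ->
  CRInt_gen f (at_right 1) (Rbar_locally p_infty) l ->
  CRInt_gen g (at_right 1) (Rbar_locally p_infty) l.
Proof.
  intros Hfg H eps He.
  assert (HP : filter_prod (at_right 1) (Rbar_locally p_infty)
    (fun ab : R * R => (1 < fst ab) /\ (1 < snd ab))).
  { exists (fun x => 1 < x) (fun x => 1 < x); auto.
    - exists (mkposreal 1 Rlt_0_1); auto.
    - exists 1%R; auto. }
  generalize (filter_and _ _ HP (H eps He)); apply filter_imp.
  intros [a b] [[H1 H2] [y [Hy1 Hy2]]]; simpl in *.
  exists y; split; [| exact Hy2].
  apply (is_RInt_ext (V := C_R_NormedModule)) with (2 := Hy1); intros x Hx.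
  apply Hfg; pose proof (Rmin_glb_lt _ _ _ H1 H2); lra.
Qed.

(** * Dependence of the Gauss series on its parameters *)

(** [sa + sb = sc] keeps a + b - c fixed, as the Lipschitz bound on coefficients demands, and
    [0 <= sc] keeps Re c from decreasing. The slopes that occur are (-1, 1, 0) and (1, 1, 2), hence
    the bound 2. *)
Lemma hyper_perturbation (a b c : C) (sa sb sc s : R) :
  0 < Re c -> 0 <= sc -> (sa + sb = sc)%R ->
  Rabs sa <= 2 -> Rabs sb <= 2 -> Rabs sc <= 2 ->
  0 < s -> Re (a + b - c) <= s ->
  exists M, (0 < M) /\ forall x, 0 <= x < 1 ->
    (Cmod (CPS (hcoef a b c) x) <= M * Rpower (1 - x) (- s)) /\
    forall e, 0 < e < 1 ->
    Cmod (CPS (hcoef (a + RtoC (sa * e)) (b + RtoC (sb * e)) (c + RtoC (sc * e))) x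
           - CPS (hcoef a b c) x) <= M * e * Rpower (1 - x) (- s).
Proof.
  intros Hc Hsc Hs Ha2 Hb2 Hc2 Hs0 Hal.
  set (r := (Cmod a + Cmod b + Cmod c + 2)%R).
  pose proof (Cmod_ge_0 a); pose proof (Cmod_ge_0 b); pose proof (Cmod_ge_0 c).
  destruct (hcoef_bound a b c s Hc Hs0 Hal) as [M1 [HM1 HB1]].
  destruct (hcoef_diff_bound_unif r (Re c) s) as [M2 [HM2 HB2]]; try (unfold r; lra).
  exists (2 * M1 + 4 * M2)%R; split; [lra |]; intros x Hx.
  assert (HP : 0 < Rpower (1 - x) (- s)) by apply exp_pos.
  split.
  - apply Rle_trans with (1 := CPS_binco_bound _ s M1 x Hs0 HB1 Hx); nra.
  - intros e He.
    set (a' := a + RtoC (sa * e)); set (b' := b + RtoC (sb * e)); set (c' := c + RtoC (sc * e)).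
    assert (Hse : forall t, Rabs t <= 2 -> Cmod (RtoC (t * e)) <= 2 * e).
    { intros t Ht; rewrite Cmod_R, Rabs_mult, (Rabs_pos_eq e) by lra.
      apply Rmult_le_compat_r; lra. }
    assert (Hd : forall z t, Rabs t <= 2 -> Cmod (z + RtoC (t * e) - z) <= 2 * e).
    { intros z t Ht; replace (z + RtoC (t * e) - z) with (RtoC (t * e)) by ring; auto. }
    assert (Hn : forall z t, Rabs t <= 2 -> Cmod z + 2 <= r ->
              Cmod (z + RtoC (t * e)) <= r).
    { intros z t Ht Hz; apply Rle_trans with (1 := Cmod_triangle _ _).
      pose proof (Hse t Ht); lra. }
    assert (Rc' : Re c <= Re c').
    { unfold c'; rewrite Re_plus, Re_RtoC; nra. }
    assert (E : a' + b' - c' = a + b - c).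
    { unfold a', b', c'; rewrite <- Hs, !RtoC_mult, RtoC_plus; ring. }
    assert (HB : forall n, Cmod (hcoef a' b' c' n - hcoef a b c n) <= M2 * (2 * e) * binco s n).
    { apply HB2; [apply Hn; auto; unfold r; lra | apply Hn; auto; unfold r; lra |
        apply Hn; auto; unfold r; lra | unfold r; lra | unfold r; lra | unfold r; lra |
        exact Rc' | lra | exact E | now rewrite E | now apply Hd | now apply Hd | now apply Hd]. }
    assert (R1 : radius1 (hcoef a' b' c')) by (apply radius1_hcoef; lra).
    assert (R0 : radius1 (hcoef a b c)) by now apply radius1_hcoef.
    rewrite <- CPS_minus by (auto; rewrite Rabs_pos_eq; lra).
    apply Rle_trans with (1 := CPS_binco_bound _ s _ x Hs0 HB Hx).
    assert (0 < M1 * e * Rpower (1 - x) (- s)) by (repeat apply Rmult_lt_0_compat; lra).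
    lra.
Qed.

(** Differentiating x^t in t costs a factor ln x, which is traded for the power x^(-eta)/eta. *)
Lemma one_minus_Rpower_bound (x t eta : R) :
  0 < x < 1 -> 0 <= t -> 0 < eta ->
  Rabs (Rpower x t - 1) <= t * (Rpower x (- eta) / eta).
Proof.
  intros Hx Ht Heta.
  assert (Hl : ln x < 0) by (rewrite <- ln_1; apply ln_increasing; lra).
  assert (H1 : Rpower x t <= 1).
  { rewrite <- (Rpower_O x) by lra; apply Rpower_le_exponent; lra. }
  rewrite Rabs_left1 by lra.
  assert (H2 : 1 + t * ln x <= Rpower x t) by apply exp_ineq1_le.
  assert (H3 : - ln x <= Rpower x (- eta) / eta).
  { apply Rmult_le_reg_r with eta; [exact Heta |].
    unfold Rdiv; rewrite Rmult_assoc, Rinv_l, Rmult_1_r by lra.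
    pose proof (exp_ineq1_le (- eta * ln x)) as H3; fold (Rpower x (- eta)) in H3; lra. }
  assert (t * - ln x <= t * (Rpower x (- eta) / eta)) by (now apply Rmult_le_compat_l).
  lra.
Qed.

(** Each Gauss series costs (1 - x)^(-s), so the error is dominated by x^u (1 - x)^(-v) with v = 2s
    - Re al; the exponents have to be chosen with u > -1 and v < 1. *)
Lemma hyper_square_integral (a b c nu : C) (sa sb sc k : R) (Le : R -> C) :
  0 < Re c -> 0 <= sc -> (sa + sb = sc)%R ->
  Rabs sa <= 2 -> Rabs sb <= 2 -> Rabs sc <= 2 -> 0 <= k <= 1 ->
  -1 < Re (a + b - c) < 1 -> -1 < Re nu ->
  (forall e, 0 < e < 1 -> CRInt_gen (fun x => Rcpow x (nu + RtoC (k * e)) *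
     Rcpow (1 - x) (a + b - c) * (CPS (hcoef a b c) x *
     CPS (hcoef (a + RtoC (sa * e)) (b + RtoC (sb * e)) (c + RtoC (sc * e))) x))
     (at_right 0) (at_left 1) (Le e)) ->
  exists L, Clim (at_right 0) Le L /\
    CRInt_gen (fun x => Rcpow x nu * Rcpow (1 - x) (a + b - c) *
      (CPS (hcoef a b c) x * CPS (hcoef a b c) x)) (at_right 0) (at_left 1) L.
Proof.
  intros Hc Hsc Hs Ha2 Hb2 Hc2 Hk Hal Hnu HLe.
  set (al := a + b - c) in *.
  (* s is placed strictly between max(Re al, 0), above which the coefficient bounds hold, and (1 +
     Re al)/2, below which v < 1; there is room because |Re al| < 1. *)
  set (m := Rmax (Re al) 0).
  assert (Hm1 : Re al <= m) by apply Rmax_l.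
  assert (Hm2 : 0 <= m) by apply Rmax_r.
  assert (Hm3 : m < (1 + Re al) / 2) by (apply Rmax_lub_lt; lra).
  set (s := ((m + (1 + Re al) / 2) / 2)%R).
  assert (Hs1 : m < s) by (unfold s; lra).
  assert (Hs2 : s < (1 + Re al) / 2) by (unfold s; lra).
  (* Half of the available room Re nu + 1 pays for the logarithm. *)
  set (eta := ((Re nu + 1) / 2)%R).
  assert (Heta : 0 < eta) by (unfold eta; lra).
  set (u := Rmin (Re nu - eta) 0).
  assert (Hu1 : u <= Re nu - eta) by apply Rmin_l.
  assert (Hu2 : u <= 0) by apply Rmin_r.
  assert (Hu3 : -1 < u) by (apply Rmin_glb_lt; unfold eta; lra).
  set (v := (2 * s - Re al)%R).
  assert (Hv : 0 <= v < 1) by (unfold v; lra).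
  destruct (hyper_perturbation a b c sa sb sc s) as [M [HM HB]]; auto; try lra.
  { fold al; lra. }
  assert (Heta' : 0 < / eta) by now apply Rinv_0_lt_compat.
  apply (CRInt_gen_limit _ (fun e x => Rcpow x (nu + RtoC (k * e)) * Rcpow (1 - x) al *
    (CPS (hcoef a b c) x * CPS (hcoef (a + RtoC (sa * e)) (b + RtoC (sb * e))
      (c + RtoC (sc * e))) x)) Le (M * (M + M * / eta)) u v).
  - apply Rmult_lt_0_compat; [exact HM |].
    apply Rplus_lt_0_compat; [exact HM | now apply Rmult_lt_0_compat].
  - lra.
  - exact Hv.
  - intros x Hx; eexists.
    assert (R0 : radius1 (hcoef a b c)) by now apply radius1_hcoef.
    assert (Hx' : Rabs x < 1) by (rewrite Rabs_pos_eq; lra).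
    apply Cder_mult; [apply Cder_mult; [apply Cder_Rcpow; lra | apply Cder_Rcpow_1m; lra] |].
    apply Cder_mult; now apply Cder_CPS.
  - exact HLe.
  - intros e x He Hx; cbv beta.
    destruct (HB x ltac:(lra)) as [HB1 HB2]; specialize (HB2 e He).
    set (h0 := CPS (hcoef a b c) x) in *.
    set (he := CPS (hcoef (a + RtoC (sa * e)) (b + RtoC (sb * e)) (c + RtoC (sc * e))) x) in *.
    rewrite Rcpow_plus, Rcpow_RtoC.
    set (w := Rcpow x nu * Rcpow (1 - x) al * h0).
    (* The perturbation acts on the series and on the power of x; the two effects are separated. *)
    replace (Rcpow x nu * RtoC (Rpower x (k * e)) * Rcpow (1 - x) al * (h0 * he) -
      Rcpow x nu * Rcpow (1 - x) al * (h0 * h0)) with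
      (w * (RtoC (Rpower x (k * e)) * (he - h0) + RtoC (Rpower x (k * e) - 1) * h0)).
    2: { unfold w; rewrite RtoC_minus; ring. }
    set (T := Rpower (1 - x) (- s)) in *.
    assert (HT : 0 < T) by apply exp_pos.
    assert (Hke : 0 <= k * e) by (apply Rmult_le_pos; lra).
    assert (P1 : Rpower x (k * e) <= 1).
    { rewrite <- (Rpower_O x) by lra; apply Rpower_le_exponent; lra. }
    pose proof (one_minus_Rpower_bound x (k * e) eta Hx Hke Heta) as P2.
    assert (P3 : 1 <= Rpower x (- eta)) by (apply Rpower_ge_1; lra).
    set (X := Rpower x (- eta)) in *.
    assert (Hbr : Cmod (RtoC (Rpower x (k * e)) * (he - h0) + RtoC (Rpower x (k * e) - 1) * h0)
                   <= e * (M + M * / eta) * (X * T)).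
    { apply Rle_trans with (1 := Cmod_triangle _ _); rewrite !Cmod_mult, !Cmod_R.
      rewrite (Rabs_pos_eq (Rpower x (k * e))) by (left; apply exp_pos).
      assert (Q1 : Rpower x (k * e) * Cmod (he - h0) <= 1 * (M * e * T)).
      { apply Rmult_le_compat; auto; [left; apply exp_pos | apply Cmod_ge_0]. }
      assert (Q2 : Rabs (Rpower x (k * e) - 1) * Cmod h0 <= (e * (X * / eta)) * (M * T)).
      { apply Rmult_le_compat; auto; [apply Rabs_pos | apply Cmod_ge_0 |].
        apply Rle_trans with (1 := P2); unfold Rdiv.
        apply Rmult_le_compat_r; [apply Rmult_le_pos; lra |]; nra. }
      assert (Q3 : M * e * T <= M * e * T * X).
      { rewrite <- (Rmult_1_r (M * e * T)) at 1; apply Rmult_le_compat_l; [| exact P3].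
        apply Rmult_le_pos; [apply Rmult_le_pos; lra | lra]. }
      lra. }
    rewrite Cmod_mult.
    assert (Hw : Cmod w <= Rpower x (Re nu) * Rpower (1 - x) (Re al) * (M * T)).
    { unfold w; rewrite !Cmod_mult, !Cmod_Rcpow_Rpower.
      apply Rmult_le_compat_l; [| exact HB1].
      apply Rmult_le_pos; left; apply exp_pos. }
    apply Rle_trans with (Rpower x (Re nu) * Rpower (1 - x) (Re al) * (M * T) *
      (e * (M + M * / eta) * (X * T)))%R.
    { apply Rmult_le_compat; auto; apply Cmod_ge_0. }
    replace (Rpower x (Re nu) * Rpower (1 - x) (Re al) * (M * T) *
      (e * (M + M * / eta) * (X * T)))%R with
      (e * (M * (M + M * / eta)) * ((Rpower x (Re nu) * X) * (Rpower (1 - x) (Re al) * T * T)))%R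
      by ring.
    apply Rmult_le_compat_l.
    { apply Rmult_le_pos; [lra |]; apply Rmult_le_pos; [lra |].
      apply Rplus_le_le_0_compat; [lra | apply Rmult_le_pos; lra]. }
    unfold X, T; rewrite <- !Rpower_plus; unfold beta_weight.
    replace (Re al + - s + - s)%R with (- v)%R by (unfold v; ring).
    apply Rmult_le_compat_r; [left; apply exp_pos |].
    apply Rpower_le_exponent; lra.
Qed.

(** * Orthogonality and norms *)

Definition Ccos (z : C) : C := (Cexp (Ci * z) + Cexp (- (Ci * z))) / 2.

Lemma Ci_neq_0 : Ci <> 0.
Proof. intros H; injection H; lra. Qed.

Lemma Ci_sqr : Ci * Ci = - (1).
Proof. apply C_ext; simpl; ring. Qed.

Lemma C2_neq_0 : RtoC 2 <> 0.
Proof. apply RtoC_neq; lra. Qed.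

Lemma Csin_plus (a b : C) : Csin (a + b) = Csin a * Ccos b + Ccos a * Csin b.
Proof.
  unfold Csin, Ccos.
  replace (Ci * (a + b)) with (Ci * a + Ci * b) by ring.
  rewrite !Cexp_opp, Cexp_plus.
  pose proof (Cexp_neq_0 (Ci * a)); pose proof (Cexp_neq_0 (Ci * b)).
  pose proof Ci_neq_0; pose proof C2_neq_0.
  field; auto.
Qed.

Lemma Csin_opp (a : C) : Csin (- a) = - Csin a.
Proof.
  unfold Csin; replace (Ci * - a) with (- (Ci * a)) by ring.
  replace (- - (Ci * a)) with (Ci * a) by ring.
  field; apply Ci_neq_0.
Qed.

Lemma Ccos_opp (a : C) : Ccos (- a) = Ccos a.
Proof.
  unfold Ccos; replace (Ci * - a) with (- (Ci * a)) by ring.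
  replace (- - (Ci * a)) with (Ci * a) by ring.
  now rewrite Cplus_comm.
Qed.

Lemma Csin_minus (a b : C) : Csin (a - b) = Csin a * Ccos b - Ccos a * Csin b.
Proof. unfold Cminus; rewrite Csin_plus, Ccos_opp, Csin_opp; ring. Qed.

Lemma Csin2_Ccos2 (a : C) : Csin a * Csin a + Ccos a * Ccos a = 1.
Proof.
  unfold Csin, Ccos; rewrite !Cexp_opp.
  pose proof (Cexp_neq_0 (Ci * a)) as HE.
  pose proof Ci_neq_0; pose proof C2_neq_0.
  set (X := Cexp (Ci * a)) in *.
  transitivity ((X - / X) * (X - / X) / (4 * (Ci * Ci)) + (X + / X) * (X + / X) / 4).
  - field; repeat split; auto; apply RtoC_neq; lra.
  - rewrite Ci_sqr; field; auto.
Qed.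

Lemma Csin_IZR_PI (k : Z) : Csin (RtoC (IZR k) * PI) = 0.
Proof.
  rewrite <- RtoC_mult, Csin_RtoC; f_equal; apply sin_eq_0_1; now exists k.
Qed.

Lemma rGamma_reflection' (z : C) :
  rGamma (z + 1) * rGamma (- z) = - Csin (z * PI) / RtoC PI.
Proof. rewrite (Cplus_comm z); apply rGamma_reflection. Qed.

(** The reflection formula at alpha, for the product that stands in the denominator of every
    boundary term. *)
Lemma Csin_alpha (al : C) :
  rGamma (al + 1) * rGamma (1 - al) * al = Csin (al * PI) / RtoC PI.
Proof.
  pose proof (rGamma_reflection' al) as H; rewrite (rGamma_rec (- al)) in H.
  replace (- al + 1) with (1 - al) in H by ring.
  transitivity (- (rGamma (al + 1) * (- al * rGamma (1 - al)))); [ring |].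
  rewrite H; unfold Cdiv; ring.
Qed.

Lemma PI_neq_0 : RtoC PI <> 0.
Proof. apply RtoC_neq; pose proof PI_RGT_0; lra. Qed.

(** The simple zero of the sine; its slope pi cancels the pi of the reflection formula in both norm
    computations. *)
Lemma Clim_Csin_ratio : Clim (at_right 0) (fun e => Csin (RtoC e * PI) / RtoC e) (RtoC PI).
Proof.
  apply Clim_dominated with (fun e => PI ^ 2 * e)%R.
  - generalize (at_right_between 0 1 Rlt_0_1); apply filter_imp; intros x Hx.
    rewrite <- RtoC_mult, Csin_RtoC, <- RtoC_div, <- RtoC_minus, Cmod_R by lra.
    replace (sin (x * PI) / x - PI)%R with ((sin (x * PI) - x * PI) / x)%R by (field; lra).
    unfold Rdiv; rewrite Rabs_mult, (Rabs_pos_eq (/ x))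
      by (left; apply Rinv_0_lt_compat; lra).
    apply Rmult_le_reg_r with x; [lra |].
    rewrite Rmult_assoc, Rinv_l, Rmult_1_r by lra.
    apply Rle_trans with (1 := sin_minus_bound _); right; ring.
  - assert (H : Clim (at_right 0) (fun e => RtoC (PI ^ 2) * RtoC e) (RtoC (PI ^ 2) * 0)).
    { apply Clim_scal, Clim_RtoC. }
    apply Clim_Re in H; rewrite Cmult_0_r in H.
    apply filterlim_ext with (2 := H); intros e; rewrite Re_scal; reflexivity.
Qed.

(** * Integrals of products of the Jacobi functions, in closed form *)

Section jacobi.

Variables alpha beta : C.
Hypothesis Halpha : -1 < Re alpha < 1.
Hypothesis Halpha0 : alpha <> 0.
Hypothesis Hbeta : -1 < Re beta.

Let r := rGamma.
Let B (q : C) : C := r (q + alpha + beta + 1).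
Let D (q : C) : C := r (q + beta + 1).
Let cc (q : C) : C := 2 * q + alpha + beta + 2.
Let Lam (p q : C) : C := (p - q) * (p + q + alpha + beta + 1).

Let in1 (q : C) : R -> C := CPS (hcoef (- q) (q + alpha + beta + 1) (beta + 1)).
Let out1 (q : C) : R -> C := CPS (hcoef (q + alpha + 1) (q + alpha + beta + 1) (cc q)).

(* Both integrals live on (0,1): the second one is pulled back by [x |-> 1/x]. *)
Let raw1 (p q : C) (x : R) : C := Rcpow x beta * Rcpow (1 - x) alpha * (in1 p x * in1 q x).
Let raw2 (p q : C) (x : R) : C :=
  Rcpow x (p + q + alpha + beta) * Rcpow (1 - x) alpha * (out1 p x * out1 q x).

(** The boundary value at 1 divided by the coefficient [kappa], which is [- Lam p q] here and
    [Lam p q / x] for the pulled-back integral in [form2]. *)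
Let form1 (p q : C) : C :=
  (r (- q) * B q * (D p * r (- (p + alpha))) - r (- p) * B p * (D q * r (- (q + alpha))))
  / (r (beta + 1) * r (beta + 1) * r (alpha + 1) * r (1 - alpha) * alpha * - Lam p q).
Let form2 (p q : C) : C :=
  (r (q + alpha + 1) * B q * (D p * r (p + 1)) - r (p + alpha + 1) * B p * (D q * r (q + 1)))
  / (r (cc p) * r (cc q) * r (alpha + 1) * r (1 - alpha) * alpha * Lam p q).

Let good (q : C) : Prop := (0 < Re (2 * q + alpha + beta + 1)).

Lemma Re_2 (z : C) : Re (2 * z) = (2 * Re z)%R.
Proof. apply Re_scal. Qed.

Lemma good_cc (q : C) : good q -> 0 < Re (cc q).
Proof. unfold good, cc; rewrite !Re_plus, !Re_RtoC; lra. Qed.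

Lemma good_sum (p q : C) : good p -> good q -> 0 < Re (p + q + alpha + beta + 1).
Proof. unfold good; rewrite !Re_plus, !Re_2, !Re_RtoC; lra. Qed.

Lemma r_neq_0 (z : C) : 0 < Re z -> r z <> 0.
Proof. intros H; now apply rGamma_neq_0, Re_pos_not_pole. Qed.

Lemma r_beta : r (beta + 1) <> 0.
Proof. apply r_neq_0; rewrite Re_plus, Re_RtoC; lra. Qed.

Lemma r_alpha : r (alpha + 1) <> 0.
Proof. apply r_neq_0; rewrite Re_plus, Re_RtoC; lra. Qed.

Lemma r_1_alpha : r (1 - alpha) <> 0.
Proof. apply r_neq_0; rewrite Re_minus, Re_RtoC; lra. Qed.

Lemma Csub_neq_0 (x y : C) : x <> y -> x - y <> 0.
Proof. intros H E; apply H; replace x with (x - y + y) by ring; rewrite E; ring. Qed.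

Lemma sum_neq_0 (p q : C) : good p -> good q -> p + q + alpha + beta + 1 <> 0.
Proof.
  intros Hp Hq E; pose proof (good_sum p q Hp Hq) as H; rewrite E, Re_RtoC in H; lra.
Qed.

Lemma Lam_neq_0 (p q : C) : good p -> good q -> p <> q -> Lam p q <> 0.
Proof.
  intros Hp Hq Hpq; apply Cmult_neq_0; [now apply Csub_neq_0 | now apply sum_neq_0].
Qed.

(** The case mu = beta + 1, dl = 0 of the concomitant identity. *)
Lemma raw1_integral (p q : C) :
  good p -> good q -> p <> q -> CRInt_gen (raw1 p q) (at_right 0) (at_left 1) (form1 p q).
Proof.
  intros Hp Hq Hpq.
  pose proof (Lam_neq_0 p q Hp Hq Hpq) as HL.
  assert (Hb : 0 < Re (beta + 1)) by (rewrite Re_plus, Re_RtoC; lra).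
  assert (E1 : - p + (p + alpha + beta + 1) - (beta + 1 + 0) = alpha) by ring.
  assert (E2 : - q + (q + alpha + beta + 1) - (beta + 1 - 0) = alpha) by ring.
  assert (Z1 : beta + 1 + 0 = beta + 1) by ring.
  assert (Z2 : beta + 1 - 0 = beta + 1) by ring.
  assert (Hb1 : 0 < Re (beta + 1 + 0)) by (rewrite Z1; exact Hb).
  assert (Hb2 : 0 < Re (beta + 1 - 0)) by (rewrite Z2; exact Hb).
  pose proof (wronskian_integral _ _ _ _ _ _ _ E1 E2 Hb1 Hb2 Halpha Halpha0 (or_introl eq_refl)) as H.
  rewrite Z1, Z2 in H.
  apply (CRInt_gen_scal _ _ (/ - Lam p q)) in H.
  apply (CRInt_gen_val _ _ _ _ (form1 p q)) in H.
  - apply CRInt_gen_ext_01 with (2 := H); intros x Hx; unfold raw1, in1, Lam.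
    replace (beta + 1 - 1) with beta by ring.
    pose proof (Csub_neq_0 _ _ Hpq); pose proof (sum_neq_0 p q Hp Hq).
    assert (Hx0 : RtoC x <> 0) by (apply RtoC_neq; lra).
    field; auto.
  - unfold form1, B, D.
    replace (beta + 1 - - p) with (p + beta + 1) by ring.
    replace (beta + 1 - - q) with (q + beta + 1) by ring.
    replace (beta + 1 - (p + alpha + beta + 1)) with (- (p + alpha)) by ring.
    replace (beta + 1 - (q + alpha + beta + 1)) with (- (q + alpha)) by ring.
    fold r; pose proof r_beta; pose proof r_alpha; pose proof r_1_alpha.
    field; repeat split; auto.
Qed.

Lemma raw2_integral (p q : C) :
  good p -> good q -> p <> q -> CRInt_gen (raw2 p q) (at_right 0) (at_left 1) (form2 p q).
Proof.
  intros Hp Hq Hpq.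
  pose proof (Lam_neq_0 p q Hp Hq Hpq) as HL.
  (* The lower parameters [cc p] and [cc q] have mean [mu] and half-difference p - q. *)
  set (mu := p + q + alpha + beta + 2).
  assert (Z1 : mu + (p - q) = cc p) by (unfold mu, cc; ring).
  assert (Z2 : mu - (p - q) = cc q) by (unfold mu, cc; ring).
  assert (E1 : p + alpha + 1 + (p + alpha + beta + 1) - (mu + (p - q)) = alpha)
    by (unfold mu; ring).
  assert (E2 : q + alpha + 1 + (q + alpha + beta + 1) - (mu - (p - q)) = alpha)
    by (unfold mu; ring).
  assert (Hb1 : 0 < Re (mu + (p - q))) by (rewrite Z1; now apply good_cc).
  assert (Hb2 : 0 < Re (mu - (p - q))) by (rewrite Z2; now apply good_cc).
  assert (Hmu : 0 < Re (mu - 1)).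
  { replace (mu - 1) with (p + q + alpha + beta + 1) by (unfold mu; ring); now apply good_sum. }
  pose proof (wronskian_integral _ _ _ _ _ _ _ E1 E2 Hb1 Hb2 Halpha Halpha0 (or_intror Hmu)) as H.
  rewrite Z1, Z2 in H.
  apply (CRInt_gen_scal _ _ (/ Lam p q)) in H.
  apply (CRInt_gen_val _ _ _ _ (form2 p q)) in H.
  - apply CRInt_gen_ext_01 with (2 := H); intros x Hx; unfold raw2, out1.
    replace (mu - 1) with (p + q + alpha + beta + 1) by (unfold mu; ring).
    (* This factor x compensates the 1/x to which [kappa] reduces. *)
    rewrite (Rcpow_plus x _ 1), Rcpow_1 by lra.
    assert (Hx0 : RtoC x <> 0) by (apply RtoC_neq; lra).
    pose proof (Csub_neq_0 _ _ Hpq); pose proof (sum_neq_0 p q Hp Hq).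
    unfold Lam; field; auto.
  - unfold form2, B, D.
    replace (cc p - (p + alpha + 1)) with (p + beta + 1) by (unfold cc; ring).
    replace (cc q - (q + alpha + 1)) with (q + beta + 1) by (unfold cc; ring).
    replace (cc p - (p + alpha + beta + 1)) with (p + 1) by (unfold cc; ring).
    replace (cc q - (q + alpha + beta + 1)) with (q + 1) by (unfold cc; ring).
    fold r; pose proof r_alpha; pose proof r_1_alpha.
    pose proof (r_neq_0 _ (good_cc p Hp)); pose proof (r_neq_0 _ (good_cc q Hq)).
    field; repeat split; auto.
Qed.

Lemma good_shift (p : C) (e : R) : good p -> 0 < e -> good (p + RtoC e).
Proof. unfold good; rewrite !Re_plus, !Re_2, !Re_plus, !Re_RtoC; lra. Qed.

Lemma shift_neq (p : C) (e : R) : 0 < e -> p <> p + RtoC e.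
Proof.
  intros He E; apply (RtoC_neq e 0); [lra |].
  replace (RtoC e) with (p + RtoC e - p) by ring; rewrite <- E; ring.
Qed.

(** Shifting the second index to p + e moves (a, b, c) with slopes (-1, 1, 0) and leaves the power
    of x alone. *)
Lemma raw1_square_integral (p : C) :
  good p -> exists L, Clim (at_right 0) (fun e => form1 p (p + RtoC e)) L /\
  CRInt_gen (raw1 p p) (at_right 0) (at_left 1) L.
Proof.
  intros Hp.
  pose proof (hyper_square_integral (- p) (p + alpha + beta + 1) (beta + 1) beta (-1) 1 0 0
    (fun e => form1 p (p + RtoC e))) as H.
  replace (- p + (p + alpha + beta + 1) - (beta + 1)) with alpha in H by ring.
  apply H; clear H; rewrite ?Re_plus, ?Re_RtoC, ?Rabs_R0, ?Rabs_R1; try lra.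
  - rewrite Rabs_left; lra.
  - intros e He.
    apply CRInt_gen_ext_01 with (2 := raw1_integral p (p + RtoC e) Hp
      (good_shift p e Hp (proj1 He)) (shift_neq p e (proj1 He))).
    intros x Hx; unfold raw1, in1.
    replace (RtoC (0 * e)) with (RtoC 0) by (f_equal; ring).
    replace (beta + 0) with beta by ring.
    replace (beta + 1 + 0) with (beta + 1) by ring.
    replace (- p + RtoC (-1 * e)) with (- (p + RtoC e))
      by (replace (-1 * e)%R with (- e)%R by ring; rewrite RtoC_opp; ring).
    replace (p + alpha + beta + 1 + RtoC (1 * e)) with (p + RtoC e + alpha + beta + 1)
      by (rewrite Rmult_1_l; ring).
    reflexivity.
Qed.

(** Here the slopes are (1, 1, 2), and the exponent of x moves as well, with k = 1. *)
Lemma raw2_square_integral (p : C) :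
  good p -> exists L, Clim (at_right 0) (fun e => form2 p (p + RtoC e)) L /\
  CRInt_gen (raw2 p p) (at_right 0) (at_left 1) L.
Proof.
  intros Hp.
  pose proof (hyper_square_integral (p + alpha + 1) (p + alpha + beta + 1) (cc p)
    (p + p + alpha + beta) 1 1 2 1 (fun e => form2 p (p + RtoC e))) as H.
  replace (p + alpha + 1 + (p + alpha + beta + 1) - cc p) with alpha in H by (unfold cc; ring).
  apply H; clear H; rewrite ?Rabs_R1; try lra.
  - now apply good_cc.
  - rewrite Rabs_pos_eq; lra.
  - revert Hp; unfold good; rewrite !Re_plus, Re_2, Re_RtoC; lra.
  - intros e He.
    apply CRInt_gen_ext_01 with (2 := raw2_integral p (p + RtoC e) Hp
      (good_shift p e Hp (proj1 He)) (shift_neq p e (proj1 He))).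
    intros x Hx; unfold raw2, out1; rewrite !Rmult_1_l.
    replace (p + (p + RtoC e) + alpha + beta) with (p + p + alpha + beta + RtoC e) by ring.
    replace (p + RtoC e + alpha + 1) with (p + alpha + 1 + RtoC e) by ring.
    replace (p + RtoC e + alpha + beta + 1) with (p + alpha + beta + 1 + RtoC e) by ring.
    replace (cc (p + RtoC e)) with (cc p + RtoC (2 * e)) by (unfold cc; rewrite RtoC_mult; ring).
    reflexivity.
Qed.

(** * From the two integrals to the bilinear form *)

Let k1 (q : C) : C := Gamma (cc q) / Gamma (beta + 1).
Let k2 (q : C) : C := Gamma (1 + q + alpha) * rGamma (- q).

Lemma Phi_lt_1 (q : C) (x : R) : x < 1 -> Phi alpha beta q x = k1 q * in1 q x.
Proof.
  intros Hx; unfold Phi; destruct (Rlt_dec x 1) as [_ | H]; [| contradiction].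
  now rewrite F_CPS.
Qed.

Lemma Phi_gt_1 (q : C) (x : R) :
  1 < x -> Phi alpha beta q x = k2 q * out1 q (/ x) * Rcpow x (- alpha - beta - q - 1).
Proof.
  intros Hx; unfold Phi; destruct (Rlt_dec x 1) as [H | _]; [lra |].
  destruct (Rlt_dec 1 x) as [_ | H]; [| contradiction].
  rewrite F_CPS; unfold Rdiv; now rewrite Rmult_1_l.
Qed.

Lemma ex_Cder_raw2 (p q : C) (x : R) :
  good p -> good q -> 0 < x < 1 -> exists l, Cder (raw2 p q) x l.
Proof.
  intros Hp Hq Hx; eexists.
  assert (Hx' : Rabs x < 1) by (rewrite Rabs_pos_eq; lra).
  pose proof (radius1_hcoef (p + alpha + 1) (p + alpha + beta + 1) _ (good_cc p Hp)).
  pose proof (radius1_hcoef (q + alpha + 1) (q + alpha + beta + 1) _ (good_cc q Hq)).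
  apply Cder_mult; [apply Cder_mult; [apply Cder_Rcpow; lra | apply Cder_Rcpow_1m; lra] |].
  apply Cder_mult; now apply Cder_CPS.
Qed.

(** [J] and [v] are left abstract, so that the convention for theta = 0 and the general case share
    the transfer of the integrals. *)
Lemma is_form_raw (theta p q I1 I2 : C) :
  good p -> good q ->
  CRInt_gen (raw1 p q) (at_right 0) (at_left 1) I1 ->
  CRInt_gen (raw2 p q) (at_right 0) (at_left 1) I2 ->
  forall J v : C, (theta = 0 -> J = 0) ->
  (theta <> 0 -> J = Csin ((alpha + theta) * PI) / Csin (theta * PI) * (k2 p * k2 q * I2)) ->
  v = k1 p * k1 q * I1 + J ->
  is_form theta alpha beta (Phi alpha beta p) (Phi alpha beta q) v.
Proof.
  intros Hp Hq H1 H2 J v HJ0 HJ Hv.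
  exists (k1 p * k1 q * I1), J; split; [| split; [exact HJ0 | split; [| exact Hv]]].
  - apply CRInt_gen_is_RInt_gen; try typeclasses eauto.
    apply CRInt_gen_ext_01 with (2 := CRInt_gen_scal _ _ (k1 p * k1 q) _ _ H1).
    intros x Hx; unfold raw1; rewrite !Phi_lt_1 by lra; ring.
  - intros Ht; exists (k2 p * k2 q * I2); split; [| now apply HJ].
    apply CRInt_gen_is_RInt_gen; try typeclasses eauto.
    apply CRInt_gen_ext_1_infty with
      (2 := CRInt_gen_scal _ _ (k2 p * k2 q) _ _
        (CRInt_gen_inv_subst _ _ (fun x Hx => ex_Cder_raw2 p q x Hp Hq Hx) H2)).
    intros x Hx; rewrite !Phi_gt_1 by exact Hx; unfold raw2.
    (* (1 - 1/x)^alpha = (x - 1)^alpha x^(-alpha); the Jacobian 1/x^2 and the powers in the two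
       functions account for the rest of the exponent of x. *)
    replace (1 - / x)%R with ((x - 1) * / x)%R by (field; lra).
    assert (Hix : 0 < / x) by (apply Rinv_0_lt_compat; lra).
    rewrite Rcpow_mult, !Rcpow_inv, RtoC_mult by lra.
    unfold Cminus; rewrite !Rcpow_plus, !Rcpow_opp, !Rcpow_plus, !Rcpow_1 by lra.
    assert (Hx0 : RtoC x <> 0) by (apply RtoC_neq; lra).
    pose proof (Rcpow_neq_0 x p); pose proof (Rcpow_neq_0 x q).
    pose proof (Rcpow_neq_0 x alpha); pose proof (Rcpow_neq_0 x beta).
    field; repeat split; auto.
Qed.

(* [T kap q = 0] at every admissible [q] when [kap] is the coefficient of the second integral
   in the form. *)
Let T (kap q : C) : C := Csin ((q + alpha) * PI) - kap * Csin (q * PI).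

(** The reflection formula replaces each sine by values of 1/Gamma, after which the claim is a
    rational identity. It isolates [T kap p] and [T kap q]: orthogonality follows where they vanish,
    the norm from their first-order behaviour. *)
Lemma form_combination (kap p q : C) :
  good p -> good q -> p <> q -> r (1 + p + alpha) <> 0 -> r (1 + q + alpha) <> 0 ->
  k1 p * k1 q * form1 p q + kap * (k2 p * k2 q * form2 p q) =
  - (r (- p) * B p * D q / r (1 + q + alpha) * T kap q
     - r (- q) * B q * D p / r (1 + p + alpha) * T kap p)
  / (r (cc p) * r (cc q) * r (alpha + 1) * r (1 - alpha) * alpha * Lam p q * PI).
Proof.
  intros Hp Hq Hpq Hrp Hrq.
  assert (R1 : forall z, Csin (z * PI) = - (r (z + 1) * r (- z)) * RtoC PI).
  { intros z; unfold r; rewrite rGamma_reflection'; field; apply PI_neq_0. }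
  unfold T; rewrite !R1; unfold k1, k2, form1, form2, Gamma; fold r.
  replace (p + alpha + 1) with (1 + p + alpha) by ring.
  replace (q + alpha + 1) with (1 + q + alpha) by ring.
  pose proof r_beta; pose proof r_alpha; pose proof r_1_alpha; pose proof PI_neq_0.
  pose proof (r_neq_0 _ (good_cc p Hp)); pose proof (r_neq_0 _ (good_cc q Hq)).
  pose proof (Lam_neq_0 p q Hp Hq Hpq).
  field; repeat split; auto.
Qed.

(** * Limits as e -> 0+ and the two norm computations *)

Lemma Clim_shift (p : C) : Clim (at_right 0) (fun e => p + RtoC e) p.
Proof.
  apply Clim_val with (p + 0); [ring |].
  apply Clim_plus; [apply Clim_const | apply Clim_RtoC].
Qed.

Lemma Clim_r_shift (p : C) (f : C -> C) :
  (forall z, f z = z + (f 0)) -> Clim (at_right 0) (fun e => r (f (p + RtoC e))) (r (f p)).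
Proof.
  intros Hf; apply Clim_rGamma.
  apply Clim_val with (p + f 0); [symmetry; apply Hf |].
  apply Clim_ext with (fun e => p + RtoC e + f 0); [intros e; symmetry; apply Hf |].
  apply Clim_plus; [apply Clim_shift | apply Clim_const].
Qed.

Lemma Clim_cc_shift (p : C) : Clim (at_right 0) (fun e => r (cc (p + RtoC e))) (r (cc p)).
Proof.
  apply Clim_rGamma; unfold cc.
  repeat (apply Clim_plus; [| apply Clim_const]).
  apply Clim_scal, Clim_shift.
Qed.

Lemma Clim_k1_shift (p : C) :
  good p -> Clim (at_right 0) (fun e => k1 (p + RtoC e)) (k1 p).
Proof.
  intros Hp; unfold k1, Cdiv; apply Clim_mult; [| apply Clim_const].
  unfold Gamma; apply Clim_inv; [now apply r_neq_0, good_cc | apply Clim_cc_shift].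
Qed.

Lemma Clim_k2_shift (p : C) :
  r (1 + p + alpha) <> 0 -> Clim (at_right 0) (fun e => k2 (p + RtoC e)) (k2 p).
Proof.
  intros Hp; unfold k2; apply Clim_mult.
  - unfold Gamma; apply Clim_inv; [exact Hp |].
    apply Clim_rGamma; apply Clim_plus; [| apply Clim_const].
    apply Clim_plus; [apply Clim_const | apply Clim_shift].
  - apply Clim_rGamma, Clim_opp, Clim_shift.
Qed.

(** [rGamma] is used where p + beta + 1 or p + alpha + beta + 1 may be a pole of Gamma; the norm is
    then 0. *)
Let target (p : C) : C :=
  Cpow (Gamma (cc p)) 2 * Gamma (1 + p + alpha) * Gamma (p + 1)
    * rGamma (p + beta + 1) * rGamma (p + alpha + beta + 1) / (2 * p + alpha + beta + 1).

Lemma good_neq_0 (p : C) : good p -> 2 * p + alpha + beta + 1 <> 0.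
Proof. unfold good; intros H E; rewrite E, Re_RtoC in H; lra. Qed.

Lemma Csin_alpha_neq_0 : Csin (alpha * PI) <> 0.
Proof.
  intros E; pose proof (Csin_alpha alpha) as H; rewrite E in H.
  apply (Cmult_neq_0 (r (alpha + 1) * r (1 - alpha)) alpha).
  - apply Cmult_neq_0; [apply r_alpha | apply r_1_alpha].
  - exact Halpha0.
  - unfold r; rewrite H; unfold Cdiv; ring.
Qed.

Lemma Clim_B_shift (p : C) : Clim (at_right 0) (fun e => B (p + RtoC e)) (B p).
Proof. apply (Clim_r_shift p (fun z => z + alpha + beta + 1)); intros z; ring. Qed.

Lemma Clim_D_shift (p : C) : Clim (at_right 0) (fun e => D (p + RtoC e)) (D p).
Proof. apply (Clim_r_shift p (fun z => z + beta + 1)); intros z; ring. Qed.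

Lemma Clim_r1_shift (p : C) :
  Clim (at_right 0) (fun e => r (1 + (p + RtoC e) + alpha)) (r (1 + p + alpha)).
Proof. apply (Clim_r_shift p (fun z => 1 + z + alpha)); intros z; ring. Qed.

(** With q = p + e, one term of [form_combination] vanishes by T kap p = 0; in the other T kap q = W
    sin(e pi), and the factor p - q = -e of [Lam] leaves sin(e pi)/e. The relation W sin(p pi) = -
    sin(alpha pi) then removes W. *)
Lemma norm_generic (kap p I1 I2 : C) :
  good p -> r (1 + p + alpha) <> 0 -> T kap p = 0 -> Csin (p * PI) <> 0 ->
  Clim (at_right 0) (fun e => form1 p (p + RtoC e)) I1 ->
  Clim (at_right 0) (fun e => form2 p (p + RtoC e)) I2 ->
  k1 p * k1 p * I1 + kap * (k2 p * k2 p * I2) = target p.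
Proof.
  intros Hp Hrp HT Hsp H1 H2.
  set (W := Ccos ((p + alpha) * PI) - kap * Ccos (p * PI)).
  assert (HW : W * Csin (p * PI) = - Csin (alpha * PI)).
  { replace (alpha * PI) with ((p + alpha) * PI - p * PI) by ring.
    rewrite Csin_minus.
    assert (E : Csin ((p + alpha) * PI) = kap * Csin (p * PI)).
    { unfold T in HT; replace (Csin ((p + alpha) * PI)) with
        (Csin ((p + alpha) * PI) - kap * Csin (p * PI) + kap * Csin (p * PI)) by ring.
      rewrite HT; ring. }
    rewrite E; unfold W; ring. }
  pose proof (Csin_alpha alpha) as Ha; fold r in Ha.
  pose proof (rGamma_reflection' p) as Hs; fold r in Hs.
  pose proof PI_neq_0 as Hpi; pose proof Csin_alpha_neq_0 as Hsa.
  pose proof (good_neq_0 p Hp) as Hg; pose proof (r_neq_0 _ (good_cc p Hp)) as Hrc.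
  pose proof r_alpha as Hra; pose proof r_1_alpha as Hra1.
  assert (Hrp1 : r (p + 1) <> 0).
  { intros E; rewrite E in Hs; apply Hsp.
    transitivity (- (- Csin (p * PI) / PI) * PI); [field; exact Hpi |].
    rewrite <- Hs; ring. }
  (* Reflection at p and at alpha converts the trigonometric relation into values of 1/Gamma. *)
  assert (HWr : r (- p) * W * r (p + 1) = r (alpha + 1) * r (1 - alpha) * alpha).
  { rewrite Ha; transitivity ((r (p + 1) * r (- p)) * W); [ring |].
    rewrite Hs; transitivity (- (W * Csin (p * PI)) / PI); [field; exact Hpi |].
    rewrite HW; field; exact Hpi. }
  apply (Clim_unique (Fl := at_right 0) (fun e =>
    k1 p * k1 (p + RtoC e) * form1 p (p + RtoC e)
    + kap * (k2 p * k2 (p + RtoC e) * form2 p (p + RtoC e)))).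
  - apply Clim_plus.
    + apply Clim_mult; [apply Clim_scal; now apply Clim_k1_shift | exact H1].
    + apply Clim_scal, Clim_mult; [apply Clim_scal; now apply Clim_k2_shift | exact H2].
  - apply Clim_ext_loc with (fun e => r (- p) * B p * D (p + RtoC e) / r (1 + (p + RtoC e) + alpha)
      * W * (Csin (RtoC e * PI) / RtoC e)
      / (r (cc p) * r (cc (p + RtoC e)) * (r (alpha + 1) * r (1 - alpha) * alpha)
         * (2 * p + alpha + beta + 1 + RtoC e) * PI)).
    + generalize (filter_and _ _ (at_right_between 0 1 Rlt_0_1)
        (Clim_neq _ _ Hrp (Clim_r1_shift p))); apply filter_imp; intros e [He Hrq].
      assert (Hq : good (p + RtoC e)) by exact (good_shift p e Hp (proj1 He)).
      assert (Hpq : p <> p + RtoC e) by exact (shift_neq p e (proj1 He)).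
      rewrite form_combination by auto.
      assert (HTq : T kap (p + RtoC e) = W * Csin (RtoC e * PI)).
      { unfold T, W.
        replace ((p + RtoC e + alpha) * PI) with ((p + alpha) * PI + RtoC e * PI) by ring.
        replace ((p + RtoC e) * PI) with (p * PI + RtoC e * PI) by ring.
        rewrite !Csin_plus.
        transitivity (T kap p * Ccos (RtoC e * PI) +
          (Ccos ((p + alpha) * PI) - kap * Ccos (p * PI)) * Csin (RtoC e * PI)).
        - unfold T; ring.
        - rewrite HT; ring. }
      rewrite HT, HTq; unfold Lam.
      assert (He0 : RtoC e <> 0) by (apply RtoC_neq; lra).
      pose proof (r_neq_0 _ (good_cc _ Hq)).
      assert (Hge : 2 * p + alpha + beta + 1 + RtoC e <> 0).
      { pose proof (sum_neq_0 _ _ Hp Hq) as Hsum.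
        now replace (p + (p + RtoC e) + alpha + beta + 1)
          with (2 * p + alpha + beta + 1 + RtoC e) in Hsum by ring. }
      replace (p - (p + RtoC e)) with (- RtoC e) by ring.
      replace (p + (p + RtoC e) + alpha + beta + 1) with (2 * p + alpha + beta + 1 + RtoC e) by ring.
      field; repeat split; auto.
    + apply Clim_val with (r (- p) * B p * D p / r (1 + p + alpha) * W * RtoC PI
        / (r (cc p) * r (cc p) * (r (alpha + 1) * r (1 - alpha) * alpha)
           * (2 * p + alpha + beta + 1) * PI)).
      (* The product depending on alpha is replaced so that 1/Gamma(-p) and W cancel; the 1/Gamma(p
         + 1) left in the denominator is the factor Gamma(p + 1) of the norm. *)
      * rewrite <- HWr; unfold target, Gamma, B, D; fold r; simpl Cpow.
        assert (HW0 : W <> 0).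
        { intros E; apply Hsa; replace (Csin (alpha * PI)) with (- - Csin (alpha * PI)) by ring.
          rewrite <- HW, E; ring. }
        assert (Hrmp : r (- p) <> 0).
        { intros E; apply Hsp; transitivity (- (- Csin (p * PI) / PI) * PI); [field; exact Hpi |].
          rewrite <- Hs, E; ring. }
        field; repeat split; auto.
      * apply Clim_div.
        { repeat apply Cmult_neq_0; auto. }
        { apply Clim_mult; [| apply Clim_Csin_ratio].
          apply Clim_mult; [| apply Clim_const].
          apply Clim_div; [exact Hrp | apply Clim_scal, Clim_D_shift | apply Clim_r1_shift]. }
        { apply Clim_mult; [| apply Clim_const]; apply Clim_mult.
          - apply Clim_mult; [| apply Clim_const]; apply Clim_scal, Clim_cc_shift.
          - apply Clim_shift. }
Qed.

(* For [theta = 0] the factor [1/Gamma(-p)] vanishes and the limit comes from [1/Gamma(-p-e)]. *)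
Lemma norm_polynomial (n : nat) (I1 : C) :
  let p := RtoC (INR n) in
  good p -> r (1 + p + alpha) <> 0 ->
  Clim (at_right 0) (fun e => form1 p (p + RtoC e)) I1 ->
  k1 p * k1 p * I1 = target p.
Proof.
  intros p Hp Hrp H1.
  assert (Hsp : Csin (p * PI) = 0).
  { unfold p; rewrite INR_IZR_INZ; apply Csin_IZR_PI. }
  (* cos(p pi) = (-1)^n enters the result only through its square. *)
  assert (Hcp : Ccos (p * PI) * Ccos (p * PI) = 1).
  { rewrite <- (Csin2_Ccos2 (p * PI)), Hsp; ring. }
  assert (Hmp : r (- p) = 0) by apply rGamma_neg_INR.
  pose proof (Csin_alpha alpha) as Ha; fold r in Ha.
  pose proof PI_neq_0 as Hpi; pose proof Csin_alpha_neq_0 as Hsa.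
  pose proof (good_neq_0 p Hp) as Hg; pose proof (r_neq_0 _ (good_cc p Hp)) as Hrc.
  pose proof r_alpha as Hra; pose proof r_1_alpha as Hra1; pose proof r_beta as Hrb.
  assert (Hrp1 : r (p + 1) <> 0).
  { apply r_neq_0; unfold p; rewrite Re_plus, !Re_RtoC; pose proof (pos_INR n); lra. }
  assert (Hrpa : r (- (p + alpha)) = - (Ccos (p * PI) * Csin (alpha * PI)) / (PI * r (1 + p + alpha))).
  { pose proof (rGamma_reflection' (p + alpha)) as H; fold r in H.
    replace (p + alpha + 1) with (1 + p + alpha) in H by ring.
    replace ((p + alpha) * PI) with (p * PI + alpha * PI) in H by ring.
    rewrite Csin_plus, Hsp in H.
    transitivity (r (1 + p + alpha) * r (- (p + alpha)) / r (1 + p + alpha)); [field; exact Hrp |].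
    rewrite H; field; auto. }
  assert (Lr1 : Clim (at_right 0) (fun e => r (p + RtoC e + 1)) (r (p + 1))).
  { apply (Clim_r_shift p (fun z => z + 1)); intros z; ring. }
  apply (Clim_unique (Fl := at_right 0) (fun e =>
    k1 p * k1 (p + RtoC e) * form1 p (p + RtoC e))).
  - apply Clim_mult; [apply Clim_scal; now apply Clim_k1_shift | exact H1].
  - apply Clim_ext_loc with (fun e => B (p + RtoC e) * D p * (Csin (RtoC e * PI) / RtoC e)
      / (r (cc p) * r (cc (p + RtoC e)) * r (p + RtoC e + 1) * r (1 + p + alpha)
         * (2 * p + alpha + beta + 1 + RtoC e) * PI)).
    + generalize (filter_and _ _ (at_right_between 0 1 Rlt_0_1)
        (Clim_neq _ _ Hrp1 Lr1)); apply filter_imp; intros e [He Hrq].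
      assert (Hq : good (p + RtoC e)) by exact (good_shift p e Hp (proj1 He)).
      assert (Hmq : r (- (p + RtoC e)) =
        - (Ccos (p * PI) * Csin (RtoC e * PI)) / (PI * r (p + RtoC e + 1))).
      { pose proof (rGamma_reflection' (p + RtoC e)) as H; fold r in H.
        replace ((p + RtoC e) * PI) with (p * PI + RtoC e * PI) in H by ring.
        rewrite Csin_plus, Hsp in H.
        transitivity (r (p + RtoC e + 1) * r (- (p + RtoC e)) / r (p + RtoC e + 1));
          [field; exact Hrq |].
        rewrite H; field; auto. }
      unfold form1, k1, Gamma; fold r; rewrite Hmp, Hmq, Hrpa; unfold Lam.
      assert (He0 : RtoC e <> 0) by (apply RtoC_neq; lra).
      pose proof (r_neq_0 _ (good_cc _ Hq)).
      assert (Hge : 2 * p + alpha + beta + 1 + RtoC e <> 0).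
      { pose proof (sum_neq_0 _ _ Hp Hq) as Hsum.
        now replace (p + (p + RtoC e) + alpha + beta + 1)
          with (2 * p + alpha + beta + 1 + RtoC e) in Hsum by ring. }
      replace (p - (p + RtoC e)) with (- RtoC e) by ring.
      replace (p + (p + RtoC e) + alpha + beta + 1) with (2 * p + alpha + beta + 1 + RtoC e) by ring.
      replace (r (beta + 1) * r (beta + 1) * r (alpha + 1) * r (1 - alpha) * alpha) with
        (r (beta + 1) * r (beta + 1) * (r (alpha + 1) * r (1 - alpha) * alpha)) by ring.
      rewrite Ha.
      (* A factor 1 = cos(p pi)^2 is inserted to match the two signs coming from 1/Gamma(-p - e) and
         1/Gamma(-(p + alpha)). *)
      transitivity ((Ccos (p * PI) * Ccos (p * PI)) *
        (B (p + RtoC e) * D p * (Csin (RtoC e * PI) / RtoC e)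
      / (r (cc p) * r (cc (p + RtoC e)) * r (p + RtoC e + 1) * r (1 + p + alpha)
         * (2 * p + alpha + beta + 1 + RtoC e) * PI))).
      * rewrite Hcp; ring.
      * field; repeat split; auto.
    + apply Clim_val with (B p * D p * RtoC PI
        / (r (cc p) * r (cc p) * r (p + 1) * r (1 + p + alpha)
           * (2 * p + alpha + beta + 1) * PI)).
      * unfold target, Gamma, B, D; fold r; simpl Cpow; field; repeat split; auto.
      * apply Clim_div.
        { repeat apply Cmult_neq_0; auto. }
        { apply Clim_mult; [| apply Clim_Csin_ratio].
          apply Clim_mult; [apply Clim_B_shift | apply Clim_const]. }
        { apply Clim_mult; [| apply Clim_const]; apply Clim_mult; [| apply Clim_shift].
          apply Clim_mult; [| apply Clim_const]; apply Clim_mult; [| exact Lr1].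
          apply Clim_scal, Clim_cc_shift. }
Qed.

(** * Admissible indices: orthogonality and norm *)

Section admissible_indices.

Variable theta : C.
Hypothesis Htheta : 0 <= Re theta < 1.

Lemma admissible_good (p : C) : admissible theta alpha beta p -> good p.
Proof. intros [_ [H _]]; exact H. Qed.

Lemma admissible_r (p : C) : admissible theta alpha beta p -> r (1 + p + alpha) <> 0.
Proof. intros [_ [_ [H _]]]; now apply rGamma_neq_0. Qed.

(** By reflection a zero of sin(theta pi) would be a zero of 1/Gamma(theta + 1) or of
    1/Gamma(-theta), and the strip 0 <= Re theta < 1 leaves only theta = 0. *)
Lemma Csin_theta_neq_0 : theta <> 0 -> Csin (theta * PI) <> 0.
Proof.
  intros Ht E; pose proof (rGamma_reflection' theta) as H; rewrite E in H.
  apply (Cmult_neq_0 (r (theta + 1)) (r (- theta))).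
  - apply r_neq_0; rewrite Re_plus, Re_RtoC; lra.
  - apply rGamma_neq_0; intros k Ek.
    assert (Et : theta = RtoC (INR k)).
    { replace theta with (- - theta) by ring; rewrite Ek; ring. }
    rewrite Et, Re_RtoC in Htheta; destruct k as [| k].
    + apply Ht, Et.
    + rewrite S_INR in Htheta; pose proof (pos_INR k); lra.
  - unfold r; rewrite H; unfold Cdiv; ring.
Qed.

Lemma Csin_shift_IZR (z : C) (k : Z) :
  Csin ((z + RtoC (IZR k)) * PI) = Csin (z * PI) * Ccos (RtoC (IZR k) * PI).
Proof.
  replace ((z + RtoC (IZR k)) * PI) with (z * PI + RtoC (IZR k) * PI) by ring.
  rewrite Csin_plus, Csin_IZR_PI; ring.
Qed.

(** Adding an integer k to theta multiplies both sines by the same cos(k pi), so one coefficient of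
    the second integral serves every index. *)
Lemma T_admissible (p : C) :
  theta <> 0 -> admissible theta alpha beta p ->
  T (Csin ((alpha + theta) * PI) / Csin (theta * PI)) p = 0.
Proof.
  intros Ht [[k Hk] _]; unfold T.
  assert (Ep : p = theta + RtoC (IZR k)) by (rewrite <- Hk; ring).
  rewrite Ep; replace (theta + RtoC (IZR k) + alpha) with (alpha + theta + RtoC (IZR k)) by ring.
  rewrite !Csin_shift_IZR; field; now apply Csin_theta_neq_0.
Qed.

Lemma Csin_admissible_neq_0 (p : C) :
  theta <> 0 -> admissible theta alpha beta p -> Csin (p * PI) <> 0.
Proof.
  intros Ht [[k Hk] _].
  assert (Ep : p = theta + RtoC (IZR k)) by (rewrite <- Hk; ring).
  rewrite Ep, Csin_shift_IZR; apply Cmult_neq_0; [now apply Csin_theta_neq_0 |].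
  intros E; pose proof (Csin2_Ccos2 (RtoC (IZR k) * PI)) as H.
  rewrite E, Csin_IZR_PI in H.
  apply (RtoC_neq 0 1); [lra |]; rewrite <- H; ring.
Qed.

Lemma Phi_orthogonal (p q : C) :
  admissible theta alpha beta p -> admissible theta alpha beta q -> p <> q ->
  is_form theta alpha beta (Phi alpha beta p) (Phi alpha beta q) 0.
Proof.
  intros Hp Hq Hpq.
  pose proof (admissible_good p Hp) as Gp; pose proof (admissible_good q Hq) as Gq.
  pose proof (raw1_integral p q Gp Gq Hpq) as H1.
  pose proof (raw2_integral p q Gp Gq Hpq) as H2.
  destruct (Ceq_dec theta 0) as [Ht | Ht].
  - apply (is_form_raw theta p q _ _ Gp Gq H1 H2 0); [auto | contradiction |].
    destruct Hp as [_ [_ [_ Hp]]]; destruct (Hp Ht) as [n Hn].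
    destruct Hq as [_ [_ [_ Hq]]]; destruct (Hq Ht) as [m Hm].
    (* Each term of [form1] contains 1/Gamma(-p) or 1/Gamma(-q), so the first integral vanishes by
       itself. *)
    assert (E1 : r (- p) = 0) by (rewrite Hn; apply rGamma_neg_INR).
    assert (E2 : r (- q) = 0) by (rewrite Hm; apply rGamma_neg_INR).
    unfold form1; rewrite E1, E2; unfold Cdiv; ring.
  - set (kap := Csin ((alpha + theta) * PI) / Csin (theta * PI)).
    apply (is_form_raw theta p q _ _ Gp Gq H1 H2 (kap * (k2 p * k2 q * form2 p q)));
      [contradiction | auto |].
    rewrite form_combination by (auto; now apply admissible_r).
    unfold kap; rewrite !T_admissible by auto; unfold Cdiv; ring.
Qed.

Lemma Phi_norm (p : C) :
  admissible theta alpha beta p ->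
  is_form theta alpha beta (Phi alpha beta p) (Phi alpha beta p) (target p).
Proof.
  intros Hp.
  pose proof (admissible_good p Hp) as Gp; pose proof (admissible_r p Hp) as Rp.
  destruct (raw1_square_integral p Gp) as [I1 [L1 H1]].
  destruct (raw2_square_integral p Gp) as [I2 [L2 H2]].
  destruct (Ceq_dec theta 0) as [Ht | Ht].
  - apply (is_form_raw theta p p _ _ Gp Gp H1 H2 0); [auto | contradiction |].
    destruct Hp as [_ [_ [_ Hp]]]; destruct (Hp Ht) as [n Hn].
    rewrite Hn in Gp, Rp, L1 |- *.
    rewrite (norm_polynomial n I1 Gp Rp L1); ring.
  - set (kap := Csin ((alpha + theta) * PI) / Csin (theta * PI)).
    apply (is_form_raw theta p p _ _ Gp Gp H1 H2 (kap * (k2 p * k2 p * I2)));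
      [contradiction | auto |].
    symmetry; apply norm_generic; auto.
    + now apply T_admissible.
    + now apply Csin_admissible_neq_0.
Qed.

End admissible_indices.

End jacobi.

Theorem theorem1 (alpha beta theta p q : C)
  (Htheta : (0 <= Re theta < 1)%R)
  (Halpha : (-1 < Re alpha < 1)%R)
  (Halpha0 : alpha <> 0)
  (Hbeta : (-1 < Re beta)%R)
  (Hp : admissible theta alpha beta p)
  (Hq : admissible theta alpha beta q) :
  (p <> q ->
     is_form theta alpha beta (Phi alpha beta p) (Phi alpha beta q) 0) /\
  is_form theta alpha beta (Phi alpha beta p) (Phi alpha beta p)
    (Cpow (Gamma (2 * p + alpha + beta + 2)) 2
       * Gamma (1 + p + alpha) * Gamma (p + 1)
       * rGamma (p + beta + 1) * rGamma (p + alpha + beta + 1)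
     / (2 * p + alpha + beta + 1)).
Proof.
  split.
  - intros Hpq; now apply Phi_orthogonal.
  - now apply Phi_norm.
Qed.
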